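(* Let $\mathcal L\subset\mathbb R^d$ be an $(r,R)$-Delone set and let $\dot{\mathfrak H}(\mathcal L)=\varprojlim_N\bigoplus_{n=0}^N\mathfrak H_n$ be the core algebra of physical Galilean and gauge invariant Hamiltonians with finite interaction range. The inverse limit in the category of topological $\ast$-algebras of the projective tower of $C^\ast$-algebras $$\cdots\twoheadrightarrow\bigoplus_{n=0}^{N+1}\mathcal M(\mathfrak G_n(\mathcal L))\twoheadrightarrow\bigoplus_{n=0}^{N}\mathcal M(\mathfrak G_n(\mathcal L))\twoheadrightarrow\cdots\twoheadrightarrow0,$$ denoted $\mathfrak H(\mathcal L)$, is a pro-$C^\ast$-algebra, the tower defining $\dot{\mathfrak H}(\mathcal L)$ embeds into this tower through the inclusions $\mathfrak H_n\subset\mathcal M(\mathfrak G_n(\mathcal L))$ in $\mathbb B(\mathcal F_n^{(-)}(\mathcal L))$, and this gives a faithful (injective) algebra morphism $\dot{\mathfrak H}(\mathcal L)\rightarrowtail\mathfrak H(\mathcal L)$.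
   Context: **Patterns.** Fix $d\ge1$, $0<r<R$. $\mathcal L\subset\mathbb R^d$ (discrete, infinite) is $(r,R)$-Delone if each closed ball of radius $r$ contains at most one point and each closed ball of radius $R$ at least one point of $\mathcal L$; $\mathrm{Del}$ is the set of these, with the topology of the metric $D(\Lambda,\Lambda')=\inf\{1/(1+\rho):d_H(\Lambda[\rho],\Lambda'[\rho])<1/\rho\}$, $\Lambda[\rho]=(\Lambda\cap B(0,\rho))\cup\partial B(0,\rho)$, $d_H$ the Hausdorff distance. $\widehat{\mathrm{Del}}^{(n)}$ is the set of triples $\xi=(\mathcal L_\xi,V_\xi,\chi_\xi)$ with $\mathcal L_\xi\in\mathrm{Del}$, $V_\xi\subset\mathcal L_\xi$, $|V_\xi|=n$, $\chi_\xi:\{1,\dots,n\}\to V_\xi$ a bijection. Basic neighborhoods of $(\mathcal L,V,\chi)$: all $(\mathcal L',V',g\circ\chi)$ with $d_H(\mathcal L[M],\mathcal L'[M])<\epsilon$, $V'\subset\mathcal L'$, $|V'|=n$, $d_H(V,V')<\epsilon$, $g:V\to V'$ the unique bijection with $|g(v)-v|<\epsilon$ ($\epsilon<r/2$, $M$ large). $\widehat{\mathrm{Del}}^{(n,n)}=\{(\xi,\zeta):\mathcal L_\xi=\mathcal L_\zeta\}\subset\widehat{\mathrm{Del}}^{(n)}\times\widehat{\mathrm{Del}}^{(n)}$. $\hat{\mathfrak t}_x\xi=(\mathcal L_\xi-x,V_\xi-x,\chi_\xi(\cdot)-x)$, acting diagonally on pairs; $\Lambda_s\xi=(\mathcal L_\xi,V_\xi,\chi_\xi\circ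 s^{-1})$ for $s\in\mathcal S_n$. **Coefficients and derivations.** A continuous bi-equivariant $n$-coefficient is a function $q_n:\widehat{\mathrm{Del}}^{(n,n)}\to\mathbb C$ induced from a continuous compactly supported function on the quotient of $\widehat{\mathrm{Del}}^{(n,n)}$ by $\mathbb R^d$ and with $q_n(\Lambda_{s_1}\xi,\Lambda_{s_2}^{-1}\zeta)=(-1)^{s_1}q_n(\xi,\zeta)(-1)^{s_2}$. $\mathrm{CAR}(\mathcal L)$ is the $C^\ast$-algebra generated by $a_x$, $x\in\mathcal L$, with $a_xa_{x'}+a_{x'}a_x=0$, $a_x^\ast a_{x'}+a_{x'}a_x^\ast=\delta_{x,x'}$; it is the limit of $\mathrm{CAR}(\mathcal L_k)$ for increasing finite $\mathcal L_k$ exhausting $\mathcal L$; $\mathcal D(\mathcal L)=\bigcup_k\mathrm{CAR}(\mathcal L_k)$. $\boldsymbol a(\xi)=a_{\chi_\xi(n)}\cdots a_{\chi_\xi(1)}$, $\boldsymbol a^\ast(\xi)=\boldsymbol a(\xi)^\ast$. To $q_n$ corresponds the formal sum $Q^n_{\mathcal L}=\frac1{n!}\sum_{\mathcal L_\xi=\mathcal L_\zeta=\mathcal L}q_n(\xi,\zeta)\boldsymbol a^\ast(\xi)\boldsymbol a(\zeta)$, $n\ge1$, and the derivation $\mathrm{ad}_{Q^n_{\mathcal L}}(A)=\lim_k\imath[A,Q^n_{\mathcal L_k}]$ of $\mathcal D(\mathcal L)$ ($Q^n_{\mathcal L_k}$: terms with $V_\xi,V_\zeta\subset\mathcal L_k$;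 the sequence is eventually constant). **Quotients and $\mathfrak H_N$.** $\mathrm{GI}_N(\mathcal L)$ is the closed linear span of $\boldsymbol a^\ast(\xi)\boldsymbol a(\zeta)$, $\mathcal L_\xi=\mathcal L_\zeta=\mathcal L$, $|V_\xi|=|V_\zeta|\ge N$ (for $N=0$ including the unit), an ideal of the gauge invariant algebra $\mathrm{GI}_0(\mathcal L)$. $\mathcal F_N^{(-)}(\mathcal L)$ is the Hilbert space spanned by $|\xi\rangle$, $\xi\in\widehat{\mathrm{Del}}^{(N)}$, $\mathcal L_\xi=\mathcal L$, with $\langle\xi|\zeta\rangle=(-1)^{\chi_\xi^{-1}\circ\chi_\zeta}$ if $V_\xi=V_\zeta$, else $0$. The map $[\boldsymbol a^\ast(\xi)\boldsymbol a(\zeta)]\mapsto|\xi\rangle\langle\zeta|$ gives $\mathrm{GI}_N(\mathcal L)/\mathrm{GI}_{N+1}(\mathcal L)\simeq\mathbb K(\mathcal F_N^{(-)}(\mathcal L))$, and $\mathrm{ad}_{Q^n_{\mathcal L}}$ descends to a bounded derivation $\widehat{\mathrm{ad}}^N_{Q^n_{\mathcal L}}$ of $\mathbb K(\mathcal F_N^{(-)}(\mathcal L))$. For $N\ge1$, $\mathfrak H_N$ is the subalgebra of $\mathbb B(\mathcal F_N^{(-)}(\mathcal L))$ generated by all $B$ such that $\widehat{\mathrm{ad}}^N_{Q^n_{\mathcal L}}=\imath[\cdot,B]$ for some formal sum $Q^n_{\mathcal L}=\frac1{n!}\sum_{\mathcal L_\xi=\mathcal L_\zeta=\mathcal L}q_n(\xi,\zeta)\boldsymbol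 a^\ast(\xi)\boldsymbol a(\zeta)$ with $n\ge1$ and $q_n$ a continuous bi-equivariant $n$-coefficient; $\mathfrak H_0=\mathbb C$. **$\mathfrak G_N(\mathcal L)$.** For $N\ge1$ it is the norm closure in $\mathbb B(\mathcal F^{(-)}_N(\mathcal L))$ of the set of operators $\frac1{N!}\sum_{\mathcal L_\xi=\mathcal L_\zeta=\mathcal L}q_N(\xi,\zeta)|\xi\rangle\langle\zeta|$, $q_N$ a continuous bi-equivariant $N$-coefficient; it is a $C^\ast$-algebra; $\mathfrak G_0(\mathcal L)=\mathbb C$. $\mathcal M$ is the multiplier algebra, realized as $\{T\in\mathbb B(\mathcal F_n^{(-)}(\mathcal L)):T\mathfrak G_n,\mathfrak G_nT\subset\mathfrak G_n\}$. A pro-$C^\ast$-algebra is a complete topological $\ast$-algebra whose topology is given by its continuous $C^\ast$-seminorms (equivalently an inverse limit of $C^\ast$-algebras). *)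

(* Defs.v *)
From HB Require Import structures.
From mathcomp Require Import all_boot all_order all_algebra all_fingroup.
From mathcomp Require Import generic_quotient complex.
From mathcomp Require Import all_classical all_reals.
From mathcomp Require Import ereal topology normedtype sequences.

Set Implicit Arguments.
Unset Strict Implicit.
Unset Printing Implicit Defensive.

Import Order.TTheory GRing.Theory Num.Theory.
Import numFieldNormedType.Exports.

Local Open Scope classical_set_scope.
Local Open Scope complex_scope.
Local Open Scope ring_scope.

(* Algebras are those of the library: associative, unital, with 1 != 0. *)
HB.mixin Record isStarAlgebra (R : realType) A of GRing.Algebra R[i] A := {
  star : A -> A;
  starK : involutive star;
  starD : {morph star : x y / x + y};
  starZ : forall (c : R[i]) (x : A), star (c *: x) = c^* *: star x;
  starM : forall x y : A, star (x * y) = star y * star x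
}.

#[short(type="starAlgType")]
HB.structure Definition StarAlgebra (R : realType) :=
  {A of isStarAlgebra R A & GRing.Algebra R[i] A}.

HB.mixin Record isTopStarAlgebra (R : realType) A
    of StarAlgebra R A & TopologicalLmodule R[i] A := {
  mul_continuous : continuous (fun x : A * A => x.1 * x.2);
  star_continuous : continuous (star : A -> A)
}.

#[short(type="topStarAlgType")]
HB.structure Definition TopStarAlgebra (R : realType) :=
  {A of isTopStarAlgebra R A & StarAlgebra R A & TopologicalLmodule R[i] A}.

(* Cauchy filters and completeness of a topological vector space for the
   uniformity of its additive group. *)
Definition add_cauchy (R : realType) (V : topologicalLmodType R[i])
    (Fl : set_system V) : Prop :=
  forall U : set V, nbhs 0 U ->
    exists2 B : set V, Fl B & forall x y, B x -> B y -> U (x - y).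

Definition add_complete (R : realType) (V : topologicalLmodType R[i]) : Prop :=
  forall Fl : set_system V, ProperFilter Fl -> add_cauchy Fl ->
    exists x : V, Fl --> x.

(* The library norm structures cannot be joined with a ring that is not a
   numDomainType, hence the norm is a separate operation here, required to
   induce the topology. *)
HB.mixin Record isCStarAlgebra (R : realType) A of TopStarAlgebra R A := {
  cnorm : A -> R;
  cnorm_eq0 : forall x : A, cnorm x = 0 -> x = 0;
  cnormD : forall x y : A, cnorm (x + y) <= cnorm x + cnorm y;
  cnormZ : forall (c : R[i]) (x : A), (cnorm (c *: x))%:C = `|c| * (cnorm x)%:C;
  cnormM : forall x y : A, cnorm (x * y) <= cnorm x * cnorm y;
  cnorm_star : forall x : A, cnorm (star x * x) = cnorm x ^+ 2;
  cnorm_nbhs : forall (x : A) (U : set A),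
    nbhs x U <-> exists2 e : R, 0 < e & [set y | cnorm (y - x) < e] `<=` U;
  cnorm_complete : add_complete (A : topologicalLmodType R[i])
}.

#[short(type="cstarAlgType")]
HB.structure Definition CStarAlgebra (R : realType) :=
  {A of isCStarAlgebra R A & TopStarAlgebra R A}.

(* The inner product is linear in its second argument. *)
HB.mixin Record isHilbert (R : realType) H of CompleteNormedModule R[i] H := {
  inner : H -> H -> R[i];
  inner_linear : forall u (c : R[i]) v w,
    inner u (c *: v + w) = c * inner u v + inner u w;
  inner_conj : forall u v, inner v u = (inner u v)^*;
  inner_norm : forall u, inner u u = `|u| ^+ 2
}.

#[short(type="hilbertType")]
HB.structure Definition Hilbert (R : realType) :=
  {H of isHilbert R H & CompleteNormedModule R[i] H}.

Section ProCStar.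
Context (R : realType).

Definition star_morphism (A B : starAlgType R) (f : A -> B) : Prop :=
  forall x, f (star x) = star (f x).

Definition cstar_seminorm (X : topStarAlgType R) (s : X -> R) : Prop :=
  [/\ forall x y, s (x + y) <= s x + s y,
      forall (c : R[i]) x, (s (c *: x))%:C = `|c| * (s x)%:C,
      forall x y, s (x * y) <= s x * s y &
      forall x, s (star x * x) = s x ^+ 2].

(* By translation it suffices to describe the neighborhoods of 0. *)
Definition pro_cstar (X : topStarAlgType R) : Prop :=
  [/\ hausdorff_space X, add_complete X &
      forall U : set X, nbhs 0 U ->
        exists m (s : 'I_m -> X -> R) (e : R),
          [/\ forall i, cstar_seminorm (s i) /\ continuous (s i), 0 < e &
              [set x | forall i, s i x < e] `<=` U]].

Definition topstar_morphism (A B : topStarAlgType R) (f : A -> B) : Prop :=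
  continuous f /\ star_morphism f.

Definition is_inverse_limit (A : nat -> topStarAlgType R)
    (conn : forall N, {lrmorphism A N.+1 -> A N})
    (X : topStarAlgType R) (p : forall N, {lrmorphism X -> A N}) : Prop :=
  [/\ forall N, topstar_morphism (p N),
      forall N x, conn N (p N.+1 x) = p N x &
      forall (Y : topStarAlgType R) (f : forall N, {lrmorphism Y -> A N}),
        (forall N, topstar_morphism (f N)) ->
        (forall N y, conn N (f N.+1 y) = f N y) ->
        exists g : {lrmorphism Y -> X},
          [/\ topstar_morphism g, forall N y, p N (g y) = f N y &
              forall h : {lrmorphism Y -> X}, topstar_morphism h ->
                (forall N y, p N (h y) = f N y) -> h =1 g]].

Definition is_algebra_limit (B : nat -> algType R[i])
    (conn : forall N, {lrmorphism B N.+1 -> B N})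
    (X : algType R[i]) (p : forall N, {lrmorphism X -> B N}) : Prop :=
  (forall N x, conn N (p N.+1 x) = p N x) /\
  forall b : forall N, B N, (forall N, conn N (b N.+1) = b N) ->
    exists! x : X, forall N, p N x = b N.

Definition closed_span (V : topologicalLmodType R[i]) (S : set V) : set V :=
  [set x | forall W : set V, closed W -> W 0 ->
     (forall (c : R[i]) u v, W u -> W v -> W (c *: u + v)) ->
     S `<=` W -> W x].

Definition cstar_generated (A : cstarAlgType R) (S : set A) : set A :=
  [set x | forall W : set A, closed W -> W 1 ->
     (forall (c : R[i]) u v, W u -> W v -> W (c *: u + v)) ->
     (forall u v, W u -> W v -> W (u * v)) ->
     (forall u, W u -> W (star u)) ->
     S `<=` W -> W x].

End ProCStar.

(* Operators on a Hilbert space are represented by their underlying functions;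
   B(H) is the set bounded_op. *)
Section Operators.
Context (R : realType) (H : hilbertType R).
Implicit Types (S T : H -> H) (U : set (H -> H)).

Definition op_bound T (k : R) : Prop := forall u, `|T u| <= k%:C * `|u|.

Definition bounded_op T : Prop :=
  (forall (c : R[i]) u v, T (c *: u + v) = c *: T u + T v) /\
  exists k, op_bound T k.

Definition compact_op T : Prop :=
  bounded_op T /\ compact (closure (T @` [set u | `|u| <= 1])).

Definition ketbra (u v : H) : H -> H := fun w => inner v w *: u.

Definition scalar_ops : set (H -> H) :=
  [set T | exists c : R[i], T = fun u => c *: u].

Definition norm_closure U : set (H -> H) :=
  [set T | bounded_op T /\ forall e : R, 0 < e ->
     exists2 S, U S & op_bound (fun u => T u - S u) e].

Definition op_generated U : set (H -> H) :=
  [set T | forall W : set (H -> H), W id ->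
     (forall (c : R[i]) S1 S2, W S1 -> W S2 -> W (fun u => c *: S1 u + S2 u)) ->
     (forall S1 S2, W S1 -> W S2 -> W (S1 \o S2)) ->
     U `<=` W -> W T].

Definition multipliers U : set (H -> H) :=
  [set T | bounded_op T /\ forall S, U S -> U (T \o S) /\ U (S \o T)].

(* Bounded derivations of the algebra K(H), as functions of which only the
   values on compact operators matter. *)
Definition bounded_derivation (delta : (H -> H) -> H -> H) : Prop :=
  [/\ forall T, compact_op T -> compact_op (delta T),
      forall (c : R[i]) S T, compact_op S -> compact_op T ->
        delta (fun u => c *: S u + T u) = (fun u => c *: delta S u + delta T u),
      forall S T, compact_op S -> compact_op T ->
        delta (S \o T) = (fun u => delta S (T u) + S (delta T u)) &
      exists2 k : R, 0 <= k & forall T c, compact_op T -> 0 <= c ->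
        op_bound T c -> op_bound (delta T) (k * c)].

End Operators.

Section DirectSums.
Context (R : realType) (F : nat -> hilbertType R)
  (S : forall n, set (F n -> F n)) (N : nat).

(* B is the direct sum over n <= N of the algebras of operators S n, the map
   ev n being the projection to the n-th summand. *)
Definition is_op_sum (B : algType R[i])
    (ev : forall n : 'I_N.+1, B -> F n -> F n) : Prop :=
  [/\ forall n (c : R[i]) x y,
        ev n (c *: x + y) = (fun u => c *: ev n x u + ev n y u),
      forall n, ev n 1 = id,
      forall n x y, ev n (x * y) = ev n x \o ev n y,
      forall n x, S (ev n x) &
      forall T : forall n : 'I_N.+1, F n -> F n, (forall n, S (T n)) ->
        exists! x : B, forall n, ev n x = T n].

(* Likewise as C*-algebras: the involution is the adjoint, and the norm is the
   maximum of the operator norms of the components. *)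
Definition is_cstar_sum (A : cstarAlgType R)
    (ev : forall n : 'I_N.+1, A -> F n -> F n) : Prop :=
  [/\ is_op_sum ev,
      forall n x u v, inner (ev n (star x) u) v = inner u (ev n x v) &
      forall x (k : R), 0 <= k ->
        cnorm x <= k <-> forall n, op_bound (ev n x) k].

End DirectSums.

Section Delone.
Context (R : realType) (d : nat).
Local Notation E := 'rV[R]_d.

Definition enorm (x : E) : R := Num.sqrt (\sum_(i < d) x 0 i ^+ 2).

(* Such a set is automatically discrete, and infinite when 0 < d. *)
Definition delone (r rho : R) (L : set E) : Prop :=
  (forall c x y, L x -> L y -> enorm (x - c) <= r -> enorm (y - c) <= r ->
     x = y) /\
  (forall c, exists2 x, L x & enorm (x - c) <= rho).

Definition hausdorff_dist (A B : set E) : \bar R :=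
  let excess (X Y : set E) : \bar R :=
    ereal_sup [set ereal_inf [set (enorm (x - y))%:E | y in Y] | x in X] in
  maxe (excess A B) (excess B A).

Definition window (L : set E) (M : R) : set E :=
  [set x | L x /\ enorm x <= M] `|` [set x | enorm x = M].

Lemma delone_shift r rho L (x : E) :
  delone r rho L -> delone r rho [set y | L (y + x)].
Proof.
case=> sep dense; split=> [c y z Ly Lz cy cz|c].
  apply: (addIr x); apply: (sep (c + x)) => //.
    by rewrite opprD addrACA subrr addr0.
  by rewrite opprD addrACA subrr addr0.
have [y Ly cy] := dense (c + x); exists (y - x); rewrite /= ?subrK//.
by rewrite -addrA -opprD [x + c]addrC.
Qed.

End Delone.

(* A labelled pattern (L, V, chi): V is the image of the injective labelling
   lab : 'I_n -> L, so |V| = n and lab is a bijection onto V. *)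
Record pattern (R : realType) (d : nat) (r rho : R) (n : nat) := Pattern {
  lat : set 'rV[R]_d;
  lab : 'I_n -> 'rV[R]_d;
  lat_delone : delone r rho lat;
  lab_inj : injective lab;
  lab_lat : forall i, lat (lab i)
}.

Section Patterns.
Context (R : realType) (d : nat) (r rho : R).
Local Notation E := 'rV[R]_d.
Local Notation pat n := (pattern d r rho n).

HB.instance Definition _ n := gen_eqMixin (pat n).
HB.instance Definition _ n := gen_choiceMixin (pat n).

Lemma pattern_eq n (xi zeta : pat n) :
  lat xi = lat zeta -> lab xi =1 lab zeta -> xi = zeta.
Proof.
case: xi zeta => [L f dL fi fL] [L' f' dL' fi' fL'] /= eL /funext ef.
by subst L' f'; congr Pattern; exact: Prop_irrelevance.
Qed.

Definition points n (xi : pat n) : set E := range (lab xi).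

(* The bijection g from V to V' moving points by less than e is encoded by the
   labellings: chi' = g \o chi.  The condition d_H(V, V') < e follows. *)
Definition basic_nbhs n (xi : pat n) (M e : R) : set (pat n) :=
  [set xi' | (hausdorff_dist (window (lat xi) M) (window (lat xi') M) < e%:E)%E
     /\ forall i, enorm (lab xi' i - lab xi i) < e].

(* hausdorff_dist (window L M) (window L' M) is nondecreasing in M, so allowing
   all M > 0, instead of large M, gives the same topology; the sets basic_nbhs
   are open and form a base. *)
HB.instance Definition _ n := @isSubBaseTopological.Build (pat n) (set (pat n))
  [set U | exists xi M e, [/\ 0 < M, 0 < e, e < r / 2 & U = basic_nbhs xi M e]]
  id.

Lemma translate_inj n (xi : pat n) (x : E) :
  injective (fun i => lab xi i - x).
Proof. by move=> i j /addIr /lab_inj. Qed.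

Lemma translate_lat n (xi : pat n) (x : E) i :
  [set y | lat xi (y + x)] (lab xi i - x).
Proof. by rewrite /= subrK; exact: lab_lat. Qed.

Definition translate n (x : E) (xi : pat n) : pat n :=
  Pattern (delone_shift x (lat_delone xi)) (translate_inj (x := x))
    (@translate_lat n xi x).

Lemma relabel_inj n (s : 'S_n) (xi : pat n) :
  injective (fun i => lab xi ((s^-1)%g i)).
Proof. by move=> i j /lab_inj /perm_inj. Qed.

Definition relabel n (s : 'S_n) (xi : pat n) : pat n :=
  Pattern (lat_delone xi) (@relabel_inj n s xi)
    (fun i => lab_lat xi ((s^-1)%g i)).

Definition pat_pair n : Type :=
  set_type [set p : pat n * pat n | lat p.1 = lat p.2].
HB.instance Definition _ n := Topological.on (pat_pair n).

Definition ppl n (p : pat_pair n) : pat n := (val p).1.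
Definition ppr n (p : pat_pair n) : pat n := (val p).2.

Definition translation_equiv n (p p' : pat_pair n) : bool :=
  `[< exists x, ppl p' = translate x (ppl p) /\ ppr p' = translate x (ppr p) >].

Lemma translate0 n (xi : pat n) : translate 0 xi = xi.
Proof.
apply: pattern_eq => [|i] /=; last by rewrite subr0.
by apply/seteqP; split=> y /=; rewrite addr0.
Qed.

Lemma translateD n x y (xi : pat n) :
  translate x (translate y xi) = translate (x + y) xi.
Proof.
apply: pattern_eq => [|i] /=; last by rewrite opprD addrA addrAC.
by apply/seteqP; split=> z /=; rewrite addrA.
Qed.

Lemma translation_equiv_class n : equiv_class_of (@translation_equiv n).
Proof.
have sym p p' : @translation_equiv n p p' -> translation_equiv p' p.
  move=> /asboolP[x [e1 e2]]; apply/asboolP; exists (- x).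
  by rewrite e1 e2 !translateD addNr !translate0.
split=> [p|p p'|p' p p''].
- by apply/asboolP; exists 0; rewrite !translate0.
- by apply/idP/idP; exact: sym.
- move=> /asboolP[x [e1 e2]] /asboolP[y [e3 e4]]; apply/asboolP.
  by exists (y + x); rewrite e3 e4 e1 e2 !translateD.
Qed.

Canonical translation_equiv_rel n := EquivRelPack (@translation_equiv_class n).

Definition pair_quotient n : Type :=
  quotient_topology {eq_quot (@translation_equiv n)}%qT.
HB.instance Definition _ n := Topological.on (pair_quotient n).
HB.instance Definition _ n := Quotient.on (pair_quotient n).

Definition is_coefficient n (q : pat_pair n -> R[i]) : Prop :=
  (exists f : pair_quotient n -> (R[i])^o,
     [/\ continuous f, compact (closure [set z | f z != 0]) &
         forall p, q p = f (\pi_(pair_quotient n) p)%qT]) /\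
  (forall (s1 s2 : 'S_n) p p',
     ppl p' = relabel s1 (ppl p) -> ppr p' = relabel (s2^-1)%g (ppr p) ->
     q p' = (-1) ^+ s1 * q p * (-1) ^+ s2).

End Patterns.

Section CAR.
Context (R : realType) (d : nat) (r rho : R).
Local Notation E := 'rV[R]_d.
Local Notation pat n := (pattern d r rho n).
Local Notation pat_pair n := (@pat_pair R d r rho n).
Context (A : cstarAlgType R) (a : E -> A) (L : set E).

(* Only the values of a on L matter. *)
Definition is_CAR : Prop :=
  [/\ forall x y, L x -> L y -> a x * a y + a y * a x = 0,
      forall x y, L x -> L y ->
        star (a x) * a y + a y * star (a x) = (x == y)%:R &
      cstar_generated (a @` L) = setT].

Definition exhausts (Lk : nat -> set E) : Prop :=
  [/\ forall k, finite_set (Lk k), forall k, Lk k `<=` Lk k.+1 &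
      \bigcup_k Lk k = L].

Definition local_algebra (Lk : nat -> set E) : set A :=
  [set x | exists k, cstar_generated (a @` Lk k) x].

(* a_{chi(n)} ... a_{chi(1)} *)
Definition annihilators n (xi : pat n) : A :=
  \prod_(i < n) a (lab xi (rev_ord i)).

Definition monomial n (p : pat_pair n) : A :=
  star (annihilators (ppl p)) * annihilators (ppr p).

Definition truncation n (q : pat_pair n -> R[i]) (K : set E) : A :=
  (n`!%:R^-1 : R[i]) *: \sum_(p \in [set p : pat_pair n |
      [/\ lat (ppl p) = L, points (ppl p) `<=` K & points (ppr p) `<=` K]])
    q p *: monomial p.

(* y = ad_Q (x) *)
Definition ad_lim (Lk : nat -> set E) n (q : pat_pair n -> R[i]) (x y : A) :
    Prop :=
  (fun k => 'i *: (x * truncation q (Lk k) - truncation q (Lk k) * x)) @ \oo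
    --> y.

(* For N = 0 the empty pattern contributes the unit. *)
Definition GI (N : nat) : set A :=
  closed_span [set x | exists n (p : pat_pair n),
    [/\ (N <= n)%N, lat (ppl p) = L & x = monomial p]].

End CAR.

Section Fock.
Context (R : realType) (d : nat) (r rho : R).
Local Notation E := 'rV[R]_d.
Local Notation pat n := (pattern d r rho n).
Local Notation pat_pair n := (@pat_pair R d r rho n).
Context (L : set E).

Section Sector.
Context (N : nat) (H : hilbertType R) (ket : pat N -> H).

(* H is the Hilbert space spanned by the vectors ket xi with lat xi = L. *)
Definition is_fermi_space : Prop :=
  [/\ forall (xi zeta : pat N) (s : 'S_N), lat xi = L -> lat zeta = L ->
        (forall i, lab zeta i = lab xi (s i)) ->
        inner (ket xi) (ket zeta) = (-1) ^+ s,
      forall xi zeta : pat N, lat xi = L -> lat zeta = L ->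
        points xi <> points zeta -> inner (ket xi) (ket zeta) = 0 &
      closed_span (ket @` [set xi | lat xi = L]) = setT].

(* T = 1/N! sum q(xi, zeta) |xi><zeta|; on each ket the sum is finite when q
   is a coefficient. *)
Definition represents (q : pat_pair N -> R[i]) (T : H -> H) : Prop :=
  forall eta : pat N, lat eta = L ->
    T (ket eta) = (N`!%:R^-1 : R[i]) *:
      \sum_(p \in [set p : pat_pair N | lat (ppl p) = L])
        q p *: ketbra (ket (ppl p)) (ket (ppr p)) (ket eta).

Definition G_alg : set (H -> H) :=
  if N is 0%N then @scalar_ops R H else
  norm_closure [set T | bounded_op T /\
    exists2 q : pat_pair N -> R[i], is_coefficient q & represents q T].

Context (A : cstarAlgType R) (a : E -> A) (Lk : nat -> set E).
Local Notation GI := (@GI R d r rho A a L).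

(* pi : GI_N -> K(H) is a surjective *-morphism with kernel GI_{N+1}, given by
   the displayed formula on monomials: it is the isomorphism
   GI_N / GI_{N+1} ~ K(H) composed with the projection. *)
Definition is_quotient_map (pi : A -> H -> H) : Prop :=
  [/\ [/\ forall x, GI N x -> compact_op (pi x),
          forall T, compact_op T -> exists2 x, GI N x & pi x = T &
          forall x, GI N x -> pi x = (fun=> 0) <-> GI N.+1 x],
      [/\ forall (c : R[i]) x y, GI N x -> GI N y ->
            pi (c *: x + y) = (fun u => c *: pi x u + pi y u),
          forall x y, GI N x -> GI N y -> pi (x * y) = pi x \o pi y &
          forall x u v, GI N x -> inner (pi (star x) u) v = inner u (pi x v)] &
      forall p : pat_pair N, lat (ppl p) = L ->
        pi (monomial a p) = ketbra (ket (ppl p)) (ket (ppr p))].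

(* delta is the bounded derivation of K(H) to which ad_Q descends. *)
Definition descends_to n (q : pat_pair n -> R[i]) (delta : (H -> H) -> H -> H) :
    Prop :=
  bounded_derivation delta /\
  exists2 pi, is_quotient_map pi &
    forall x, GI N x -> local_algebra a Lk x ->
      exists2 y, ad_lim a L Lk q x y & GI N y /\ delta (pi x) = pi y.

Definition H_generators : set (H -> H) :=
  [set B | bounded_op B /\
    exists n (q : pat_pair n -> R[i]) delta,
      [/\ (0 < n)%N, is_coefficient q, descends_to q delta &
          forall T, compact_op T ->
            delta T = (fun u => 'i *: (T (B u) - B (T u)))]].

(* The subalgebra is taken unital; the identity is itself a generator,
   obtained from q = 0. *)
Definition H_alg : set (H -> H) :=
  if N is 0%N then @scalar_ops R H else op_generated H_generators.

End Sector.
End Fock.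

(* Main.v *)
Require Import Defs.
From HB Require Import structures.
From mathcomp Require Import all_boot all_order all_algebra all_fingroup.
From mathcomp Require Import generic_quotient complex finmap.
From mathcomp Require Import all_classical all_reals.
From mathcomp Require Import ereal topology normedtype sequences.
From mathcomp Require Import zify ring lra.

Set Implicit Arguments.
Unset Strict Implicit.
Unset Printing Implicit Defensive.

Import Order.TTheory GRing.Theory Num.Theory.
Import numFieldNormedType.Exports ComplexField.Normc.

Local Open Scope classical_set_scope.
Local Open Scope complex_scope.
Local Open Scope ring_scope.

(** The assertions on the towers are formal, once every operator of H_n is
    known to be a multiplier of G_n. The multipliers of a norm closed,
    self-adjoint space of bounded operators form a C*-algebra of operators
    (mult_star_ops; adjoints come from riesz). A product of such algebras over
    any index set, with the topology of the operator norms of the components,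
    is complete, and its topology is given by C*-seminorms (opprod_complete,
    opprod_pro_cstar). For the indices up to N this is the C*-sum at stage N,
    whose norm is the maximum of those seminorms, and for all indices it is
    the inverse limit (oplim_inverse_limit). Elements of both towers are
    families of operators, so that the inclusions of H_n give injective
    morphisms at each stage and in the limit (tower_embedding).

    It remains to show that an operator B on the N-particle space is a
    multiplier of G_N if it implements the derivation that descends from ad_Q,
    for the formal sum Q of an n-coefficient q.

    The first step is algebraic. Modulo GI_(N+1), the product of two monomials
    is given by contractions: the monomial on the left removes n of the
    creators of the other one, if it finds them, and puts its own in their
    place (pi_theta). Terms of Q with no point in common with a monomial
    commute with it, so that all commutators with Q are finite sums. Comparing
    the commutators of |xi><zeta| with Q and with B shows that B maps every
    ket to its image under Q plus a fixed multiple of itself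
    (implementer_columns). The sector of N < n particles is annihilated by Q,
    and B is a scalar there.

    The second step is geometric. The matrix elements of Q between patterns of
    N >= n points form a kernel on pairs of patterns which is continuous,
    translation invariant and of finite range (lift_kernel_local). It has no
    compact support modulo translations, because N - n points stay where they
    are; but its products with a kernel of compact support are continuous and
    have compact support (kprod_continuous, kprod_compact_r, kprod_compact_l).
    Indeed, only finitely many intermediate patterns contribute, they follow
    the lattice continuously, and compactness of a set of pairs of patterns
    only depends on their lattices as long as the labels stay bounded
    (transfer_compact). As G_N is the norm closure of the operators of kernels
    with compact support (G_algE), B is a multiplier (local_multiplier). *)

(** * Geometry of Hilbert spaces *)

Section HilbertGeometry.
Context (R : realType) (H : hilbertType R).
Implicit Types (u v w : H) (T S : H -> H).

Definition hnorm u : R := complex.Re `|u|.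

Lemma hnormE u : (hnorm u)%:C = `|u|.
Proof. by rewrite /hnorm RRe_real// normr_real. Qed.

Lemma conjE (c : R[i]) : c^* = conjc c.
Proof. by []. Qed.

Lemma hnorm_ge0 u : 0 <= hnorm u.
Proof. by rewrite -ler0c hnormE. Qed.

Lemma hnorm0 : hnorm 0 = 0.
Proof. by rewrite /hnorm normr0. Qed.

Lemma hnorm_eq0 u : hnorm u = 0 -> u = 0.
Proof. by move=> u0; apply: normr0_eq0; rewrite -hnormE u0. Qed.

Lemma hnormD u v : hnorm (u + v) <= hnorm u + hnorm v.
Proof. by rewrite -lecR rmorphD /= !hnormE ler_normD. Qed.

Lemma hnormN u : hnorm (- u) = hnorm u.
Proof. by rewrite /hnorm normrN. Qed.

Lemma hnormB u v : hnorm (u - v) = hnorm (v - u).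
Proof. by rewrite -hnormN opprB. Qed.

Lemma cabsE (c : R[i]) : (normc c)%:C = `|c|.
Proof. by []. Qed.

Lemma normc_ge0 (c : R[i]) : 0 <= normc c.
Proof. by rewrite -ler0c cabsE. Qed.

Lemma hnormZ (c : R[i]) u : hnorm (c *: u) = normc c * hnorm u.
Proof. by apply: complexI; rewrite rmorphM /= !hnormE cabsE normrZ. Qed.

Lemma innerDr u v w : inner u (v + w) = inner u v + inner u w.
Proof. by have := inner_linear u 1 v w; rewrite scale1r mul1r. Qed.

Lemma inner0r u : inner u 0 = 0.
Proof. by apply: (addrI (inner u 0)); rewrite -innerDr !addr0. Qed.

Lemma innerZr u (c : R[i]) v : inner u (c *: v) = c * inner u v.
Proof. by have := inner_linear u c v 0; rewrite inner0r !addr0. Qed.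

Lemma innerNr u v : inner u (- v) = - inner u v.
Proof. by rewrite -scaleN1r innerZr mulN1r. Qed.

Lemma innerBr u v w : inner u (v - w) = inner u v - inner u w.
Proof. by rewrite innerDr innerNr. Qed.

Lemma innerDl u v w : inner (u + v) w = inner u w + inner v w.
Proof. by rewrite inner_conj innerDr rmorphD /= -!inner_conj. Qed.

Lemma innerZl (c : R[i]) u v : inner (c *: u) v = c^* * inner u v.
Proof. by rewrite inner_conj innerZr rmorphM /= -!inner_conj. Qed.

Lemma innerNl u v : inner (- u) v = - inner u v.
Proof. by rewrite inner_conj innerNr rmorphN /= -!inner_conj. Qed.

Lemma innerBl u v w : inner (u - v) w = inner u w - inner v w.
Proof. by rewrite innerDl innerNl. Qed.

Lemma inner0l u : inner 0 u = 0.
Proof. by rewrite inner_conj inner0r rmorph0. Qed.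

Lemma inner_self u : inner u u = (hnorm u ^+ 2)%:C.
Proof. by rewrite inner_norm -hnormE rmorphXn. Qed.

Lemma inner_self_eq0 u : inner u u = 0 -> u = 0.
Proof. by rewrite inner_norm => /eqP; rewrite expf_eq0 /= normr_eq0 => /eqP. Qed.

Lemma inner_injl u v : (forall w, inner u w = inner v w) -> u = v.
Proof.
move=> uv; apply/eqP; rewrite -subr_eq0; apply/eqP/inner_self_eq0.
by rewrite innerBl uv subrr.
Qed.

Definition reinner u v : R := complex.Re (inner u v).

Lemma reinnerC u v : reinner u v = reinner v u.
Proof. by rewrite /reinner inner_conj conjE; case: inner. Qed.

Lemma hnorm_sqrD u v :
  hnorm (u + v) ^+ 2 = hnorm u ^+ 2 + 2 * reinner u v + hnorm v ^+ 2.
Proof.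
have reE w : hnorm w ^+ 2 = reinner w w by rewrite /reinner inner_self.
rewrite !reE /reinner !innerDl !innerDr !raddfD /= -!/(reinner _ _).
by rewrite (reinnerC v u) mulr_natl mulr2n !addrA.
Qed.

Lemma reinnerZr (t : R) u v : reinner u (t%:C *: v) = t * reinner u v.
Proof. by rewrite /reinner innerZr; case: inner => a b /=; rewrite mul0r subr0. Qed.

Lemma hnormZr (t : R) u : hnorm (t%:C *: u) = `|t| * hnorm u.
Proof. by rewrite hnormZ /= expr0n /= addr0 sqrtr_sqr. Qed.

Lemma reinner_le u v : reinner u v <= hnorm u * hnorm v.
Proof.
have [->|u0] := eqVneq u 0.
  by rewrite /reinner inner0l hnorm0 mul0r.
have [->|v0] := eqVneq v 0.
  by rewrite /reinner inner0r hnorm0 mulr0.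
have nu : 0 < hnorm u.
  by rewrite lt_def hnorm_ge0 andbT; apply: contra_neq u0; exact: hnorm_eq0.
have nv : 0 < hnorm v.
  by rewrite lt_def hnorm_ge0 andbT; apply: contra_neq v0; exact: hnorm_eq0.
have := sqr_ge0 (hnorm ((hnorm v)%:C *: u + (- hnorm u)%:C *: v)).
rewrite hnorm_sqrD !hnormZr normrN !ger0_norm ?hnorm_ge0//.
rewrite reinnerZr reinnerC reinnerZr (reinnerC v u) => h.
have : 0 <= (hnorm u * hnorm v) * (hnorm u * hnorm v - reinner u v).
  by move: h; lra.
by rewrite pmulr_rge0 ?mulr_gt0// subr_ge0.
Qed.

Lemma cauchy_schwarz u v : normc (inner u v) <= hnorm u * hnorm v.
Proof.
have [->|z0] := eqVneq (inner u v) 0.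
  by rewrite normc0 mulr_ge0// hnorm_ge0.
have nz : 0 < normc (inner u v).
  rewrite lt_def normc_ge0 andbT; apply: contra_neq z0; exact: eq0_normc.
(* rotate v so that the inner product becomes a nonnegative real *)
pose c := (inner u v)^* .
have := reinner_le u (c *: v).
have -> : reinner u (c *: v) = normc (inner u v) ^+ 2.
  rewrite /reinner innerZr /c conjE; case: (inner u v) => a b /=.
  by rewrite sqr_sqrtr ?addr_ge0 ?sqr_ge0//; ring.
rewrite hnormZ.
have -> : normc c = normc (inner u v).
  by rewrite /c conjE; case: (inner u v) => a b /=; rewrite sqrrN.
by rewrite mulrCA expr2 ler_pM2l.
Qed.

Lemma hnorm_sub_le u v w : hnorm (u - w) <= hnorm (u - v) + hnorm (v - w).
Proof. by rewrite -[u - w](subrKA v) hnormD. Qed.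

Lemma parallelogram u v :
  hnorm (u + v) ^+ 2 + hnorm (u - v) ^+ 2 = 2 * (hnorm u ^+ 2 + hnorm v ^+ 2).
Proof.
rewrite !hnorm_sqrD hnormN.
have -> : reinner u (- v) = - reinner u v by rewrite /reinner innerNr raddfN.
by ring.
Qed.

Lemma hnear u (e : R) : 0 < e -> \forall v \near u, hnorm (u - v) < e.
Proof.
move=> e0; have e0' : 0 < e%:C by rewrite ltcR.
move/cvgrPdist_lt: (@cvg_id _ (nbhs u)) => /(_ _ e0').
by apply: filterS => v; rewrite -hnormE ltcR.
Qed.

Lemma hcomplete (Fl : set_system H) : ProperFilter Fl ->
  (forall e : R, 0 < e -> exists2 B : set H, Fl B &
     forall x y, B x -> B y -> hnorm (x - y) < e) ->
  exists x, forall e : R, 0 < e -> Fl [set y | hnorm (x - y) < e].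
Proof.
move=> FF cF.
have cau : cauchy Fl.
  apply/cauchy_ballP => e e0.
  have er : e = (complex.Re e)%:C by rewrite RRe_real// gtr0_real.
  have [|B FB Bxy] := cF (complex.Re e).
    by move: e0; rewrite ltcE /= => /andP[].
  exists (B, B) => //= -[x y] /= [Bx By].
  by rewrite -ball_normE /= er -hnormE ltcR; exact: Bxy.
have /cvg_ex[x Fx] := @cauchy_cvg _ _ FF cau.
by exists x => e e0; apply: Fx; exact: hnear.
Qed.

End HilbertGeometry.

(** * Riesz representation and adjoints *)

Section Riesz.
Context (R : realType) (H : hilbertType R).
Implicit Types (u v w : H) (T S : H -> H).

Section Functional.
Context (f : H -> R[i]) (k : R).
Hypothesis f_linear : forall (c : R[i]) u v, f (c *: u + v) = c * f u + f v.
Hypothesis f_bound : forall u, normc (f u) <= k * hnorm u.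

Let refE (t : R) u v :
  complex.Re (f (t%:C *: u + v)) = t * complex.Re (f u) + complex.Re (f v).
Proof. by rewrite f_linear raddfD /=; case: (f u) => a b /=; rewrite mul0r subr0. Qed.

Let f0 : f 0 = 0.
Proof. by have := f_linear (-1) 0 0; rewrite scaleN1r oppr0 add0r mulN1r addNr. Qed.

Let Re_le_normc (c : R[i]) : complex.Re c <= normc c.
Proof.
case: c => a b /=; apply: (le_trans (ler_norm a)).
by rewrite -sqrtr_sqr ler_wsqrtr// lerDl sqr_ge0.
Qed.

(** The functional whose minimizer represents f. *)
Let phi w : R := hnorm w ^+ 2 - 2 * complex.Re (f w).

Let phi_ge w : - k ^+ 2 <= phi w.
Proof.
have := le_trans (Re_le_normc (f w)) (f_bound w); rewrite /phi.
by have := sqr_ge0 (hnorm w - k); nra.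
Qed.

Let phi_shift (t : R) u y : phi (y + t%:C *: u) =
  phi y + 2 * t * (reinner y u - complex.Re (f u)) + t ^+ 2 * hnorm u ^+ 2.
Proof.
rewrite /phi hnorm_sqrD reinnerZr hnormZr exprMn real_normK ?num_real//.
by rewrite [y + _]addrC refE; ring.
Qed.

Let range_phi := range phi.

Let phi_has_inf : has_inf range_phi.
Proof.
split; first by exists (phi 0), 0.
by exists (- k ^+ 2) => _ [w _ <-]; exact: phi_ge.
Qed.

Let I := inf range_phi.

Let phi_geI w : I <= phi w.
Proof. by apply: ge_inf; [case: phi_has_inf|exists w]. Qed.

Let near_min (e : R) : set H := [set w | phi w < I + e].

Let near_min_cauchy (e : R) x y : near_min e x -> near_min e y ->
  hnorm (x - y) ^+ 2 <= 4 * e.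
Proof.
rewrite /near_min /= => xe ye; have := phi_geI ((2^-1)%:C *: (x + y)).
have := parallelogram x y; move: xe ye; rewrite /phi hnormZr.
rewrite -[_ *: (x + y)]addr0 refE f0 /= addr0.
have -> : complex.Re (f (x + y)) = complex.Re (f x) + complex.Re (f y).
  by have := refE 1 x y; rewrite scale1r mul1r.
by rewrite ger0_norm ?invr_ge0 ?ler0n// exprMn; lra.
Qed.

(** A minimizing filter of phi is Cauchy by the parallelogram law, and the
    first variation of phi vanishes at its limit in every direction; this is
    the claim for real parts. Evaluation at multiples by 'i gives the
    imaginary parts. *)
Lemma riesz : exists w, forall u, f u = inner w u.
Proof.
pose Fl : set_system H := filter_from [set e : R | 0 < e] near_min.
have FF : ProperFilter Fl.
  apply: filter_from_proper; last first.
    move=> e /= e0; have [_ [w _ <-] we] := inf_adherent e0 phi_has_inf.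
    by exists w.
  apply: filter_from_filter; first by exists 1; exact: ltr01.
  move=> e1 e2 /= e10 e20; exists (Num.min e1 e2).
    by rewrite /= lt_min e10.
  move=> w /=; rewrite /near_min /= => we; split.
    by apply: (lt_le_trans we); rewrite lerD2l ge_min lexx.
  by apply: (lt_le_trans we); rewrite lerD2l ge_min lexx orbT.
have cF (e : R) : 0 < e -> exists2 B : set H, Fl B &
    forall x y, B x -> B y -> hnorm (x - y) < e.
  move=> e0; exists (near_min (e ^+ 2 / 8)).
    by exists (e ^+ 2 / 8) => //=; rewrite divr_gt0// exprn_gt0.
  move=> x y Bx By; rewrite -(ltr_pXn2r (n := 2)) ?nnegrE ?hnorm_ge0 ?(ltW e0)//.
  apply: (le_lt_trans (near_min_cauchy Bx By)).
  by have : 0 < e ^+ 2; [rewrite exprn_gt0|lra].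
have [w0 w0F] := hcomplete FF cF.
have Re_eq u : complex.Re (f u) = reinner w0 u.
  apply/eqP; rewrite eq_sym -subr_eq0; apply: contraT => g0.
  set g := reinner w0 u - _ in g0.
  set s := hnorm u; have s0 : 0 <= s by exact: hnorm_ge0.
  have p : 0 < s ^+ 2 + 1 by rewrite ltr_wpDl// sqr_ge0.
  (* a step against a nonzero first variation g lowers phi by de *)
  pose t := - g / (s ^+ 2 + 1).
  have tE : t * (s ^+ 2 + 1) = - g by rewrite /t divfK// gt_eqF.
  pose de := t ^+ 2 * (s ^+ 2 + 1).
  have t0 : t != 0 by rewrite mulf_neq0 ?oppr_eq0// invr_eq0 gt_eqF.
  have de0 : 0 < de by rewrite mulr_gt0// exprn_even_gt0.
  pose e := de / (4 * `|t| * (s + 1)).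
  have q : 0 < 4 * `|t| * (s + 1).
    by rewrite !mulr_gt0 ?normr_gt0// ltr_wpDl.
  have e0 : 0 < e by rewrite divr_gt0.
  have eE : 4 * `|t| * (s + 1) * e = de by rewrite /e mulrC divfK// gt_eqF.
  have de20 : 0 < de / 2 by rewrite divr_gt0.
  have Fde : Fl (near_min (de / 2)) by exists (de / 2).
  have [y [/= w0y]] := filter_ex (filterI (w0F e e0) Fde).
  rewrite /near_min /= => ymin; have := phi_geI (y + t%:C *: u).
  rewrite phi_shift -/s.
  have h : t * (reinner y u - reinner w0 u) <= `|t| * (e * s).
    apply: (le_trans (ler_norm _)); rewrite normrM ler_wpM2l//.
    have -> : reinner y u - reinner w0 u = reinner (y - w0) u.
      by rewrite /reinner innerBl raddfB.
    rewrite ler_norml; apply/andP; split.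
      rewrite lerNl; have -> : - reinner (y - w0) u = reinner (w0 - y) u.
        by rewrite /reinner -opprB innerNl raddfN opprK.
      apply: (le_trans (reinner_le _ _)).
      by rewrite ler_wpM2r// ltW.
    apply: (le_trans (reinner_le _ _)).
    by rewrite hnormB ler_wpM2r// ltW.
  have te : 0 <= `|t| * e by rewrite mulr_ge0// ltW.
  have -> : reinner y u - complex.Re (f u) =
     (reinner y u - reinner w0 u) + g by rewrite /g subrKA.
  have gE : t * g = - de.
    by rewrite -[g]opprK -tE /de mulrN expr2 mulrA.
  have ts : t ^+ 2 * s ^+ 2 <= de by rewrite /de ler_wpM2l ?sqr_ge0// lerDl.
  by move: eE h te gE ts ymin; lra.
exists w0 => u; apply/eqP; rewrite eq_complex; apply/andP; split.
  by rewrite Re_eq.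
have := Re_eq ('i *: u); rewrite /reinner innerZr -[_ *: u]addr0 f_linear f0 addr0.
have Rei (c : R[i]) : complex.Re ('i * c) = - complex.Im c.
  by rewrite -complexiE mulrC ReiNIm.
by rewrite !Rei => /oppr_inj ->.
Qed.

End Functional.

Lemma op_boundP T (k : R) :
  op_bound T k <-> forall u, hnorm (T u) <= k * hnorm u.
Proof.
by split=> b u; have := b u; rewrite -!hnormE -rmorphM lecR.
Qed.

Lemma op_bound_le T (k l : R) : k <= l -> op_bound T k -> op_bound T l.
Proof.
move=> kl /op_boundP Tk; apply/op_boundP => u; apply: (le_trans (Tk u)).
by rewrite ler_wpM2r// hnorm_ge0.
Qed.

Lemma bounded_op_ge0 T : bounded_op T -> exists2 k : R, 0 < k & op_bound T k.
Proof.
case=> _ [k Tk]; exists (`|k| + 1); first by rewrite ltr_wpDl.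
by apply: op_bound_le Tk; rewrite ler_wpDr// ler_norm.
Qed.

Lemma boundedP T : bounded_op T ->
  (forall (c : R[i]) u v, T (c *: u + v) = c *: T u + T v).
Proof. by case. Qed.

Lemma bop0 T : bounded_op T -> T 0 = 0.
Proof.
by case=> l _; have := l (-1) 0 0; rewrite scaleN1r oppr0 add0r scaleN1r addNr.
Qed.

Lemma bopD T u v : bounded_op T -> T (u + v) = T u + T v.
Proof. by case=> l _; have := l 1 u v; rewrite !scale1r. Qed.

Lemma bopZ T (c : R[i]) u : bounded_op T -> T (c *: u) = c *: T u.
Proof. by move=> bT; have := boundedP bT c u 0; rewrite (bop0 bT) !addr0. Qed.

Lemma bopN T u : bounded_op T -> T (- u) = - T u.
Proof. by move=> bT; rewrite -scaleN1r bopZ// scaleN1r. Qed.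

Lemma bopB T u v : bounded_op T -> T (u - v) = T u - T v.
Proof. by move=> bT; rewrite bopD// bopN. Qed.

Lemma bop_sum T I (s : seq I) (P : pred I) (F : I -> H) : bounded_op T ->
  T (\sum_(i <- s | P i) F i) = \sum_(i <- s | P i) T (F i).
Proof.
by move=> bT; apply: (big_morph T) => [u v|]; [exact: bopD|exact: bop0].
Qed.

Lemma bounded_id : bounded_op (@id H).
Proof. by split=> //; exists 1 => u; rewrite mul1r. Qed.

Lemma op_bound_lin S T (c : R[i]) (k l : R) : op_bound S k -> op_bound T l ->
  op_bound (fun u => c *: S u + T u) (normc c * k + l).
Proof.
move=> /op_boundP Sk /op_boundP Tl; apply/op_boundP => u.
apply: (le_trans (hnormD _ _)); rewrite mulrDl lerD// hnormZ -mulrA.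
by rewrite ler_wpM2l// normc_ge0.
Qed.

Lemma op_bound_comp S T (k l : R) : 0 <= k -> op_bound S k -> op_bound T l ->
  op_bound (S \o T) (k * l).
Proof.
move=> k0 /op_boundP Sk /op_boundP Tl; apply/op_boundP => u /=.
by apply: (le_trans (Sk _)); rewrite -mulrA ler_wpM2l.
Qed.

Lemma bounded_lin S T (c : R[i]) : bounded_op S -> bounded_op T ->
  bounded_op (fun u => c *: S u + T u).
Proof.
move=> [lS [k Sk]] [lT [l Tl]]; split=> [e u v|]; last first.
  by exists (normc c * k + l); exact: op_bound_lin.
by rewrite lS lT !scalerDr !scalerA mulrC addrACA.
Qed.

Lemma bounded_comp S T : bounded_op S -> bounded_op T -> bounded_op (S \o T).
Proof.
move=> bS [lT [l Tl]]; split=> [e u v|].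
  by rewrite /= lT (boundedP bS).
have [k k0 Sk] := bounded_op_ge0 bS.
by exists (k * l); apply: op_bound_comp => //; exact: ltW.
Qed.

Definition adjoint_of T S := forall u v, inner (S u) v = inner u (T v).

Lemma adjoint_sym T S : adjoint_of T S -> adjoint_of S T.
Proof. by move=> a u v; rewrite inner_conj -a -inner_conj. Qed.

Lemma op_bound_adjoint T S (k : R) : 0 <= k -> adjoint_of T S ->
  op_bound T k -> op_bound S k.
Proof.
move=> k0 a /op_boundP Tk; apply/op_boundP => u.
have [->|Su] := eqVneq (S u) 0; first by rewrite hnorm0 mulr_ge0// hnorm_ge0.
have p : 0 < hnorm (S u).
  by rewrite lt_def hnorm_ge0 andbT; apply: contra_neq Su; exact: hnorm_eq0.
rewrite -(ler_pM2l p) -expr2.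
have -> : hnorm (S u) ^+ 2 = reinner u (T (S u)).
  by rewrite /reinner -a inner_self.
apply: (le_trans (reinner_le _ _)).
rewrite mulrC mulrA (mulrC (hnorm (S u))) ler_wpM2r ?hnorm_ge0//.
Qed.

Lemma adjoint_ex T : bounded_op T -> exists2 S, bounded_op S & adjoint_of T S.
Proof.
move=> bT; have [k k0 Tk] := bounded_op_ge0 bT.
have ex u : exists w, forall v, inner u (T v) = inner w v.
  apply: (@riesz (fun v => inner u (T v)) (hnorm u * k)).
    by move=> c v w; rewrite (boundedP bT) inner_linear.
  move=> v; apply: (le_trans (cauchy_schwarz _ _)).
  by rewrite -mulrA ler_wpM2l ?hnorm_ge0//; move/op_boundP: Tk.
have [S SP] := choice ex; have aS : adjoint_of T S by move=> u v; rewrite SP.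
exists S => //; split; last first.
  by exists k; apply: op_bound_adjoint Tk => //; exact: ltW.
move=> c u v; apply: inner_injl => w.
by rewrite aS innerDl innerZl innerDl innerZl !aS.
Qed.

(** The operator norm. *)
Definition opnorm T : R := inf [set k : R | 0 <= k /\ op_bound T k].

Let opset_has_inf T : bounded_op T ->
  has_inf [set k : R | 0 <= k /\ op_bound T k].
Proof.
move=> bT; split; last by exists 0 => k [].
by have [k k0 Tk] := bounded_op_ge0 bT; exists k; split=> //; exact: ltW.
Qed.

Lemma opnorm_ge0 T : bounded_op T -> 0 <= opnorm T.
Proof. by case/opset_has_inf => ne _; apply: lb_le_inf => // k []. Qed.

Lemma opnorm_le T (k : R) : 0 <= k -> op_bound T k -> opnorm T <= k.
Proof. by move=> k0 Tk; apply: ge_inf => //; exists 0 => l []. Qed.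

Lemma opnormP T : bounded_op T -> op_bound T (opnorm T).
Proof.
move=> bT; apply/op_boundP => u; apply/ler_addgt0Pr => e e0.
have p : 0 < hnorm u + 1 by rewrite ltr_wpDl// hnorm_ge0.
have e0' : 0 < e / (hnorm u + 1) by rewrite divr_gt0.
have [k [k0 /op_boundP Tk] ke] := inf_adherent e0' (opset_has_inf bT).
apply: (le_trans (Tk u)).
apply: (@le_trans _ _ ((opnorm T + e / (hnorm u + 1)) * hnorm u)).
  by rewrite ler_wpM2r ?hnorm_ge0// ltW.
rewrite mulrDl lerD2l -mulrA ler_piMr ?(ltW e0)//.
by rewrite mulrC ler_pdivrMr// mul1r lerDl.
Qed.

End Riesz.

(** * Products of operator algebras *)

(** A unital C*-algebra of operators, given by its set of elements. *)
Record star_ops (R : realType) (H : hilbertType R) := StarOps {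
  ops :> (H -> H) -> Prop;
  ops_bounded : forall T, ops T -> bounded_op T;
  ops_id : ops id;
  ops_lin : forall (c : R[i]) S T, ops S -> ops T ->
    ops (fun u => c *: S u + T u);
  ops_comp : forall S T, ops S -> ops T -> ops (S \o T);
  ops_adj : forall T, ops T -> exists2 S, ops S & adjoint_of T S;
  ops_closed : forall T, bounded_op T ->
    (forall e : R, 0 < e ->
       exists2 S, ops S & op_bound (fun u => T u - S u) e) -> ops T
}.

(** Components are indexed by any type, so that the finite sums and their
    limit are instances of one construction. A nonzero vector somewhere gives
    the product a unit different from 0. *)
Record op_family (R : realType) := OpFamily {
  fidx : eqType;
  fsp : fidx -> hilbertType R;
  fops : forall i, star_ops (fsp i);
  fidx0 : fidx;
  fsp_neq0 : exists u : fsp fidx0, u <> 0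
}.

Record opprod (R : realType) (X : op_family R) := OpProd {
  pcomp : forall i : fidx X, fsp i -> fsp i;
  pcompP : forall i, fops i (@pcomp i)
}.
Arguments pcomp {R X} _ _ _.

Section OpProd.
Context (R : realType) (X : op_family R).
Local Notation P := (opprod X).
Implicit Types x y z : P.

Lemma opprod_eq x y : (forall i u, pcomp x i u = pcomp y i u) -> x = y.
Proof.
move=> e; have {e} : pcomp x = pcomp y.
  by apply: functional_extensionality_dep => i; apply/funext => u.
case: x y => [x xP] [y yP] /= e; subst y.
by congr OpProd; exact: Prop_irrelevance.
Qed.

HB.instance Definition _ := gen_eqMixin P.
HB.instance Definition _ := gen_choiceMixin P.

Lemma ops0 (H : hilbertType R) (A : star_ops H) : A (fun=> 0).
Proof.
have := ops_lin (-1) (ops_id A) (ops_id A).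
by congr (ops A _); apply/funext => u; rewrite scaleN1r addNr.
Qed.

Lemma opsZ (H : hilbertType R) (A : star_ops H) (c : R[i]) S :
  A S -> A (fun u => c *: S u).
Proof.
move=> AS; have := ops_lin c AS (ops0 A).
by congr (ops A _); apply/funext => u; rewrite addr0.
Qed.

Lemma opsD (H : hilbertType R) (A : star_ops H) S T :
  A S -> A T -> A (fun u => S u + T u).
Proof.
move=> AS AT; have := ops_lin 1 AS AT.
by congr (ops A _); apply/funext => u; rewrite scale1r.
Qed.

Definition pzero : P := OpProd (fun i => ops0 (fops i)).
Definition padd x y : P := OpProd (fun i => opsD (pcompP x i) (pcompP y i)).
Definition pscale (c : R[i]) x : P := OpProd (fun i => opsZ c (pcompP x i)).
Definition popp x : P := pscale (-1) x.
Definition pone : P := OpProd (fun i => ops_id (fops i)).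
Definition pmul x y : P := OpProd (fun i => ops_comp (pcompP x i) (pcompP y i)).

Let pbop x i : bounded_op (pcomp x i).
Proof. exact: ops_bounded (pcompP x i). Qed.

Fact paddA : associative padd.
Proof. by move=> x y z; apply: opprod_eq => i u /=; rewrite addrA. Qed.
Fact paddC : commutative padd.
Proof. by move=> x y; apply: opprod_eq => i u /=; rewrite addrC. Qed.
Fact padd0 : left_id pzero padd.
Proof. by move=> x; apply: opprod_eq => i u /=; rewrite add0r. Qed.
Fact paddN : left_inverse pzero popp padd.
Proof. by move=> x; apply: opprod_eq => i u /=; rewrite scaleN1r addNr. Qed.

HB.instance Definition _ := GRing.isZmodule.Build P paddA paddC padd0 paddN.

Fact pmulA : associative pmul.
Proof. by move=> x y z; apply: opprod_eq. Qed.
Fact pmul1l : left_id pone pmul.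
Proof. by move=> x; apply: opprod_eq. Qed.
Fact pmul1r : right_id pone pmul.
Proof. by move=> x; apply: opprod_eq. Qed.
Fact pmulDl : left_distributive pmul padd.
Proof. by move=> x y z; apply: opprod_eq. Qed.
Fact pmulDr : right_distributive pmul padd.
Proof. by move=> x y z; apply: opprod_eq => i u /=; rewrite bopD. Qed.
Fact pone_neq0 : pone != pzero.
Proof.
apply/eqP => e; have [u] := fsp_neq0 X; apply.
by have : pcomp pone (fidx0 X) u = pcomp pzero (fidx0 X) u by rewrite e.
Qed.

HB.instance Definition _ := GRing.Zmodule_isNzRing.Build P
  pmulA pmul1l pmul1r pmulDl pmulDr pone_neq0.

Fact pscaleA (a b : R[i]) x : pscale a (pscale b x) = pscale (a * b) x.
Proof. by apply: opprod_eq => i u /=; rewrite scalerA. Qed.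
Fact pscale1 : left_id 1 pscale.
Proof. by move=> x; apply: opprod_eq => i u /=; rewrite scale1r. Qed.
Fact pscaleDr : right_distributive pscale +%R.
Proof. by move=> c x y; apply: opprod_eq => i u /=; rewrite scalerDr. Qed.
Fact pscaleDl x : {morph pscale^~ x : a b / a + b}.
Proof. by move=> a b; apply: opprod_eq => i u /=; rewrite scalerDl. Qed.

HB.instance Definition _ := GRing.Zmodule_isLmodule.Build R[i] P
  pscaleA pscale1 pscaleDr pscaleDl.

Fact pscaleAl (c : R[i]) x y : c *: (x * y) = (c *: x) * y.
Proof. by apply: opprod_eq. Qed.

HB.instance Definition _ := GRing.Lmodule_isLalgebra.Build R[i] P pscaleAl.

Fact pscaleAr (c : R[i]) x y : c *: (x * y) = x * (c *: y).
Proof. by apply: opprod_eq => i u /=; rewrite bopZ. Qed.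

HB.instance Definition _ := GRing.Lalgebra_isAlgebra.Build R[i] P pscaleAr.

Definition adj_op x (i : fidx X) : fsp i -> fsp i := s2val (cid2 (ops_adj (pcompP x i))).

Fact adj_opP x i : fops i (@adj_op x i).
Proof. exact: s2valP (cid2 (ops_adj (pcompP x i))). Qed.

Definition pstar x : P := OpProd (@adj_opP x).

Lemma pstarE x i : adjoint_of (pcomp x i) (pcomp (pstar x) i).
Proof. exact: s2valP' (cid2 (ops_adj (pcompP x i))). Qed.

Fact pstarK : involutive pstar.
Proof.
move=> x; apply: opprod_eq => i u; apply: inner_injl => w.
by rewrite pstarE (adjoint_sym (@pstarE x i)).
Qed.

Fact pstarD : {morph pstar : x y / x + y}.
Proof.
move=> x y; apply: opprod_eq => i u; apply: inner_injl => w.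
by rewrite pstarE /= innerDr innerDl !pstarE.
Qed.

Fact pstarZ (c : R[i]) x : pstar (c *: x) = c^* *: pstar x.
Proof.
apply: opprod_eq => i u; apply: inner_injl => w.
by rewrite pstarE /= innerZr innerZl -pstarE conjCK.
Qed.

Fact pstarM x y : pstar (x * y) = pstar y * pstar x.
Proof.
apply: opprod_eq => i u; apply: inner_injl => w.
by rewrite pstarE /= !pstarE.
Qed.

HB.instance Definition _ := isStarAlgebra.Build R P pstarK pstarD pstarZ pstarM.

Lemma starE x i : adjoint_of (pcomp x i) (pcomp (star x) i).
Proof. exact: pstarE. Qed.

(** The topology of the product is that of these seminorms, the operator norms
    of the components. *)
Definition psn i x : R := opnorm (pcomp x i).

Lemma psn_ge0 i x : 0 <= psn i x.
Proof. exact: opnorm_ge0. Qed.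

Lemma psn_bound i x u : hnorm (pcomp x i u) <= psn i x * hnorm u.
Proof. by move: u; apply/op_boundP; exact: opnormP. Qed.

Lemma psn_le i x (k : R) : 0 <= k -> op_bound (pcomp x i) k -> psn i x <= k.
Proof. exact: opnorm_le. Qed.

Lemma psn0 i : psn i 0 = 0.
Proof.
apply/le_anti; rewrite psn_ge0 andbT; apply: psn_le => // u.
by rewrite mul0r normr0.
Qed.

Lemma psnD i x y : psn i (x + y) <= psn i x + psn i y.
Proof.
apply: psn_le; first by rewrite addr_ge0 ?psn_ge0.
apply/op_boundP => u /=; apply: (le_trans (hnormD _ _)).
by rewrite mulrDl lerD ?psn_bound.
Qed.

Let psnZ_le i (c : R[i]) x : psn i (c *: x) <= normc c * psn i x.
Proof.
apply: psn_le; first by rewrite mulr_ge0 ?psn_ge0 ?normc_ge0.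
by apply/op_boundP => u /=; rewrite hnormZ -mulrA ler_wpM2l ?normc_ge0 ?psn_bound.
Qed.

Lemma psnZ i (c : R[i]) x : psn i (c *: x) = normc c * psn i x.
Proof.
apply/le_anti; rewrite psnZ_le /=.
have [->|c0] := eqVneq c 0; first by rewrite normc0 mul0r psn_ge0.
have n0 : 0 < normc c.
  by rewrite lt_def normc_ge0 andbT; apply: contra_neq c0; exact: eq0_normc.
have := psnZ_le i c^-1 (c *: x); rewrite scalerA mulVf// scale1r normcV.
by rewrite mulrC ler_pdivlMr// mulrC.
Qed.

Lemma psnN i x : psn i (- x) = psn i x.
Proof.
rewrite -scaleN1r psnZ; have -> : normc (-1 : R[i]) = 1.
  by rewrite /= oppr0 expr0n addr0 sqrrN expr1n sqrtr1.
by rewrite mul1r.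
Qed.

Lemma psnM i x y : psn i (x * y) <= psn i x * psn i y.
Proof.
apply: psn_le; first by rewrite mulr_ge0 ?psn_ge0.
apply/op_boundP => u /=; apply: (le_trans (psn_bound _ _)).
by rewrite -mulrA ler_wpM2l ?psn_ge0 ?psn_bound.
Qed.

Lemma psn_star i x : psn i (star x) = psn i x.
Proof.
have h z : psn i (star z) <= psn i z.
  apply: psn_le; first exact: psn_ge0.
  apply: (@op_bound_adjoint _ _ (pcomp z i)); first exact: psn_ge0.
    exact: pstarE.
  exact: opnormP.
by apply/le_anti; rewrite h -{1}[x]starK h.
Qed.

(** For an operator T with adjoint T*, one has |T u|^2 = <T* T u, u>. *)
Lemma psn_cstar i x : psn i (star x * x) = psn i x ^+ 2.
Proof.
apply/le_anti/andP; split.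
  by apply: (le_trans (psnM _ _ _)); rewrite psn_star expr2.
set k := psn i (star x * x); have k0 : 0 <= k by exact: psn_ge0.
rewrite -[leRHS]sqr_sqrtr// ler_pXn2r ?nnegrE ?psn_ge0 ?sqrtr_ge0//.
apply: psn_le; first exact: sqrtr_ge0.
apply/op_boundP => u.
rewrite -(ler_pXn2r (n := 2)) ?nnegrE ?hnorm_ge0 ?mulr_ge0 ?sqrtr_ge0 ?hnorm_ge0//.
rewrite exprMn sqr_sqrtr//.
have -> : hnorm (pcomp x i u) ^+ 2 = reinner (pcomp (star x * x) i u) u.
  by rewrite /reinner /= pstarE inner_self.
apply: (le_trans (reinner_le _ _)).
rewrite expr2 mulrA ler_wpM2r ?hnorm_ge0//; exact: psn_bound.
Qed.

Lemma psn_eq0 x y : (forall i, psn i (x - y) = 0) -> x = y.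
Proof.
move=> e; apply: opprod_eq => i u; apply/eqP; rewrite -subr_eq0; apply/eqP.
apply: hnorm_eq0; apply/le_anti; rewrite hnorm_ge0 andbT.
have := psn_bound (x - y) u; rewrite e mul0r /=.
by congr (hnorm _ <= _); rewrite -[_ i u in RHS]/(_) scaleN1r.
Qed.

Lemma psnB i x y : psn i (x - y) = psn i (y - x).
Proof. by rewrite -opprB psnN. Qed.

Lemma psnBD i x y z : psn i (x - z) <= psn i (x - y) + psn i (y - z).
Proof. by rewrite -[x - z](subrKA y) psnD. Qed.

Definition pbox x (s : seq (fidx X)) (e : R) : set P :=
  [set y | forall i, i \in s -> psn i (y - x) < e].

Definition pnbhs x : set_system P :=
  [set U | exists s, exists2 e : R, 0 < e & pbox x s e `<=` U].

HB.instance Definition _ := hasNbhs.Build P pnbhs.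

Fact pnbhs_filter x : ProperFilter (nbhs x).
Proof.
split.
  case=> s [e e0 /(_ x)]; apply => i _; by rewrite subrr psn0.
split.
- by exists [::], 1.
- move=> U V [s [e e0 sU]] [t [f f0 tV]]; exists (s ++ t), (Num.min e f).
    by rewrite lt_min e0.
  move=> y xy; split; [apply: sU|apply: tV] => i ii.
    have := xy i; rewrite mem_cat ii => /(_ isT).
    by rewrite lt_min => /andP[].
  have := xy i; rewrite mem_cat ii orbT => /(_ isT).
  by rewrite lt_min => /andP[].
- by move=> U V UV [s [e e0 sU]]; exists s, e => // y /sU/UV.
Qed.

Fact pnbhs_singleton x (U : set P) : nbhs x U -> U x.
Proof. by case=> s [e e0]; apply => i _; rewrite subrr psn0. Qed.

Fact pnbhs_nbhs x (U : set P) : nbhs x U -> nbhs x (nbhs^~ U).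
Proof.
case=> s [e e0 sU]; exists s, (e / 2); first by rewrite divr_gt0.
move=> y xy; exists s, (e / 2); first by rewrite divr_gt0.
move=> z yz; apply: sU => i si; apply: (le_lt_trans (psnBD _ _ y _)).
by rewrite [ltRHS]splitr ltrD ?xy ?yz.
Qed.

HB.instance Definition _ := Nbhs_isNbhsTopological.Build P
  pnbhs_filter pnbhs_singleton pnbhs_nbhs.

Lemma near_psn i x (e : R) : 0 < e -> \forall y \near x, psn i (y - x) < e.
Proof.
by move=> e0; exists [:: i], e => // y xy; apply: xy; rewrite mem_head.
Qed.

Lemma near_psnS i x (e : R) (U : set P) : 0 < e ->
  (forall y, psn i (y - x) < e -> U y) -> nbhs x U.
Proof.
by move=> e0 eU; exists [:: i], e => // y xy; apply: eU; apply: xy; rewrite mem_head.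
Qed.

Lemma filter_all (T : Type) (Fl : set_system T) (I : eqType) (s : seq I)
    (Q : I -> set T) : Filter Fl -> (forall i, i \in s -> Fl (Q i)) ->
  Fl [set y | forall i, i \in s -> Q i y].
Proof.
move=> FF; elim: s => [|j s IH] h; first by apply: filterS filterT => y _ i.
have hj := h j (mem_head _ _).
have hs : Fl [set y | forall i, i \in s -> Q i y].
  by apply: IH => i si; apply: h; rewrite inE si orbT.
apply: filterS (filterI hj hs) => y [yj ys] i; rewrite inE.
by case/orP => [/eqP->|/ys].
Qed.

Lemma cvg_opprod (T : Type) (Fl : set_system T) (f : T -> P) x : Filter Fl ->
  (forall i (e : R), 0 < e -> \forall t \near Fl, psn i (f t - x) < e) ->
  f @ Fl --> x.
Proof.
move=> FF h U [s [e e0 sU]].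
have A := @filter_all _ _ _ s (fun i => [set t | psn i (f t - x) < e]) FF
  (fun i _ => h i e e0).
by rewrite /nbhs /=; apply: filterS A => t ft; apply: sU.
Qed.

Lemma near_pair (T1 T2 : topologicalType) (a : T1) (b : T2)
    (Q1 : set T1) (Q2 : set T2) : nbhs a Q1 -> nbhs b Q2 ->
  nbhs (a, b) [set z : T1 * T2 | Q1 z.1 /\ Q2 z.2].
Proof. by move=> h1 h2; exists (Q1, Q2). Qed.

Fact padd_continuous : continuous (fun x : P * P => x.1 + x.2).
Proof.
move=> [x y]; apply: cvg_opprod => i e e0.
have e2 : 0 < e / 2 by rewrite divr_gt0.
apply: filterS (near_pair (near_psn i x e2) (near_psn i y e2)) => -[x' y'] /= [hx hy].
rewrite opprD addrACA; apply: (le_lt_trans (psnD _ _ _)).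
by rewrite [ltRHS]splitr ltrD.
Qed.

Fact popp_continuous : continuous (-%R : P -> P).
Proof.
move=> x; apply: (@cvg_opprod _ (nbhs x)) => i e e0.
apply: (@near_psnS i x e) => // y /=.
by rewrite -opprD psnN.
Qed.

(** A bound for the three error terms of a product of approximations. *)
Lemma product_error (a b e : R) : 0 <= a -> 0 <= b -> 0 < e ->
  exists2 t : R, 0 < t & t * t + t * b + a * t < e.
Proof.
move=> a0 b0 e0; have p : 0 < 1 + a + b by lra.
exists (Num.min 1 (e / (2 * (1 + a + b)))).
  by rewrite lt_min ltr01 divr_gt0// mulr_gt0.
set t := Num.min _ _.
have t0 : 0 < t by rewrite lt_min ltr01 divr_gt0// mulr_gt0.
have t1 : t <= 1 by rewrite ge_min lexx.
have te : t * (2 * (1 + a + b)) <= e.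
  by rewrite -ler_pdivlMr ?mulr_gt0// ge_min lexx orbT.
have tt : t * t <= t by rewrite ler_piMr// ltW.
have : 0 < t * (1 + a + b) by rewrite mulr_gt0.
lra.
Qed.

Fact pscale_continuous : continuous (fun z : R[i]^o * P => z.1 *: z.2).
Proof.
move=> [c x]; apply: cvg_opprod => i e e0.
have [t t0 te] := product_error (normc_ge0 c) (psn_ge0 i x) e0.
have near_c : nbhs (c : R[i]^o) [set d | normc (d - c) < t].
  have t0' : 0 < t%:C by rewrite ltcR.
  move/cvgrPdist_lt: (@cvg_id _ (nbhs (c : R[i]^o))) => /(_ _ t0').
  by apply: filterS => d; rewrite -cabsE ltcR -normcN opprB.
apply: filterS (near_pair near_c (near_psn i x t0)) => -[d y] /= [hd hy].
have -> : d *: y - c *: x =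
    ((d - c) *: (y - x) + (d - c) *: x) + c *: (y - x).
  by rewrite -scalerDr subrK scalerBl scalerBr subrKA.
apply: le_lt_trans te.
apply: (le_trans (psnD _ _ _)); rewrite lerD//; last first.
  by rewrite psnZ ler_wpM2l ?normc_ge0// ltW.
apply: (le_trans (psnD _ _ _)); rewrite !psnZ lerD//.
  by rewrite ler_pM ?normc_ge0 ?psn_ge0 ?ltW.
by rewrite ler_wpM2r ?psn_ge0// ltW.
Qed.

HB.instance Definition _ :=
  PreTopologicalNmodule_isTopologicalNmodule.Build P padd_continuous.
HB.instance Definition _ :=
  TopologicalNmodule_isTopologicalZmodule.Build P popp_continuous.
HB.instance Definition _ :=
  TopologicalZmodule_isTopologicalLmodule.Build R[i] P pscale_continuous.

Fact pmul_continuous : continuous (fun x : P * P => x.1 * x.2).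
Proof.
move=> [x y]; apply: cvg_opprod => i e e0.
have [t t0 te] := product_error (psn_ge0 i x) (psn_ge0 i y) e0.
apply: filterS (near_pair (near_psn i x t0) (near_psn i y t0)) => -[x' y'] /= [hx hy].
have -> : x' * y' - x * y =
    ((x' - x) * (y' - y) + (x' - x) * y) + x * (y' - y).
  by rewrite -mulrDr subrK mulrBl mulrBr subrKA.
apply: le_lt_trans te.
apply: (le_trans (psnD _ _ _)); rewrite lerD//; last first.
  by apply: (le_trans (psnM _ _ _)); rewrite ler_wpM2l ?psn_ge0// ltW.
apply: (le_trans (psnD _ _ _)); rewrite lerD//.
  by apply: (le_trans (psnM _ _ _)); rewrite ler_pM ?psn_ge0 ?ltW.
by apply: (le_trans (psnM _ _ _)); rewrite ler_wpM2r ?psn_ge0// ltW.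
Qed.

Fact pstar_continuous : continuous (star : P -> P).
Proof.
move=> x; apply: (@cvg_opprod _ (nbhs x)) => i e e0.
apply: (@near_psnS i x e) => // y /=.
have <- : star (y - x) = star y - star x.
  by rewrite -scaleN1r starD starZ rmorphN rmorph1 scaleN1r.
by rewrite psn_star.
Qed.

HB.instance Definition _ := isTopStarAlgebra.Build R P
  pmul_continuous pstar_continuous.

Lemma pcompB x y i u : pcomp (x - y) i u = pcomp x i u - pcomp y i u.
Proof. by rewrite /= scaleN1r. Qed.

(** Pointwise limits of a Cauchy filter of bounded operators converge in
    norm, so every component stays in its norm closed algebra. *)
Lemma opprod_complete : add_complete (P : topologicalLmodType R[i]).
Proof.
move=> Fl FF cF.
have cau i (e : R) : 0 < e ->
    exists2 B : set P, Fl B & forall x y, B x -> B y -> psn i (x - y) < e.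
  move=> e0; have := cF [set z | psn i z < e]; apply.
  by exists [:: i], e => // z hz; have := hz i (mem_head _ _); rewrite subr0.
have lim i u : exists v, forall e : R, 0 < e ->
    Fl [set x | hnorm (v - pcomp x i u) < e].
  have := @hcomplete _ _ ((fun x => pcomp x i u) @ Fl); apply => e e0.
  have e1 : 0 < e / (hnorm u + 1) by rewrite divr_gt0// ltr_wpDl ?hnorm_ge0.
  have [B FB Bxy] := cau i _ e1.
  exists [set v | exists2 x, B x & pcomp x i u = v].
    by apply: (@filterS _ Fl _ B) FB => x Bx; exists x.
  move=> _ _ [x Bx <-] [y By <-]; rewrite -pcompB.
  apply: (le_lt_trans (psn_bound _ _)).
  apply: (@le_lt_trans _ _ (e / (hnorm u + 1) * hnorm u)).
    by rewrite ler_wpM2r ?hnorm_ge0// ltW// Bxy.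
  rewrite mulrAC ltr_pdivrMr ?ltr_wpDl ?hnorm_ge0//.
  by rewrite ltr_pM2l// ltrDl.
have {lim} [T TP] : exists T : forall i : fidx X, fsp i -> fsp i, forall i u (e : R),
    0 < e -> Fl [set x | hnorm (T i u - pcomp x i u) < e].
  by exists (fun i u => sval (cid (lim i u))) => i u; case: cid.
have Tlin i (c : R[i]) u v : T i (c *: u + v) = c *: T i u + T i v.
  apply/eqP; rewrite -subr_eq0; apply/eqP/hnorm_eq0/le_anti.
  rewrite hnorm_ge0 andbT; apply/ler_addgt0Pl => e e0; rewrite addr0.
  pose k := normc c + 2; have k0 : 0 < k by rewrite ltr_wpDl ?normc_ge0.
  have e1 : 0 < e / k by rewrite divr_gt0.
  have [x [[/= h1 h2] h3]] := filter_ex (filterI (filterI (TP i (c *: u + v) _ e1)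
    (TP i u _ e1)) (TP i v _ e1)).
  have -> : T i (c *: u + v) - (c *: T i u + T i v) =
      (T i (c *: u + v) - pcomp x i (c *: u + v)) -
      (c *: (T i u - pcomp x i u) + (T i v - pcomp x i v)).
    rewrite (boundedP (pbop x i)) scalerBr [in RHS]addrACA -opprD opprB.
    by rewrite subrKA.
  apply: (le_trans (hnormD _ _)); rewrite hnormN.
  have -> : e = e / k + (normc c * (e / k) + e / k).
    have : e / k * (normc c + 2) = e by rewrite divfK// gt_eqF.
    by move: (e / k) => q qE; lra.
  rewrite lerD ?(ltW h1)//; apply: (le_trans (hnormD _ _)).
  by rewrite hnormZ lerD ?ler_wpM2l ?normc_ge0 ?(ltW h2) ?(ltW h3).
have Tclose i (e : R) B x : 0 < e -> Fl B ->
    (forall x y, B x -> B y -> psn i (x - y) < e) -> B x ->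
    op_bound (fun u => T i u - pcomp x i u) e.
  move=> e0 FB Bxy Bx; apply/op_boundP => u; apply/ler_addgt0Pl => e' e'0.
  have [y [/= h By]] := filter_ex (filterI (TP i u _ e'0) FB).
  apply: (le_trans (hnorm_sub_le _ (pcomp y i u) _)); apply: lerD (ltW h) _.
  rewrite -pcompB; apply: (le_trans (psn_bound _ _)).
  by rewrite ler_wpM2r ?hnorm_ge0// ltW// Bxy.
have Tb i : bounded_op (T i).
  split; first exact: Tlin.
  have [B FB Bxy] := cau i _ ltr01.
  have [x Bx] := filter_ex FB.
  exists (1 + psn i x); apply/op_boundP => u.
  rewrite -[T i u](subrK (pcomp x i u)); apply: (le_trans (hnormD _ _)).
  rewrite mulrDl lerD ?psn_bound//.
  by move/op_boundP: (Tclose i 1 B x ltr01 FB Bxy Bx); apply.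
have Tops i : fops i (T i).
  apply: ops_closed => // e e0; have [B FB Bxy] := cau i _ e0.
  have [x Bx] := filter_ex FB; exists (pcomp x i); first exact: pcompP.
  exact: Tclose FB Bxy Bx.
exists (OpProd Tops); apply: (@cvg_opprod _ _ id) => i e e0.
have e2 : 0 < e / 2 by rewrite divr_gt0.
have [B FB Bxy] := cau i _ e2; have := FB; apply: filterS => x Bx.
apply: (@le_lt_trans _ _ (e / 2)); last by rewrite ltr_pdivrMr// ltr_pMr// ltr1n.
rewrite psnB; apply: psn_le; first exact: ltW.
have := Tclose i _ B x e2 FB Bxy Bx.
by move=> /op_boundP h; apply/op_boundP => u; rewrite pcompB; exact: h.
Qed.

Lemma psn_continuous i : continuous (psn i : P -> R).
Proof.
move=> x; apply/(@cvgrPdist_lt _ _ _ (nbhs x)) => e e0.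
apply: (@near_psnS i x e) => // y; apply: le_lt_trans.
have h1 : psn i x <= psn i (y - x) + psn i y.
  by have := psnD i (x - y) y; rewrite subrK psnB.
have h2 : psn i y <= psn i (y - x) + psn i x.
  by have := psnD i (y - x) x; rewrite subrK.
by rewrite ler_norml; apply/andP; split; lra.
Qed.

Lemma opprod_pro_cstar : pro_cstar (P : topStarAlgType R).
Proof.
split; [|exact: opprod_complete|].
- move=> x y cl; apply: psn_eq0 => i; apply/le_anti; rewrite psn_ge0 andbT.
  apply/ler_addgt0Pl => e e0; rewrite addr0.
  have e2 : 0 < e / 2 by rewrite divr_gt0.
  have [z [/= zx zy]] := cl _ _ (near_psn i x e2) (near_psn i y e2).
  apply: (le_trans (psnBD _ _ z _)); rewrite psnB [leRHS]splitr.
  by rewrite lerD// ltW.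
- move=> U [s [e e0 sU]]; exists (size s), (fun j => psn (tnth (in_tuple s) j)), e.
  split=> // [j|x xs]; first split; last 1 first.
  + apply: sU => i si; rewrite subr0.
    have := si; rewrite -index_mem => hi; have := xs (Ordinal hi).
    by rewrite (tnth_nth i) /= nth_index.
  + split; [exact: psnD| |exact: psnM|exact: psn_cstar].
    by move=> c x; rewrite psnZ rmorphM.
  + exact: psn_continuous.
Qed.

End OpProd.

(** * The tower of finite sums and its limit *)

Lemma lrmorphism_ex (R : realType) (A B : algType R[i]) (f : A -> B) :
  (forall (c : R[i]) x y, f (c *: x + y) = c *: f x + f y) -> f 1 = 1 ->
  (forall x y, f (x * y) = f x * f y) ->
  exists g : {lrmorphism A -> B}, g =1 f.
Proof.
move=> fl f1 fM.
pose m1 := GRing.isLinear.Build R[i] A B *:%R f fl.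
pose m2 := GRing.isMonoidMorphism.Build A B f (f1, fM).
pose g : {lrmorphism A -> B} := HB.pack f m1 m2.
by exists g.
Qed.

Section Tower.
Context (R : realType) (F : nat -> hilbertType R) (S : forall n, star_ops (F n)).
Hypothesis F0_neq0 : exists u : F 0%N, u <> 0.

Definition sum_family N : op_family R :=
  @OpFamily R 'I_N.+1 (fun n => F n) (fun n => S n) ord0 F0_neq0.

Definition limit_family : op_family R := @OpFamily R nat F S 0%N F0_neq0.

Definition opsum N : Type := opprod (sum_family N).
HB.instance Definition _ N := TopStarAlgebra.on (opsum N).

Definition oplim : topStarAlgType R := opprod limit_family.

Section OpSumNorm.
Context (N : nat).
Implicit Types x y : opsum N.

Definition cn x : R := \big[Num.max/0]_(i < N.+1) psn (X := sum_family N) i x.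

Lemma cn_leP x (k : R) : 0 <= k ->
  cn x <= k <-> forall i, psn (X := sum_family N) i x <= k.
Proof.
move=> k0; split=> [/bigmax_leP[_ h] i|h]; first exact: h.
by apply/bigmax_leP; split=> // i _; exact: h.
Qed.

Lemma le_cn x i : psn (X := sum_family N) i x <= cn x.
Proof. exact: le_bigmax. Qed.

Lemma cn_ge0 x : 0 <= cn x.
Proof. by apply: le_trans (le_cn x ord0); exact: psn_ge0. Qed.

Fact cn_eq0 x : cn x = 0 -> x = 0.
Proof.
move=> x0; apply: psn_eq0 => i; apply/le_anti.
by rewrite psn_ge0 andbT subr0 -x0 le_cn.
Qed.

Fact cnD x y : cn (x + y) <= cn x + cn y.
Proof.
apply/cn_leP => [|i]; first by rewrite addr_ge0 ?cn_ge0.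
by apply: (le_trans (psnD _ _ _)); rewrite lerD ?le_cn.
Qed.

Fact cnZ (c : R[i]) x : (cn (c *: x))%:C = `|c| * (cn x)%:C.
Proof.
rewrite -cabsE -rmorphM; congr (_%:C); apply/le_anti/andP; split.
  apply/cn_leP => [|i]; first by rewrite mulr_ge0 ?cn_ge0 ?normc_ge0.
  by rewrite psnZ ler_wpM2l ?normc_ge0 ?le_cn.
have [->|c0] := eqVneq c 0; first by rewrite normc0 mul0r cn_ge0.
have n0 : 0 < normc c.
  by rewrite lt_def normc_ge0 andbT; apply: contra_neq c0; exact: eq0_normc.
rewrite mulrC -ler_pdivlMr//; apply/cn_leP => [|i].
  by rewrite divr_ge0 ?cn_ge0 ?normc_ge0.
by rewrite ler_pdivlMr// mulrC -psnZ le_cn.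
Qed.

Fact cnM x y : cn (x * y) <= cn x * cn y.
Proof.
apply/cn_leP => [|i]; first by rewrite mulr_ge0 ?cn_ge0.
by apply: (le_trans (psnM _ _ _)); rewrite ler_pM ?psn_ge0 ?le_cn.
Qed.

Fact cn_star x : cn (star x * x) = cn x ^+ 2.
Proof.
apply/le_anti/andP; split.
  apply/cn_leP => [|i]; first by rewrite exprn_ge0 ?cn_ge0.
  by rewrite psn_cstar ler_pXn2r ?nnegrE ?psn_ge0 ?cn_ge0 ?le_cn.
set k := cn (star x * x); have k0 : 0 <= k by exact: cn_ge0.
rewrite -[leRHS]sqr_sqrtr// ler_pXn2r ?nnegrE ?cn_ge0 ?sqrtr_ge0//.
apply/cn_leP => [|i]; first exact: sqrtr_ge0.
rewrite -(ler_pXn2r (n := 2)) ?nnegrE ?psn_ge0 ?sqrtr_ge0//.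
by rewrite -psn_cstar sqr_sqrtr// le_cn.
Qed.

Fact cn_nbhs x (U : set (opsum N)) :
  nbhs x U <-> exists2 e : R, 0 < e & [set y | cn (y - x) < e] `<=` U.
Proof.
split=> [[s [e e0 sU]]|[e e0 eU]].
  exists e => // y /= xy; apply: sU => i _; apply: le_lt_trans xy; exact: le_cn.
exists (enum 'I_N.+1), e => // y xy; apply: eU; rewrite /= /cn.
by apply/bigmax_ltP; split=> // i _; apply: xy; rewrite mem_enum.
Qed.

Fact cn_complete : add_complete (opsum N : topologicalLmodType R[i]).
Proof. exact: opprod_complete. Qed.

HB.instance Definition _ := isCStarAlgebra.Build R (opsum N)
  cn_eq0 cnD cnZ cnM cn_star cn_nbhs cn_complete.

End OpSumNorm.

Definition evS N (n : 'I_N.+1) (x : opsum N) : F n -> F n := pcomp x n.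

Lemma opsum_cstar_sum N : is_cstar_sum (fun n => S n : set _) (@evS N).
Proof.
split; last 1 first.
- move=> x k k0; split=> [/(cn_leP x k0) h n|h].
    apply: op_bound_le (h n) _; apply: opnormP; exact: ops_bounded (pcompP x n).
  by apply: (proj2 (cn_leP x k0)) => n; apply: opnorm_le => //; exact: h.
- split=> //; first by move=> n x; exact: pcompP.
  move=> T TS; exists (@OpProd _ (sum_family N) T TS); split=> // y h.
  by apply: opprod_eq => i u /=; rewrite -h.
- by move=> n x u v; exact: pstarE.
Qed.

Definition restr N (x : opsum N.+1) : opsum N :=
  @OpProd _ (sum_family N) (fun n => pcomp x (widen_ord (leqnSn N.+1) n))
    (fun n => pcompP x _).

Definition proj N (x : oplim) : opsum N :=
  @OpProd _ (sum_family N) (fun n => pcomp x (nat_of_ord n))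
    (fun n => pcompP x _).

Lemma restr_ex N : exists g : {lrmorphism opsum N.+1 -> opsum N}, g =1 @restr N.
Proof. by apply: lrmorphism_ex => *; apply: opprod_eq. Qed.

Lemma proj_ex N : exists g : {lrmorphism oplim -> opsum N}, g =1 @proj N.
Proof. by apply: lrmorphism_ex => *; apply: opprod_eq. Qed.

Definition conn N : {lrmorphism opsum N.+1 -> opsum N} := sval (cid (restr_ex N)).
Definition plim N : {lrmorphism oplim -> opsum N} := sval (cid (proj_ex N)).

Lemma connE N x : conn N x = restr x.
Proof. by rewrite /conn; case: cid. Qed.

Lemma plimE N x : plim N x = proj N x.
Proof. by rewrite /plim; case: cid. Qed.

Lemma conn_topstar N : topstar_morphism (conn N).
Proof.
split=> [x|x].
  apply: (@cvg_opprod _ _ _ (nbhs x)) => i e e0.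
  apply: (@near_psnS _ (sum_family N.+1) (widen_ord (leqnSn N.+1) i) x e) => // y.
  by rewrite !connE; apply: le_lt_trans.
apply: opprod_eq => i u; apply: inner_injl => w.
by rewrite !connE (starE (restr x)).
Qed.

Lemma plim_topstar N : topstar_morphism (plim N).
Proof.
split=> [x|x].
  apply: (@cvg_opprod _ _ _ (nbhs x)) => i e e0.
  apply: (@near_psnS _ limit_family (nat_of_ord i) x e) => // y.
  by rewrite !plimE; apply: le_lt_trans.
apply: opprod_eq => i u; apply: inner_injl => w.
by rewrite !plimE (starE (proj N x)).
Qed.

(** Completion by identities, which shows that the connecting maps are
    onto. *)
Definition extend N (y : opsum N) k : F k -> F k :=
  match @idP (k < N.+1)%N with
  | ReflectT kN => pcomp y (Ordinal kN : fidx (sum_family N))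
  | ReflectF _ => id
  end.

Lemma extendP N (y : opsum N) k : S k (@extend N y k).
Proof.
rewrite /extend; case: {-}_ / idP => kN; last exact: ops_id.
exact: (pcompP y (Ordinal kN : fidx (sum_family N))).
Qed.

Lemma extendE N (y : opsum N) (n : 'I_N.+1) : @extend N y n = pcomp y n.
Proof.
case: n => k kN; rewrite /extend /=; case: {-}_ / idP => // kN'.
by rewrite (bool_irrelevance kN' kN).
Qed.

Lemma conn_surj N (y : opsum N) : exists x, conn N x = y.
Proof.
exists (@OpProd _ (sum_family N.+1) (fun n => @extend N y n) (fun n => extendP y n)).
rewrite connE; apply: opprod_eq => i u /=.
by have := extendE y i; rewrite /= => ->.
Qed.

Lemma plim_conn N x : conn N (plim N.+1 x) = plim N x.
Proof. by rewrite connE !plimE; apply: opprod_eq. Qed.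

Lemma oplim_eq (x y : oplim) :
  (forall N, plim N x = plim N y) -> x = y.
Proof.
move=> e; apply: opprod_eq => i u.
have := e i; rewrite !plimE => /(congr1 (fun z : opsum i => pcomp z ord_max u)).
by [].
Qed.

(** In a compatible family the n-th component is fixed from stage n on. *)
Lemma widen_compat (T : forall N (n : 'I_N.+1), F n -> F n) :
  (forall N (n : 'I_N.+1), T N n = T N.+1 (widen_ord (leqnSn N.+1) n)) ->
  forall N k (kN : (k < N.+1)%N),
    T N (Ordinal kN) = T k (Ordinal (ltnSn k)) :> (F k -> F k).
Proof.
move=> Tw; elim=> [|N IH] k kN.
  by case: k kN => // kN; rewrite (bool_irrelevance kN (ltnSn 0)).
have := kN; rewrite ltnS leq_eqVlt => /orP[/eqP kE|kN'].
  by subst k; rewrite (bool_irrelevance kN (ltnSn N.+1)).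
rewrite -(IH k kN').
have -> : kN = widen_ord_proof (Ordinal kN') (leqnSn N.+1).
  exact: bool_irrelevance.
exact/esym/(Tw N (Ordinal kN')).
Qed.

Section Cone.
Context (Y : algType R[i]) (f : forall N, {lrmorphism Y -> opsum N}).
Hypothesis f_conn : forall N y, conn N (f N.+1 y) = f N y.

(** The n-th component of the limit is read off at stage n, where it is the
    last one. *)
Definition cone (y : Y) : oplim :=
  @OpProd _ limit_family (fun n => pcomp (f n y) (ord_max : fidx (sum_family n)))
    (fun n => pcompP (f n y) _).

Lemma cone_comp N (n : 'I_N.+1) y :
  pcomp (f n y) (ord_max : fidx (sum_family n)) = pcomp (f N y) n.
Proof.
pose T N (n : 'I_N.+1) : F n -> F n := pcomp (f N y) n.
have Tw N' (n' : 'I_N'.+1) : T N' n' = T N'.+1 (widen_ord (leqnSn N'.+1) n').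
  by rewrite /T -f_conn connE.
case: n => k kN /=; have := widen_compat Tw kN; rewrite /T => ->.
by [].
Qed.

Lemma proj_cone N y : proj N (cone y) = f N y.
Proof. by apply: opprod_eq => i u; have /= := cone_comp i y => ->. Qed.

Lemma cone_ex : exists g : {lrmorphism Y -> oplim}, g =1 cone.
Proof.
apply: lrmorphism_ex => [c x y||x y]; apply: opprod_eq => i u /=.
- by rewrite linearP.
- by rewrite rmorph1.
- by rewrite rmorphM.
Qed.

Lemma cone_unique (h : Y -> oplim) :
  (forall N y, plim N (h y) = f N y) -> h =1 cone.
Proof.
by move=> hf y; apply: oplim_eq => N; rewrite hf plimE proj_cone.
Qed.

End Cone.

Lemma oplim_inverse_limit :
  @is_inverse_limit R (fun N => opsum N : topStarAlgType R) conn oplim plim.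
Proof.
split; [exact: plim_topstar|exact: plim_conn|].
move=> Y f ft fc; have [g gE] := cone_ex f.
exists g; split.
- split=> [y|y].
    apply: (@cvg_opprod _ _ _ (nbhs y)) => i e e0.
    have [cf _] := ft i.
    have N := cf y _ (near_psn (ord_max : fidx (sum_family i)) (f i y) e0).
    by apply: (@filterS _ (nbhs y) _ _ _ _ N) => z; rewrite !gE.
  apply: opprod_eq => i u; rewrite !gE; have [_ fs] := ft i.
  apply: inner_injl => w; rewrite (@starE _ limit_family (cone f y) i u w).
  have /= -> := fs y.
  exact: (@starE _ (sum_family i) (f i y) ord_max u w).
- by move=> N y; rewrite gE plimE proj_cone.
- by move=> h _ hf y; rewrite gE; exact: cone_unique.
Qed.

Section Embedding.
Context (Hn : forall n, set (F n -> F n)) (HS : forall n, Hn n `<=` S n).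
Context (B : nat -> algType R[i]) (evB : forall N (n : 'I_N.+1), B N -> F n -> F n)
  (connB : forall N, {lrmorphism B N.+1 -> B N})
  (dotH : algType R[i]) (pB : forall N, {lrmorphism dotH -> B N}).
Hypotheses (sumB : forall N, is_op_sum Hn (@evB N))
  (evB_conn : forall N (n : 'I_N.+1) x,
     @evB N n (connB N x) = @evB N.+1 (widen_ord (leqnSn N.+1) n) x)
  (limB : is_algebra_limit connB pB).

Lemma evB_in N (n : 'I_N.+1) x : S n (@evB N n x).
Proof. by apply: HS; have [_ _ _ h _] := sumB N; exact: h. Qed.

Lemma evB_inj N x y : (forall n : 'I_N.+1, @evB N n x = @evB N n y) -> x = y.
Proof.
move=> e; have [_ _ _ h /(_ (fun n => @evB N n y)) ex] := sumB N.
have [|z [_ zu]] := ex; first by move=> n; exact: h.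
by rewrite -(zu x e) -(zu y).
Qed.

Definition embed N (x : B N) : opsum N :=
  @OpProd _ (sum_family N) (fun n => @evB N n x) (fun n => evB_in n x).

Lemma embed_ex N : exists g : {lrmorphism B N -> opsum N}, g =1 @embed N.
Proof.
have [l o m _ _] := sumB N.
apply: lrmorphism_ex => [c x y||x y]; apply: opprod_eq => i u /=.
- by rewrite l.
- by rewrite o.
- by rewrite m.
Qed.

(** An element of either tower is a family of operators, hence is determined
    by its components: inclusions of the sets of operators give injective
    maps, and so does passage to the limit. *)
Lemma tower_embedding :
  exists (emb : forall N, {lrmorphism B N -> opsum N})
    (j : {lrmorphism dotH -> oplim}),
  [/\ forall N (n : 'I_N.+1) x, @evS N n (emb N x) = @evB N n x,
      forall N, injective (emb N),
      forall N x, conn N (emb N.+1 x) = emb N (connB N x),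
      forall N x, plim N (j x) = emb N (pB N x) &
      injective j].
Proof.
have [emb embE] : exists emb : forall N, {lrmorphism B N -> opsum N},
    forall N, emb N =1 @embed N.
  by exists (fun N => sval (cid (@embed_ex N))) => N; case: cid.
have [pB_conn limx] := limB.
have emb_conn N x : conn N (emb N.+1 x) = emb N (connB N x).
  rewrite !embE connE; apply: opprod_eq => i u /=.
  by rewrite evB_conn.
pose f N : {lrmorphism dotH -> opsum N} := emb N \o pB N.
have f_conn N y : conn N (f N.+1 y) = f N y.
  by rewrite /= emb_conn pB_conn.
have [j jE] := cone_ex f; exists emb, j.
have emb_inj N : injective (emb N).
  move=> x y; rewrite !embE => e; apply: evB_inj => n.
  by have := congr1 (fun z : opsum N => pcomp z n) e.
have plim_j N x : plim N (j x) = emb N (pB N x).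
  by rewrite jE plimE (proj_cone f_conn).
split=> //; first by move=> N n x; rewrite embE.
move=> x y jxy; have [|z [_ zu]] := limx (fun N => pB N y) => //.
rewrite -(zu x) ?(zu y)// => N; apply: emb_inj.
by rewrite -!plim_j jxy.
Qed.

End Embedding.
End Tower.

(** * Euclidean and Delone geometry *)

Lemma ultra_fmap (T U : Type) (f : T -> U) (Fl : set_system T) :
  UltraFilter Fl -> UltraFilter (f @ Fl).
Proof.
move=> UF; split=> [|G GG FG]; first exact: fmap_proper_filter.
apply/seteqP; split=> // A GA.
have [//|FA] := in_ultra_setVsetC (f @^-1` A) UF.
have [x [Ax nAx]] := filter_ex (filterI GA (FG (~` A) FA)).
by [].
Qed.

(** Compactness is used along ultrafilters, as convergence of patterns has a
    simple description along every filter. *)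
Lemma compact_ultra_cvg (T : Type) (X : topologicalType) (K : set X)
    (f : T -> X) (Fl : set_system T) : compact K -> UltraFilter Fl ->
  (\forall t \near Fl, K (f t)) -> exists2 x, K x & f @ Fl --> x.
Proof.
rewrite compact_ultra => cK UF FK.
have [x [Kx fx]] := cK _ (ultra_fmap f UF) FK.
by exists x.
Qed.

Section Euclid.
Context (R : realType) (d : nat).
Local Notation E := 'rV[R]_d.
Implicit Types x y z : E.

Lemma enorm_ge0 x : 0 <= enorm x.
Proof. exact: sqrtr_ge0. Qed.

Lemma enorm_sqr x : enorm x ^+ 2 = \sum_(i < d) x 0 i ^+ 2.
Proof. by rewrite sqr_sqrtr// sumr_ge0// => i _; exact: sqr_ge0. Qed.

Lemma enorm0 : enorm (0 : E) = 0.
Proof.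
by rewrite /enorm big1 ?sqrtr0// => i _; rewrite mxE expr0n.
Qed.

Lemma enormN x : enorm (- x) = enorm x.
Proof. by congr Num.sqrt; apply: eq_bigr => i _; rewrite mxE sqrrN. Qed.

Lemma enormBC x y : enorm (x - y) = enorm (y - x).
Proof. by rewrite -enormN opprB. Qed.

Lemma enormZ (c : R) x : enorm (c *: x) = `|c| * enorm x.
Proof.
rewrite /enorm -sqrtr_sqr -sqrtrM ?sqr_ge0// mulr_sumr.
by congr Num.sqrt; apply: eq_bigr => i _; rewrite mxE exprMn.
Qed.

Lemma enorm_eq0 x : enorm x = 0 -> x = 0.
Proof.
move=> x0; have := enorm_sqr x; rewrite x0 expr0n /= => /esym/eqP.
rewrite psumr_eq0 => [/allP h|i _]; last exact: sqr_ge0.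
apply/rowP => i; rewrite mxE; apply/eqP.
by have := h i; rewrite mem_index_enum sqrf_eq0; exact.
Qed.

Lemma enormD x y : enorm (x + y) <= enorm x + enorm y.
Proof.
pose p := \sum_(i < d) x 0 i * y 0 i.
have xyE : enorm (x + y) ^+ 2 = enorm x ^+ 2 + 2 * p + enorm y ^+ 2.
  rewrite !enorm_sqr mulr_sumr -!big_split /=; apply: eq_bigr => i _.
  by rewrite mxE; ring.
suff pxy : p <= enorm x * enorm y.
  rewrite -(ler_pXn2r (n := 2)) ?nnegrE ?addr_ge0 ?enorm_ge0//.
  by rewrite xyE sqrrD; move: pxy; lra.
have [x0|x0] := eqVneq (enorm x) 0.
  rewrite x0 mul0r /p big1// => i _.
  by rewrite (enorm_eq0 x0) mxE mul0r.
have [y0|y0] := eqVneq (enorm y) 0.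
  rewrite y0 mulr0 /p big1// => i _.
  by rewrite (enorm_eq0 y0) mxE mulr0.
have p0 : 0 < enorm x * enorm y.
  by rewrite mulr_gt0// lt_def enorm_ge0 ?x0 ?y0.
have : 0 <= \sum_(i < d) (enorm y * x 0 i - enorm x * y 0 i) ^+ 2.
  by rewrite sumr_ge0// => i _; exact: sqr_ge0.
have -> : \sum_(i < d) (enorm y * x 0 i - enorm x * y 0 i) ^+ 2 =
    2 * (enorm x * enorm y) * (enorm x * enorm y - p).
  transitivity (enorm y ^+ 2 * (\sum_(i < d) x 0 i ^+ 2) -
      2 * (enorm x * enorm y) * p + enorm x ^+ 2 * (\sum_(i < d) y 0 i ^+ 2)).
    rewrite /p !mulr_sumr -sumrN -!big_split /=; apply: eq_bigr => i _; ring.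
  by rewrite -!enorm_sqr; ring.
have p2 : 0 < 2 * (enorm x * enorm y) by lra.
by rewrite (pmulr_rge0 _ p2) subr_ge0.
Qed.

Lemma enormB_le x y z : enorm (x - z) <= enorm (x - y) + enorm (y - z).
Proof. by rewrite -[x - z](subrKA y) enormD. Qed.

Lemma enorm_triangle x y : enorm x <= enorm (x - y) + enorm y.
Proof. by have := enormD (x - y) y; rewrite subrK. Qed.

Lemma coord_le_enorm x i : `|x 0 i| <= enorm x.
Proof.
rewrite -sqrtr_sqr ler_wsqrtr// (bigD1 i)//= lerDl.
by rewrite sumr_ge0// => j _; exact: sqr_ge0.
Qed.

Lemma norm_le_enorm x : `|x| <= enorm x.
Proof.
rewrite -[ `|x| ]/(mx_norm x) mx_normrE; apply/bigmax_leP; split=> [|[i j] _]; first exact: enorm_ge0.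
by rewrite (ord1 i); exact: coord_le_enorm.
Qed.

Lemma enorm_le_norm x : enorm x <= d%:R * `|x|.
Proof.
have h (s : seq 'I_d) : Num.sqrt (\sum_(i <- s) x 0 i ^+ 2) <= (size s)%:R * `|x|.
  elim: s => [|i s IH] /=; first by rewrite big_nil sqrtr0 mul0r.
  rewrite big_cons -natr1 mulrDl mul1r addrC.
  have a0 : 0 <= \sum_(j <- s) x 0 j ^+ 2 by rewrite sumr_ge0// => j _; exact: sqr_ge0.
  rewrite -(ler_pXn2r (n := 2)) ?nnegrE ?addr_ge0 ?mulr_ge0 ?sqrtr_ge0//.
  rewrite sqr_sqrtr ?addr_ge0 ?sqr_ge0// sqrrD.
  have xi : x 0 i ^+ 2 <= `|x| ^+ 2.
    rewrite -[x 0 i ^+ 2]real_normK ?num_real// ler_pXn2r ?nnegrE//.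
    by rewrite -[ `|x| ]/(mx_norm x) mx_normrE; exact: (le_bigmax _ _ (0, i)).
  have IH2 : \sum_(j <- s) x 0 j ^+ 2 <= ((size s)%:R * `|x|) ^+ 2.
    by rewrite -[leLHS]sqr_sqrtr// ler_pXn2r ?nnegrE ?mulr_ge0 ?sqrtr_ge0.
  have : 0 <= (size s)%:R * `|x| * `|x| by rewrite !mulr_ge0.
  by rewrite -mulr_natl; move: xi IH2; lra.
by have := h (enum 'I_d); rewrite big_enum size_enum_ord.
Qed.

Lemma near_enorm x (e : R) : 0 < e -> \forall y \near x, enorm (y - x) < e.
Proof.
move=> e0; have p : 0 < (d%:R : R) + 1 by rewrite ltr_wpDl.
have e1 : 0 < e / (d%:R + 1) by rewrite divr_gt0.
move/cvgrPdist_lt: (@cvg_id _ (nbhs x)) => /(_ _ e1).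
apply: filterS => y yx; apply: (le_lt_trans (enorm_le_norm _)).
apply: (@le_lt_trans _ _ (d%:R * (e / (d%:R + 1)))).
  by rewrite ler_wpM2l// distrC ltW.
rewrite mulrA ltr_pdivrMr// mulrDr mulr1 mulrC ltrDl//.
Qed.

Lemma ultra_enorm (T : Type) (Fl : set_system T) (f : T -> E) (M : R) :
  UltraFilter Fl -> (\forall t \near Fl, enorm (f t) <= M) ->
  exists l : E, forall e : R, 0 < e -> \forall t \near Fl, enorm (f t - l) < e.
Proof.
move=> UF fM.
pose B : set E := [set x | `|x| <= M].
have cB : compact B.
  apply: bounded_closed_compact.
    exists M; split; first exact: num_real.
    by move=> N MN x /le_trans; apply; exact: ltW.
  rewrite (_ : B = Num.norm @^-1` [set y : R | y <= M]); last by [].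
  by apply: closed_comp; [move=> x _; exact: norm_continuous|exact: closed_le].
have [|l _ fl] := @compact_ultra_cvg _ _ B f Fl cB UF.
  by apply: filterS fM => t; apply: le_trans; exact: norm_le_enorm.
exists l => e e0; exact: fl (near_enorm l e0).
Qed.

(** Two points lie in a common ball of radius r exactly when their distance
    is at most twice r. *)
Lemma delone_sep (r rho : R) (L : set E) x y : delone r rho L ->
  L x -> L y -> enorm (x - y) <= 2 * r -> x = y.
Proof.
move=> [sep _] Lx Ly xy; apply: (sep (2^-1 *: (x + y))) => //.
- have -> : x - 2^-1 *: (x + y) = 2^-1 *: (x - y).
    by apply/rowP => i; rewrite !mxE; field.
  by rewrite enormZ ger0_norm ?invr_ge0//; lra.
- have -> : y - 2^-1 *: (x + y) = 2^-1 *: (y - x).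
  by apply/rowP => i; rewrite !mxE; field.
by rewrite enormZ ger0_norm ?invr_ge0// enormBC; lra.
Qed.

(** Points of L that approach x are eventually within 2 r of each other, hence
    eventually constant. *)
Lemma delone_closed (r rho : R) (L : set E) x : 0 < r -> delone r rho L ->
  (forall e : R, 0 < e -> exists2 y, L y & enorm (y - x) < e) -> L x.
Proof.
move=> r0 dL h; have [y Ly yx] := h r r0.
suff -> : x = y by [].
apply/eqP; rewrite -subr_eq0; apply: contraT => xy.
have p : 0 < enorm (x - y).
  by rewrite lt_def enorm_ge0 andbT; apply: contra_neq xy; exact: enorm_eq0.
have [z Lz zx] := h _ p; move: (zx); have -> : z = y; last by rewrite enormBC ltxx.
apply: (delone_sep dL Lz Ly); apply: (le_trans (enormB_le _ x _)).
by move: zx yx; rewrite (enormBC x y); lra.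
Qed.

(** A ball is covered by finitely many balls of radius r, each with at most
    one point of L. *)
Lemma delone_finite (r rho : R) (L : set E) (M : R) : 0 < r -> delone r rho L ->
  finite_set [set x | L x /\ enorm x <= M].
Proof.
move=> r0 dL; pose B : set E := [set x | `|x| <= M].
have cB : compact B.
  apply: bounded_closed_compact.
    exists M; split; first exact: num_real.
    by move=> N MN x /le_trans; apply; exact: ltW.
  rewrite (_ : B = Num.norm @^-1` [set y : R | y <= M]); last by [].
  by apply: closed_comp; [move=> x _; exact: norm_continuous|exact: closed_le].
rewrite compact_cover in cB.
have [||D _ DB] := cB E setT (fun x => [set y | enorm (y - x) < r]°).
- by move=> x _; exact: open_interior.
- by move=> x _; exists x => //; exact: near_enorm.
apply: (@sub_finite_set _ _ (\bigcup_(x in [set` D]) [set y | L y /\ enorm (y - x) < r])).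
  move=> x [Lx xM]; have [|c Dc cx] := DB x.
    exact: le_trans (norm_le_enorm x) xM.
  by exists c => //; split=> //; exact: (nbhs_singleton cx).
apply: bigcup_finite => [|c _]; first exact: finite_fset.
have [[y [Ly yc]]|ne] := pselect ([set y | L y /\ enorm (y - c) < r] !=set0).
  apply: (@sub_finite_set _ _ [set y]) => // z [Lz zc] /=.
  apply: (delone_sep dL Lz Ly); apply: (le_trans (enormB_le _ c _)).
  by rewrite (enormBC c y); lra.
by apply: (@sub_finite_set _ _ set0) => // z zP; apply: ne; exists z.
Qed.

End Euclid.

(** * The topology of patterns *)

Section Hausdorff.
Context (R : realType) (d : nat).
Local Notation E := 'rV[R]_d.
Implicit Types (A B L : set E).

Definition within (e : R) A B := forall x, A x -> exists2 y, B y & enorm (x - y) < e.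

Lemma hausdorff_lt A B (e : R) : (hausdorff_dist A B < e%:E)%E ->
  exists2 e1 : R, e1 < e & within e1 A B /\ within e1 B A.
Proof.
move=> h.
have [e1 [he1 e1e]] : exists e1 : R, (hausdorff_dist A B < e1%:E)%E /\ e1 < e.
  move: h; case: (hausdorff_dist A B) => [v| |] //=.
    rewrite lte_fin => ve; exists ((v + e) / 2); rewrite lte_fin.
    by split; [rewrite ltr_pdivlMr// | rewrite ltr_pdivrMr//]; lra.
  by move=> _; exists (e - 1); rewrite ltNyr; split=> //; lra.
exists e1 => //; move: he1; rewrite /hausdorff_dist gt_max => /andP[h1 h2].
have aux X Y : (ereal_sup [set ereal_inf [set (enorm (x - y))%:E | y in Y] |
    x in X] < e1%:E)%E -> within e1 X Y.
  move=> hs x Xx.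
  have : (ereal_inf [set (enorm (x - y))%:E | y in Y] < e1%:E)%E.
    by apply: le_lt_trans hs; apply: ereal_sup_ubound; exists x.
  by move/ereal_inf_lt => [_ [y Yy <-]]; rewrite lte_fin => xy; exists y.
by split; apply: aux.
Qed.

Lemma lt_hausdorff A B (e1 e : R) : e1 < e -> within e1 A B -> within e1 B A ->
  (hausdorff_dist A B < e%:E)%E.
Proof.
move=> e1e AB BA; apply: (@le_lt_trans _ _ e1%:E); last by rewrite lte_fin.
have aux X Y : within e1 X Y -> (ereal_sup [set ereal_inf
    [set (enorm (x - y))%:E | y in Y] | x in X] <= e1%:E)%E.
  move=> XY; apply: ge_ereal_sup => _ [x Xx <-].
  have [y Yy xy] := XY x Xx.
  apply: (@le_trans _ _ (enorm (x - y))%:E); last by rewrite lee_fin ltW.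
  by apply: ereal_inf_lbound; exists y.
by rewrite /hausdorff_dist ge_max !aux.
Qed.

Lemma within_trans (e1 e2 : R) A B C :
  within e1 A B -> within e2 B C -> within (e1 + e2) A C.
Proof.
move=> AB BC x Ax; have [y By xy] := AB x Ax; have [z Cz yz] := BC y By.
by exists z => //; apply: (le_lt_trans (enormB_le _ y _)); rewrite ltrD.
Qed.

(** Unlike windows, these sets of approximations are monotone in M, and they
    ignore the sphere. *)
Definition part_within L (M e : R) L' :=
  forall x, L x -> enorm x <= M -> exists2 y, L' y & enorm (x - y) < e.

(** A partner just outside the ball is replaced by a point of the sphere. *)
Lemma window_within L L' (M e : R) : 0 < e -> e < M -> part_within L M e L' ->
  within e (window L M) (window L' M).
Proof.
move=> e0 eM LL' x [[Lx xM]|xM]; last by exists x; [right|rewrite subrr enorm0].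
have [y L'y xy] := LL' x Lx xM.
have [yM|yM] := leP (enorm y) M; first by exists y => //; left.
have := enorm_triangle y x; rewrite enormBC => yx.
have x0 : 0 < enorm x by lra.
exists ((M / enorm x) *: x).
  rewrite /window /=; right; rewrite enormZ ger0_norm ?divr_ge0 ?enorm_ge0 ?divfK ?gt_eqF//.
  lra.
rewrite -{1}[x]scale1r -scalerBl enormZ.
have -> : 1 - M / enorm x = - ((M - enorm x) / enorm x) by field; rewrite gt_eqF.
rewrite normrN ger0_norm ?divr_ge0 ?subr_ge0 ?enorm_ge0// divfK ?gt_eqF//.
by lra.
Qed.

(** The sphere of the larger window is too far away to serve as a partner of a
    point of norm at most M. *)
Lemma window_part L L' (M e : R) : within e (window L (M + e)) (window L' (M + e)) ->
  0 <= e -> part_within L M e L'.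
Proof.
move=> h e0 x Lx xM; have [|y [[L'y _]|yM] xy] := h x.
- by left; split=> //; lra.
- by exists y.
- exfalso; have := enorm_triangle y x; rewrite enormBC yM; lra.
Qed.

End Hausdorff.

Section PatternTopology.
Context (R : realType) (d : nat) (r rho : R).
Hypothesis r0 : 0 < r.
Local Notation E := 'rV[R]_d.
Local Notation pat n := (pattern d r rho n).
Local Notation pat_pair n := (@pat_pair R d r rho n).

Lemma window_refl (e : R) (A : set E) : 0 < e -> within e A A.
Proof. by move=> e0 x Ax; exists x => //; rewrite subrr enorm0. Qed.

Lemma basic_nbhs_self n (xi : pat n) (M e : R) : 0 < e -> basic_nbhs xi M e xi.
Proof.
move=> e0; split; last by move=> i; rewrite subrr enorm0.
have e2 : 0 < e / 2 by rewrite divr_gt0.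
by apply: (@lt_hausdorff _ _ _ _ (e / 2)); [lra| |]; exact: window_refl.
Qed.

Lemma basic_nbhs_open n (xi : pat n) (M e : R) : 0 < M -> 0 < e -> e < r / 2 ->
  open (basic_nbhs xi M e).
Proof.
move=> M0 e0 er; exists [set basic_nbhs xi M e]; last by rewrite bigcup_set1.
move=> _ ->; exists [fset basic_nbhs xi M e]%fset.
  by move=> U; rewrite in_fset1 => /eqP ->; apply/mem_set; exists xi, M, e.
by rewrite set_fset1 bigcap_set1.
Qed.

(** Convergence without windows: it passes to translates, to relabellings and
    to patterns with other labels in the same lattices. *)
Definition pat_cvg (T : Type) (Fl : set_system T) n (f : T -> pat n)
    (xi : pat n) :=
  (forall i (e : R), 0 < e -> \forall t \near Fl, enorm (lab (f t) i - lab xi i) < e)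
  /\ forall M e : R, 0 < e -> \forall t \near Fl,
       part_within (lat xi) M e (lat (f t)) /\ part_within (lat (f t)) M e (lat xi).

(** A subbasic set is described by a strict inequality, so its conditions at
    xi hold with some margin, which the convergence inside the ball
    consumes. *)
Lemma cvg_patP (T : Type) (Fl : set_system T) n (f : T -> pat n) (xi : pat n) :
  Filter Fl -> f @ Fl --> xi <-> pat_cvg Fl f xi.
Proof.
move=> FF; split=> [fxi|[fl fL] U].
  have near_basic M e : 0 < M -> 0 < e -> e < r / 2 ->
      \forall t \near Fl, basic_nbhs xi M e (f t).
    move=> M0 e0 er; apply: fxi; apply: open_nbhs_nbhs; split.
      exact: basic_nbhs_open.
    exact: basic_nbhs_self.
  have small (e : R) : 0 < e -> exists2 e', 0 < e' & e' < r / 2 /\ e' <= e.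
    move=> e0; exists (Num.min e (r / 4)); first by rewrite lt_min e0 divr_gt0.
    by rewrite gt_min ge_min lexx; split=> //; apply/orP; right; move: r0; lra.
  split=> [i e e0|M e e0]; have [e' e'0 [e'r e'e]] := small _ e0.
    apply: filterS (near_basic 1 e' ltr01 e'0 e'r) => t [_ /(_ i)] h.
    exact: lt_le_trans h e'e.
  have M0 : 0 < `|M| + e' by rewrite ltr_wpDl.
  apply: filterS (near_basic _ e' M0 e'0 e'r) => t [/hausdorff_lt[e1 e1e [h1 h2]] _].
  have w (L L' : set E) : within e1 (window L (`|M| + e')) (window L' (`|M| + e')) ->
      part_within L M e L'.
    move=> h x Lx xM.
    have [|||y L'y xy] := @window_part _ _ L L' `|M| e' _ _ x Lx.
    - move=> z /h[y Wy zy]; exists y => //; exact: lt_trans e1e.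
    - exact: ltW.
    - exact: le_trans xM (ler_norm _).
    - by exists y => //; exact: lt_le_trans xy e'e.
  by split; apply: w.
rewrite nbhsE => -[B [[D' D'fin <-] [I ID Ixi]] BU].
have Fsub j : (exists xi1 M e, [/\ 0 < M, 0 < e, e < r / 2 & j = basic_nbhs xi1 M e]) ->
    j xi -> Fl [set t | j (f t)].
  move=> [xi1 [M [e [M0 e0 er ->]]]] [/hausdorff_lt[e1 e1e [h1 h2]] hl].
  have [de [de0 deM dee]] : exists de : R, [/\ 0 < de, de < M & e1 + de < e].
    exists (Num.min (M / 2) ((e - e1) / 2)); split.
    - by rewrite lt_min !divr_gt0// subr_gt0.
    - by rewrite gt_min; apply/orP; left; lra.
    - have : Num.min (M / 2) ((e - e1) / 2) <= (e - e1) / 2.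
        by rewrite ge_min lexx orbT.
      lra.
  have labs : Fl [set t | forall i, i \in enum 'I_n ->
      enorm (lab (f t) i - lab xi1 i) < e].
    apply: filter_all => i _; have hi := hl i.
    have p : 0 < e - enorm (lab xi i - lab xi1 i) by rewrite subr_gt0.
    apply: filterS (fl i _ p) => t ft.
    by apply: (le_lt_trans (enormB_le _ (lab xi i) _)); lra.
  apply: filterS (filterI labs (fL M _ de0)) => t [tl [tL1 tL2]]; split; last first.
    by move=> i; apply: tl; rewrite mem_enum.
  apply: (lt_hausdorff dee).
    by apply: within_trans h1 _; exact: window_within.
  by rewrite addrC; apply: within_trans h2; exact: window_within.
have [D DD ID'] := D'fin _ ID.
apply: (@filterS _ Fl _ [set t | I (f t)]).
  by move=> t It; apply: BU; exists I.
rewrite -ID'; apply: (@filter_bigI _ _ D (fun j => [set t | j (f t)]) Fl) => j jD.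
apply: Fsub; first by have := DD _ jD; rewrite inE.
by move: Ixi; rewrite -ID'; apply.
Qed.

Lemma pat_cvg_unique n (T : Type) (Fl : set_system T) (f : T -> pat n)
    (xi zeta : pat n) : ProperFilter Fl ->
  pat_cvg Fl f xi -> pat_cvg Fl f zeta -> xi = zeta.
Proof.
move=> FF [l1 L1] [l2 L2]; apply: pattern_eq => [|i]; last first.
  apply/eqP; rewrite -subr_eq0; apply/eqP/enorm_eq0/le_anti.
  rewrite enorm_ge0 andbT; apply/ler_addgt0Pl => e e0; rewrite addr0.
  have e2 : 0 < e / 2 by rewrite divr_gt0.
  have [t [/= h1 h2]] := filter_ex (filterI (l1 i _ e2) (l2 i _ e2)).
  apply: (le_trans (enormB_le _ (lab (f t) i) _)); rewrite enormBC.
  by rewrite [leRHS]splitr lerD// ltW.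
have sub (x1 x2 : pat n) : pat_cvg Fl f x1 -> pat_cvg Fl f x2 -> lat x1 `<=` lat x2.
  move=> [_ h1] [_ h2] x Lx; apply: (delone_closed r0 (lat_delone x2)) => e e0.
  have e2 : 0 < e / 2 by rewrite divr_gt0.
  have [t [[/= g1 _] [_ g2]]] := filter_ex (filterI (h1 (enorm x) _ e2)
    (h2 (enorm x + e / 2) _ e2)).
  have [y Ly xy] := g1 x Lx (lexx _).
  have [|z Lz yz] := g2 y Ly.
    by have := enorm_triangle y x; rewrite enormBC; lra.
  exists z => //; rewrite enormBC; apply: (le_lt_trans (enormB_le _ y _)).
  by rewrite [ltRHS]splitr ltrD.
by apply/seteqP; split; apply: sub.
Qed.

Lemma pat_pair_cvgP (T : Type) (Fl : set_system T) n (f : T -> pat_pair n) p :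
  Filter Fl -> f @ Fl --> p <->
  pat_cvg Fl (fun t => ppl (f t)) (ppl p) /\ pat_cvg Fl (fun t => ppr (f t)) (ppr p).
Proof.
move=> FF; rewrite -!cvg_patP; split=> [fp|[h1 h2] U].
  have vc : {for p, continuous (val : pat_pair n -> pat n * pat n)}.
    exact: initial_continuous.
  have h : val (f t) @[t --> Fl] --> val p by apply: (cvg_comp _ _ fp vc).
  split.
    exact: (@cvg_comp _ _ _ (fun t => val (f t)) fst Fl
      (nbhs (val p)) (nbhs (val p).1) h cvg_fst).
  exact: (@cvg_comp _ _ _ (fun t => val (f t)) snd Fl
    (nbhs (val p)) (nbhs (val p).2) h cvg_snd).
rewrite nbhsE => -[B [[C oC CB] Bp] BU].
have h : (fun t => (ppl (f t), ppr (f t))) @ Fl --> (ppl p, ppr p).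
  exact: (cvg_pair h1 h2).
have Cp : nbhs (ppl p, ppr p) C.
  apply: open_nbhs_nbhs; split=> //; move: Bp; rewrite -CB /=.
  by rewrite -surjective_pairing.
apply: (@filterS _ Fl _ _ _ _ (h _ Cp)) => t Ct; apply: BU; rewrite -CB /=.
by move: Ct; rewrite /= /ppl /ppr -surjective_pairing.
Qed.

Lemma pat_pair_hausdorff n : hausdorff_space (pat_pair n).
Proof.
move=> p q; rewrite cluster_cvgE /= => -[G GG [Gq pG]].
have Gp : G --> p by [].
have [/(_ Gp) [p1 p2] _] := @pat_pair_cvgP _ G n id p _.
have [/(_ Gq) [q1 q2] _] := @pat_pair_cvgP _ G n id q _.
apply: val_inj; move: (pat_cvg_unique GG p1 q1) (pat_cvg_unique GG p2 q2).
by rewrite /ppl /ppr; case: (val p) (val q) => [? ?] [? ?] /= -> ->.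
Qed.

End PatternTopology.

(** * Kernels on pairs of patterns *)

Section Kernels.
Context (R : realType) (d : nat) (r rho : R).
Hypothesis r0 : 0 < r.
Local Notation E := 'rV[R]_d.
Local Notation pat n := (pattern d r rho n).
Local Notation pat_pair n := (@pat_pair R d r rho n).

Lemma translate_cvg (T : Type) (Fl : set_system T) n (f : T -> pat n) xi
    (x : T -> E) (x0 : E) : Filter Fl -> pat_cvg Fl f xi ->
  (forall e : R, 0 < e -> \forall t \near Fl, enorm (x t - x0) < e) ->
  pat_cvg Fl (fun t => translate (x t) (f t)) (translate x0 xi).
Proof.
move=> FF [fl fL] xx; split=> [i e e0|M e e0].
  have e2 : 0 < e / 2 by rewrite divr_gt0.
  apply: filterS (filterI (fl i _ e2) (xx _ e2)) => t [h1 h2] /=.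
  have -> : lab (f t) i - x t - (lab xi i - x0) =
      (lab (f t) i - lab xi i) - (x t - x0) by apply/rowP => j; rewrite !mxE; ring.
  by apply: (le_lt_trans (enormD _ _)); rewrite enormN; lra.
have e2 : 0 < e / 2 by rewrite divr_gt0.
apply: filterS (filterI (fL (M + enorm x0 + e) _ e2) (xx _ e2)) => t [[h1 h2] h3].
have xb : enorm (x t) <= enorm x0 + e / 2.
  by have := enorm_triangle (x t) x0; lra.
split=> y /= Ly yM.
  have [|z Lz yz] := h1 _ Ly.
    by apply: (le_trans (enormD _ _)); lra.
  exists (z - x t); first by rewrite subrK.
  have -> : y - (z - x t) = (y + x0 - z) + (x t - x0).
    by apply/rowP => j; rewrite !mxE; ring.
  by apply: (le_lt_trans (enormD _ _)); lra.
have [|z Lz yz] := h2 _ Ly.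
  by apply: (le_trans (enormD _ _)); lra.
exists (z - x0); first by rewrite subrK.
have -> : y - (z - x0) = (y + x t - z) - (x t - x0).
  by apply/rowP => j; rewrite !mxE; ring.
by apply: (le_lt_trans (enormD _ _)); rewrite enormN; lra.
Qed.

Definition mkp n (xi zeta : pat n) (e : lat xi = lat zeta) : pat_pair n :=
  exist _ (xi, zeta) (mem_set e).

Lemma pp_lat n (p : pat_pair n) : lat (ppl p) = lat (ppr p).
Proof. exact: (set_mem (valP p)). Qed.

Lemma pat_pair_eq n (p p' : pat_pair n) :
  ppl p = ppl p' -> ppr p = ppr p' -> p = p'.
Proof.
rewrite /ppl /ppr => e1 e2; apply: val_inj.
by rewrite [LHS]surjective_pairing e1 e2 -surjective_pairing.
Qed.

Fact ptranslate_lat n x (p : pat_pair n) :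
  lat (translate x (ppl p)) = lat (translate x (ppr p)).
Proof. by rewrite /= pp_lat. Qed.

Definition ptranslate n x (p : pat_pair n) : pat_pair n := mkp (ptranslate_lat x p).

Lemma ptranslateD n x y (p : pat_pair n) :
  ptranslate x (ptranslate y p) = ptranslate (x + y) p.
Proof. by apply: pat_pair_eq; exact: translateD. Qed.

Lemma ptranslate0 n (p : pat_pair n) : ptranslate 0 p = p.
Proof. by apply: pat_pair_eq; exact: translate0. Qed.

Lemma ptranslate_cvg (T : Type) (Fl : set_system T) n (f : T -> pat_pair n) p
    (x : T -> E) (x0 : E) : Filter Fl -> f @ Fl --> p ->
  (forall e : R, 0 < e -> \forall t \near Fl, enorm (x t - x0) < e) ->
  (fun t => ptranslate (x t) (f t)) @ Fl --> ptranslate x0 p.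
Proof.
move=> FF /(pat_pair_cvgP r0)[h1 h2] xx.
by apply/(pat_pair_cvgP r0); split; exact: translate_cvg.
Qed.

(** Normal form of an orbit under translation. The quotient is homeomorphic to
    the slice of these pairs, where compactness is easier to use. *)
Definition slice n (p : pat_pair n.+1) := ptranslate (lab (ppr p) ord0) p.

Lemma slice_label n (p : pat_pair n.+1) : lab (ppr (slice p)) ord0 = 0.
Proof. exact: subrr. Qed.

Lemma slice_id n (p : pat_pair n.+1) : lab (ppr p) ord0 = 0 -> slice p = p.
Proof. by rewrite /slice => ->; exact: ptranslate0. Qed.

Lemma slice_translate n x (p : pat_pair n.+1) : slice (ptranslate x p) = slice p.
Proof. by rewrite /slice ptranslateD /= subrK. Qed.

Lemma slice_continuous n : continuous (@slice n).
Proof.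
move=> p; apply: (@ptranslate_cvg _ (nbhs p) _ id) => // e e0.
have [/(_ (fun _ => id)) h _] := @pat_pair_cvgP _ _ _ rho r0 _ (nbhs p) _ id p _.
have [_ [hl _]] := h; exact: hl.
Qed.

Local Notation pi p := (\pi_(@pair_quotient R d r rho _) p)%qT.

Lemma pi_translate n x (p : pat_pair n) : pi (ptranslate x p) = pi p.
Proof.
apply/eqquotP; rewrite /= equiv_sym; apply/asboolP; by exists x.
Qed.

Lemma pi_slice n (p : pat_pair n.+1) : pi (slice p) = pi p.
Proof. exact: pi_translate. Qed.

Lemma pi_eqP n (p p' : pat_pair n) : pi p = pi p' -> exists x, p' = ptranslate x p.
Proof.
by move/eqquotP => /asboolP[x [e1 e2]]; exists x; apply: pat_pair_eq.
Qed.

Definition unslice n (z : @pair_quotient R d r rho n.+1) : pat_pair n.+1 :=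
  slice (repr z).

Lemma unslice_pi n (p : pat_pair n.+1) : unslice (pi p) = slice p.
Proof.
have [x ->] : exists x, p = ptranslate x (repr (pi p)).
  by apply: pi_eqP; rewrite reprK.
by rewrite slice_translate pi_translate reprK.
Qed.

Lemma pi_unslice n (z : @pair_quotient R d r rho n.+1) : pi (unslice z) = z.
Proof. by rewrite pi_slice reprK. Qed.

(** The map slice is constant on orbits, hence factors through the quotient
    topology. *)
Lemma unslice_continuous n : continuous (@unslice n).
Proof.
apply/quotient_continuous.
rewrite (_ : _ \o _ = @slice n); first exact: slice_continuous.
by apply/funext => p /=; exact: unslice_pi.
Qed.

End Kernels.

Lemma compact_upper_bound (R : realType) (X : topologicalType) (K : set X)
    (h : X -> R) : compact K -> continuous h -> exists M, forall x, K x -> h x <= M.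
Proof.
move=> cK ch; have : compact (h @` K).
  by apply: continuous_compact => //; exact: continuous_subspaceT.
move=> /compact_bounded[M [_ hM]]; exists (M + 1) => x Kx.
apply: (le_trans (ler_norm _)); apply: (hM (M + 1)); first by rewrite ltrDl.
by exists x.
Qed.

Lemma lim_enorm_le (R : realType) d (T : Type) (Fl : set_system T)
    (f : T -> 'rV[R]_d) (l : 'rV[R]_d) (M : R) : ProperFilter Fl ->
  (forall e : R, 0 < e -> \forall t \near Fl, enorm (f t - l) < e) ->
  (\forall t \near Fl, enorm (f t) <= M) -> enorm l <= M.
Proof.
move=> FF fl fM; apply/ler_addgt0Pl => e e0.
have [t [/= h1 h2]] := filter_ex (filterI (fl e e0) fM).
by have := enorm_triangle l (f t); rewrite enormBC; lra.
Qed.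

Section Coefficients.
Context (R : realType) (d : nat) (r rho : R).
Hypothesis r0 : 0 < r.
Local Notation E := 'rV[R]_d.
Local Notation pat n := (pattern d r rho n).
Local Notation pat_pair n := (@pat_pair R d r rho n).
Local Notation pi p := (\pi_(@pair_quotient R d r rho _) p)%qT.

Definition invariant_kernel n (q : pat_pair n -> R[i]) :=
  forall x p, q (ptranslate x p) = q p.

Definition continuous_kernel n (q : pat_pair n -> R[i]) :=
  continuous (q : pat_pair n -> (R[i])^o).

(** A coefficient without its symmetry under relabelling, which averaging
    restores; the support is described on the slice. *)
Definition compact_kernel n (q : pat_pair n.+1 -> R[i]) :=
  [/\ continuous_kernel q, invariant_kernel q &
      exists2 K : set (pat_pair n.+1), compact K &
        forall p, lab (ppr p) ord0 = 0 -> q p <> 0 -> K p].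

(** A kernel of finite hopping range. Its support may be non-compact modulo
    translations, since distant clusters of points may be left unmoved. *)
Definition local_kernel n (b : pat_pair n -> R[i]) :=
  [/\ continuous_kernel b, invariant_kernel b &
      exists M : R, forall p, b p <> 0 ->
        (forall i, exists j, enorm (lab (ppl p) i - lab (ppr p) j) <= M) /\
        (forall j, exists i, enorm (lab (ppl p) i - lab (ppr p) j) <= M)].

Lemma compact_kernelP n (q : pat_pair n.+1 -> R[i]) : compact_kernel q <->
  exists f : @pair_quotient R d r rho n.+1 -> (R[i])^o,
     [/\ continuous f, compact (closure [set z | f z != 0]) &
         forall p, q p = f (pi p)].
Proof.
split=> [[cq iq [K cK qK]]|[f [cf sf qf]]].
  exists (fun z => q (unslice z)); split=> [z||p].
  - have cu := @unslice_continuous _ d _ rho r0 n z.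
    exact: (continuous_comp cu (cq _)).
  - have KS : [set z | q (unslice z) != 0] `<=` (@unslice R d r rho n) @^-1` K.
      move=> z /= /eqP qz; apply: qK => //; exact: slice_label.
    have cl : closed ((@unslice R d r rho n) @^-1` K).
      apply: closed_comp; first by move=> z _; exact: unslice_continuous.
      by apply: compact_closed => //; exact: pat_pair_hausdorff.
    apply: (@subclosed_compact _ _ ((fun p => pi p) @` K)).
    + exact: closed_closure.
    + apply: continuous_compact => //; apply: continuous_subspaceT.
      exact: pi_continuous.
    + move=> z /(closure_subset KS); rewrite -(closure_id _).1// => Kz.
      by exists (unslice z) => //; exact: pi_unslice.
  - by rewrite unslice_pi /slice iq.
have iq : invariant_kernel q by move=> x p; rewrite !qf pi_translate.
split=> [p||].
- rewrite (_ : q = f \o (fun p => pi p)); last by apply/funext => p'; exact: qf.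
  apply: (@continuous_comp _ _ _ (fun p => pi p) f); last exact: cf.
  exact: pi_continuous.
- exact: iq.
- exists ((@unslice R d r rho n) @` closure [set z | f z != 0]).
    apply: continuous_compact => //; apply: continuous_subspaceT.
    exact: unslice_continuous.
  move=> p p0 qp; exists (pi p); last by rewrite unslice_pi slice_id.
  by apply: subset_closure => /=; rewrite -qf; apply/eqP.
Qed.

Lemma pat_pair_cvgl n (p : pat_pair n) : pat_cvg (nbhs p) (@ppl R d r rho n) (ppl p).
Proof.
by have [/(_ (fun _ => id)) [] ] := @pat_pair_cvgP _ _ _ rho r0 _ (nbhs p) n id p _.
Qed.

Lemma pat_pair_cvgr n (p : pat_pair n) : pat_cvg (nbhs p) (@ppr R d r rho n) (ppr p).
Proof.
by have [/(_ (fun _ => id)) [] ] := @pat_pair_cvgP _ _ _ rho r0 _ (nbhs p) n id p _.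
Qed.

Lemma label_bound n (K : set (pat_pair n)) : compact K ->
  exists M : R, forall p, K p -> forall i,
    enorm (lab (ppl p) i) <= M /\ enorm (lab (ppr p) i) <= M.
Proof.
move=> cK.
have clab (g : pat_pair n -> pat n) i : (forall p, pat_cvg (nbhs p) g (g p)) ->
    continuous (fun p => enorm (lab (g p) i)).
  move=> cg p; apply/(@cvgrPdist_lt _ _ _ (nbhs p)) => e e0.
  have [h _] := cg p; apply: filterS (h i e e0) => p'; apply: le_lt_trans.
  have := enorm_triangle (lab (g p) i) (lab (g p') i).
  have := enorm_triangle (lab (g p') i) (lab (g p) i).
  rewrite (enormBC (lab (g p) i)) => h1 h2.
  by rewrite ler_norml; apply/andP; split; lra.
have [Ml MlP] := choice (fun i => compact_upper_bound cK (clab _ i (@pat_pair_cvgl n))).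
have [Mr MrP] := choice (fun i => compact_upper_bound cK (clab _ i (@pat_pair_cvgr n))).
exists (\big[Num.max/0]_i Num.max (Ml i) (Mr i)) => p Kp i.
split; apply: (@le_trans _ _ (Num.max (Ml i) (Mr i))); rewrite ?le_max ?MlP ?MrP ?orbT//;
  exact: le_bigmax.
Qed.

Lemma compact_kernel_range n (q : pat_pair n.+1 -> R[i]) : compact_kernel q ->
  exists M : R, forall p, q p <> 0 -> forall i,
    enorm (lab (ppl p) i - lab (ppr p) ord0) <= M /\
    enorm (lab (ppr p) i - lab (ppr p) ord0) <= M.
Proof.
move=> [_ iq [K cK qK]]; have [M MP] := label_bound cK.
exists M => p qp i; apply: (MP (slice p)); apply: qK; first exact: slice_label.
by rewrite iq.
Qed.

Lemma compact_kernel_local n (q : pat_pair n.+1 -> R[i]) :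
  compact_kernel q -> local_kernel q.
Proof.
move=> cq; have [M MP] := compact_kernel_range cq; have [cont inv _] := cq.
split=> //; exists (2 * M) => p /MP h; split=> i; exists ord0.
  have [h1 _] := h i; apply: (le_trans h1).
  by have := enorm_ge0 (lab (ppl p) i - lab (ppr p) ord0); lra.
have [_ h2] := h i; have [h1 _] := h ord0.
apply: (le_trans (enormB_le _ (lab (ppr p) ord0) _)).
by rewrite (enormBC _ (lab (ppr p) i)); lra.
Qed.

(** Uniform discreteness keeps the limits distinct and inside the limiting
    lattice. *)
Lemma limit_pattern (T : Type) (Fl : set_system T) n m (f : T -> pat n)
    (g : T -> pat m) (zeta : pat m) (l : 'I_n -> E) : ProperFilter Fl ->
  (\forall t \near Fl, lat (f t) = lat (g t)) -> pat_cvg Fl g zeta ->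
  (forall i (e : R), 0 < e -> \forall t \near Fl, enorm (lab (f t) i - l i) < e) ->
  exists xi : pat n, [/\ lat xi = lat zeta, lab xi = l & pat_cvg Fl f xi].
Proof.
move=> FF fg [_ gL] fl.
have l_lat i : lat zeta (l i).
  apply: (delone_closed r0 (lat_delone zeta)) => e e0.
  have e2 : 0 < e / 2 by rewrite divr_gt0.
  have [t [[/= h1 h2] [_ h3]]] := filter_ex (filterI (filterI fg (fl i _ e2))
    (gL (enorm (l i) + e / 2) _ e2)).
  have [||y Ly xy] := h3 (lab (f t) i).
  - by rewrite -h1; exact: lab_lat.
  - by have := enorm_triangle (lab (f t) i) (l i); lra.
  - exists y => //; apply: (le_lt_trans (enormB_le _ (lab (f t) i) _)).
    by rewrite (enormBC y); lra.
have l_inj : injective l.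
  move=> i j lij; have [t [/= h1 h2]] := filter_ex (filterI (fl i r r0) (fl j r r0)).
  apply: (@lab_inj _ _ _ _ _ (f t)).
  apply: (delone_sep (lat_delone (f t))); [exact: lab_lat|exact: lab_lat|].
  apply: (le_trans (enormB_le _ (l i) _)); move: h2; rewrite -lij.
  by rewrite (enormBC (l i)); lra.
exists (Pattern (lat_delone zeta) l_inj l_lat); split=> //; split=> // M e e0.
by apply: filterS (filterI fg (gL M e e0)) => t [-> []].
Qed.

(** Compactness of a set of pairs concerns their lattices only, up to bounded
    displacements: along an ultrafilter bounded labels converge, and so do the
    lattices as translates of those of K. *)
Lemma transfer_compact n (K : set (pat_pair n)) (M : R) : compact K ->
  compact [set p' : pat_pair n | exists p x,
    [/\ K p, enorm x <= M, lat (ppl p') = lat (translate x (ppl p)) &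
        forall i, enorm (lab (ppl p') i) <= M /\ enorm (lab (ppr p') i) <= M]].
Proof.
move=> cK; rewrite compact_ultra => Fl UF; set A := (X in Fl X) => FA.
have FF : ProperFilter Fl by exact: ultra_proper.
(* g chooses the witnesses p and x for each element of the set *)
pose Q (p' : pat_pair n) (z : pat_pair n * E) :=
  [/\ K z.1, enorm z.2 <= M, lat (ppl p') = lat (translate z.2 (ppl z.1)) &
      forall i, enorm (lab (ppl p') i) <= M /\ enorm (lab (ppr p') i) <= M].
have [p0' [[k0 [x0' _]] _]] := filter_ex (filterI FA FA).
have [g gP] : {g : pat_pair n -> pat_pair n * E & forall p', A p' -> Q p' (g p')}.
  apply: (@choice _ _ (fun p' z => A p' -> Q p' z)) => p'.
  have [[p [x h]]|nA] := pselect (A p'); first by exists (p, x).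
  by exists (k0, 0) => /nA.
have FK : Fl [set t | K (g t).1] by apply: filterS FA => t /gP[].
have FM : Fl [set t | enorm (g t).2 <= M] by apply: filterS FA => t /gP[].
have [p0 Kp0 gp0] := compact_ultra_cvg cK UF FK.
have [x0 gx0] := ultra_enorm UF FM.
have x0M := lim_enorm_le FF gx0 FM.
have lim1 i : exists l : E, forall e : R, 0 < e ->
    \forall t \near Fl, enorm (lab (ppl t) i - l) < e.
  by apply: (ultra_enorm (M := M) UF); apply: filterS FA => t /gP[_ _ _ /(_ i) []].
have lim2 i : exists l : E, forall e : R, 0 < e ->
    \forall t \near Fl, enorm (lab (ppr t) i - l) < e.
  by apply: (ultra_enorm (M := M) UF); apply: filterS FA => t /gP[_ _ _ /(_ i) []].
have [l1 l1P] := choice lim1; have [l2 l2P] := choice lim2.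
have gcvg := ptranslate_cvg r0 FF gp0 gx0.
have [gcl _] := (@pat_pair_cvgP _ _ _ _ r0 _ Fl _ _ _ FF).1 gcvg.
have lat1 : \forall t \near Fl, lat (ppl t) = lat (ppl (ptranslate (g t).2 (g t).1)).
  by apply: filterS FA => t /gP[_ _ -> _].
have lat2 : \forall t \near Fl, lat (ppr t) = lat (ppl (ptranslate (g t).2 (g t).1)).
  by apply: filterS lat1 => t <-; rewrite pp_lat.
have [xi [xil xiE cxi]] := limit_pattern FF lat1 gcl l1P.
have [zeta [zetal zetaE czeta]] := limit_pattern FF lat2 gcl l2P.
have e : lat xi = lat zeta by rewrite xil zetal.
exists (mkp e); split; last first.
  by have := (@pat_pair_cvgP _ _ _ _ r0 _ Fl _ id (mkp e) FF).2; apply; split.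
exists p0, x0; split=> // i.
split.
  apply: (lim_enorm_le FF (f := fun t => lab (ppl t) i)).
    by rewrite [ppl _]/= xiE; exact: l1P.
  by apply: filterS FA => t /gP[_ _ _ /(_ i) []].
apply: (lim_enorm_le FF (f := fun t => lab (ppr t) i)).
  by rewrite [ppr _]/= zetaE; exact: l2P.
by apply: filterS FA => t /gP[_ _ _ /(_ i) []].
Qed.

Lemma finite_patterns_in n (L S : set E) : finite_set S ->
  finite_set [set xi : pat n | lat xi = L /\ forall i, S (lab xi i)].
Proof.
move=> finS; have [s sP] := (finite_seqP _).1 finS.
set A := [set xi : pat n | _].
have [[xi0 _]|A0] := pselect (A !=set0); last first.
  by apply: (@sub_finite_set _ _ set0) => // xi Axi; apply: A0; exists xi.
pose P (f : {ffun 'I_n -> seq_sub s}) (xi : pat n) :=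
  lat xi = L /\ forall i, lab xi i = val (f i).
have [g gP] : {g : {ffun 'I_n -> seq_sub s} -> pat n &
    forall f, (exists xi, P f xi) -> P f (g f)}.
  apply: (@choice _ _ (fun f xi => (exists xi', P f xi') -> P f xi)) => f.
  have [[xi Pxi]|h] := pselect (exists xi, P f xi); first by exists xi.
  by exists xi0.
apply: (@sub_finite_set _ _ (g @` setT)); last first.
  exact/finite_image/finite_finset.
move=> xi [xiL xiS].
have xis i : lab xi i \in s by have := xiS i; rewrite sP.
exists [ffun i => SeqSub (xis i)] => //.
have [|gl ge] := gP [ffun i => SeqSub (xis i)].
  by exists xi; split=> // i; rewrite ffunE.
by apply: pattern_eq => [|i]; [rewrite gl|rewrite ge ffunE].
Qed.

Lemma finite_patterns n (L : set E) (M : R) : delone r rho L ->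
  finite_set [set xi : pat n | lat xi = L /\ forall i, enorm (lab xi i) <= M].
Proof.
move=> dL; apply: sub_finite_set (finite_patterns_in n L (delone_finite M r0 dL)).
by move=> xi [xiL xiM]; split=> // i; split=> //; rewrite -xiL; exact: lab_lat.
Qed.

Lemma finite_pairs_in n (L S : set E) : finite_set S ->
  finite_set [set p : pat_pair n | lat (ppl p) = L /\
    forall i, S (lab (ppl p) i) /\ S (lab (ppr p) i)].
Proof.
move=> finS; set A := [set xi : pat n | lat xi = L /\ forall i, S (lab xi i)].
have finA : finite_set A by exact: finite_patterns_in.
pose h (z : pat n * pat n) : pat_pair n :=
  if pselect (lat z.1 = lat z.2) is left e then mkp e else mkp (erefl (lat z.1)).
apply: (@sub_finite_set _ _ (h @` (A `*` A))); last first.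
  exact/finite_image/finite_setX.
move=> p [pL pS]; exists (ppl p, ppr p).
  split=> /=; first by split=> // i; have [] := pS i.
  by split=> [|i]; [rewrite -pp_lat|have [] := pS i].
rewrite /h /=; case: pselect => [e|ne]; last by case: ne; exact: pp_lat.
exact: pat_pair_eq.
Qed.

(** The value 0 off the common lattices makes this a total function of two
    patterns, so that sums over patterns carry no proofs of equality of
    lattices. *)
Definition mat n (q : pat_pair n -> R[i]) (xi zeta : pat n) : R[i] :=
  if pselect (lat xi = lat zeta) is left e then q (mkp e) else 0.

Lemma mat_mkp n (q : pat_pair n -> R[i]) xi zeta (e : lat xi = lat zeta) :
  mat q xi zeta = q (mkp e).
Proof.
by rewrite /mat; case: pselect => // e'; congr q; apply: pat_pair_eq.
Qed.

Lemma matE n (q : pat_pair n -> R[i]) p : mat q (ppl p) (ppr p) = q p.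
Proof. by rewrite (mat_mkp q (pp_lat p)); congr q; apply: pat_pair_eq. Qed.

Lemma mat_neq0 n (q : pat_pair n -> R[i]) xi zeta : mat q xi zeta <> 0 ->
  exists2 p, q p <> 0 & xi = ppl p /\ zeta = ppr p.
Proof.
rewrite /mat; case: pselect => // e qe.
by exists (mkp e).
Qed.

Lemma mat_translate n (q : pat_pair n -> R[i]) x xi zeta : invariant_kernel q ->
  mat q (translate x xi) (translate x zeta) = mat q xi zeta.
Proof.
move=> iq; rewrite {2}/mat; case: pselect => e.
  have e' : lat (translate x xi) = lat (translate x zeta) by rewrite /= e.
  by rewrite (mat_mkp q e') -(iq x (mkp e)); congr q; exact: pat_pair_eq.
rewrite /mat; case: pselect => // e'; exfalso; apply: e.
apply/seteqP; split=> y; have /= h := congr1 (fun L : set E => L (y - x)) e'.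
  by move: h; rewrite subrK => ->.
by move: h; rewrite subrK => ->.
Qed.

Lemma mat_cvg (T : Type) (Fl : set_system T) n (q : pat_pair n -> R[i])
    (f g : T -> pat n) xi zeta : Filter Fl -> continuous_kernel q ->
  pat_cvg Fl f xi -> pat_cvg Fl g zeta -> lat xi = lat zeta ->
  (\forall t \near Fl, lat (f t) = lat (g t)) ->
  (fun t => mat q (f t) (g t) : (R[i])^o) @ Fl --> (mat q xi zeta : (R[i])^o).
Proof.
move=> FF cq fxi gzeta e fg; rewrite (mat_mkp q e).
pose P t : pat_pair n :=
  if pselect (lat (f t) = lat (g t)) is left e' then mkp e' else mkp e.
have PP : \forall t \near Fl, mat q (f t) (g t) = q (P t) /\
    ppl (P t) = f t /\ ppr (P t) = g t.
  apply: filterS fg => t ft; rewrite (mat_mkp q ft) /P.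
  by case: pselect => // e'; split=> //; congr q; exact: pat_pair_eq.
have Pcvg : P @ Fl --> mkp e.
  apply/(pat_pair_cvgP r0); split.
    case: fxi => h1 h2; split=> [i e1 e10|M e1 e10].
      by apply: filterS (filterI PP (h1 i _ e10)) => t [[_ [-> _]]].
    by apply: filterS (filterI PP (h2 M _ e10)) => t [[_ [-> _]]].
  case: gzeta => h1 h2; split=> [i e1 e10|M e1 e10].
    by apply: filterS (filterI PP (h1 i _ e10)) => t [[_ [_ ->]]].
  by apply: filterS (filterI PP (h2 M _ e10)) => t [[_ [_ ->]]].
have qP : (fun t => q (P t) : (R[i])^o) @ Fl --> (q (mkp e) : (R[i])^o).
  exact: (cvg_comp _ _ Pcvg (cq (mkp e))).
apply: (cvg_trans _ qP); apply: near_eq_cvg.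
by apply: filterS PP => t [].
Qed.

End Coefficients.

(** * Products of kernels *)

Section KernelProduct.
Context (R : realType) (d : nat) (r rho : R).
Hypothesis r0 : 0 < r.
Local Notation E := 'rV[R]_d.
Local Notation pat n := (pattern d r rho n).
Local Notation pat_pair n := (@pat_pair R d r rho n).

Lemma fsbig_neq0 (V : nmodType) (I : choiceType) (D : set I) (f : I -> V) :
  \sum_(i \in D) f i <> 0 -> exists2 i, D i & f i <> 0.
Proof.
move=> h; apply: contrapT => nex; apply: h; apply: fsbig1 => i Di.
by apply: contrapT => fi; apply: nex; exists i.
Qed.

(** The product of matrices, which is the kernel of a composition of
    operators. *)
Definition kprod n (b1 b2 : pat_pair n -> R[i]) (p : pat_pair n) : R[i] :=
  \sum_(zeta \in [set zeta | lat zeta = lat (ppl p)])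
    mat b1 (ppl p) zeta * mat b2 zeta (ppr p).

Lemma translateNK n x : cancel (@translate R d r rho n x) (translate (- x)).
Proof. by move=> xi; rewrite translateD addNr translate0. Qed.

Lemma translateKN n x : cancel (@translate R d r rho n (- x)) (translate x).
Proof. by move=> xi; rewrite translateD subrr translate0. Qed.

Lemma kprod_invariant n (b1 b2 : pat_pair n -> R[i]) :
  invariant_kernel b1 -> invariant_kernel b2 -> invariant_kernel (kprod b1 b2).
Proof.
move=> i1 i2 x p; rewrite /kprod.
rewrite (reindex_fsbig (translate x) [set zeta | lat zeta = lat (ppl p)]).
  by apply: eq_fsbigr => zeta _; rewrite !mat_translate.
split.
- by move=> zeta /= ->.
- by move=> z1 z2 _ _; apply: can_inj; exact: translateNK.
- move=> zeta /= zl; exists (translate (- x) zeta); last exact: translateKN.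
  rewrite /= zl; apply/seteqP; split=> y /=; by rewrite subrK.
Qed.

Lemma cvg_sum_seq (T : Type) (Fl : set_system T) (I : eqType) (s : seq I)
    (f : I -> T -> (R[i])^o) (l : I -> (R[i])^o) : Filter Fl ->
  (forall i, i \in s -> f i @ Fl --> l i) ->
  (fun t => \sum_(i <- s) f i t) @ Fl --> \sum_(i <- s) l i.
Proof.
move=> FF; elim: s => [|j s IH] h.
  rewrite big_nil (_ : (fun t => _) = (fun=> 0)); first exact: cvg_cst.
  by apply/funext => t; rewrite big_nil.
rewrite big_cons (_ : (fun t => _) = (fun t => f j t + \sum_(i <- s) f i t)).
  apply: cvgD; first by apply: h; rewrite mem_head.
  by apply: IH => i si; apply: h; rewrite inE si orbT.
by apply/funext => t; rewrite big_cons.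
Qed.

(** Two labels near the same point of space are less than 2 r apart. *)
Lemma near_unique n (z z' zeta : pat n) : lat z = lat z' ->
  (forall i, enorm (lab z i - lab zeta i) < r) ->
  (forall i, enorm (lab z' i - lab zeta i) < r) -> z = z'.
Proof.
move=> e h h'; apply: pattern_eq => // i.
apply: (delone_sep (lat_delone z)); first exact: lab_lat.
  by rewrite e; exact: lab_lat.
apply: (le_trans (enormB_le _ (lab zeta i) _)); rewrite (enormBC _ (lab z' i)).
by have := h i; have := h' i; lra.
Qed.

(** A pattern is transported to nearby lattices by moving each of its points
    to the closest lattice point. *)
Lemma near_lift n m (T : Type) (Fl : set_system T) (g : T -> pat m) (xi : pat m)
    (zeta : pat n) (e : R) : Filter Fl -> pat_cvg Fl g xi -> lat zeta = lat xi ->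
  0 < e -> \forall t \near Fl, exists z : pat n,
    lat z = lat (g t) /\ forall i, enorm (lab z i - lab zeta i) < e.
Proof.
move=> FF [_ gL] zl e0; pose e' := Num.min e (r / 2).
have e'0 : 0 < e' by rewrite lt_min e0 divr_gt0.
have e'r : e' <= r / 2 by rewrite ge_min lexx orbT.
have e'e : e' <= e by rewrite ge_min lexx.
pose M := \big[Num.max/0]_i enorm (lab zeta i).
apply: filterS (gL M e' e'0) => t [h _].
have ex i : exists y, lat (g t) y /\ enorm (y - lab zeta i) < e'.
  have [||y Ly xy] := h (lab zeta i).
  - by rewrite -zl; exact: lab_lat.
  - exact: le_bigmax.
  - by exists y; rewrite enormBC.
have [y yP] := choice ex.
have y_inj : injective y.
  move=> i j yij; apply: (@lab_inj _ _ _ _ _ zeta).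
  apply: (delone_sep (lat_delone zeta)); [exact: lab_lat|exact: lab_lat|].
  apply: (le_trans (enormB_le _ (y i) _)).
  have [_ h1] := yP i; have [_] := yP j; rewrite -yij (enormBC (lab zeta i)).
  by move: r0; lra.
exists (Pattern (lat_delone (g t)) y_inj (fun i => (yP i).1)); split=> // i.
by apply: lt_le_trans e'e; exact: (yP i).2.
Qed.

(** Near a pair p0 the intermediate patterns are exactly the transports of the
    finitely many ones that occur at p0 within a fixed ball: finite range
    excludes those outside of it. Along each transport both factors are
    continuous. *)
Lemma kprod_continuous n (b1 b2 : pat_pair n -> R[i]) :
  local_kernel b1 -> local_kernel b2 -> continuous_kernel (kprod b1 b2).
Proof.
move=> [c1 _ _] [c2 _ [M MP]] p0.
have FF : Filter (nbhs p0) := nbhs_filter p0.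
have cl := pat_pair_cvgl r0 p0; have cr := pat_pair_cvgr r0 p0.
(* the range of b2 bounds the labels of the intermediate patterns by B *)
pose B := \big[Num.max/0]_i enorm (lab (ppr p0) i) + 1 + M.
pose A0 := [set zeta : pat n | lat zeta = lat (ppl p0) /\
  forall i, enorm (lab zeta i) <= B + r].
have finA : finite_set A0 by exact: finite_patterns (lat_delone _).
(* lift zeta p is the transport of zeta to the lattice of p, near p0 *)
pose lifts (zeta : pat n) (p : pat_pair n) (z : pat n) :=
  lat z = lat (ppl p) /\ forall i, enorm (lab z i - lab zeta i) < r / 2.
have [lift liftP] : {lift : pat n -> pat_pair n -> pat n &
    forall zeta p, (exists z, lifts zeta p z) -> lifts zeta p (lift zeta p)}.
  have [g gP] : {g : pat n * pat_pair n -> pat n & forall zp,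
      (exists z, lifts zp.1 zp.2 z) -> lifts zp.1 zp.2 (g zp)}.
    apply: (@choice _ _ (fun zp z => (exists z', lifts zp.1 zp.2 z') ->
      lifts zp.1 zp.2 z)) => -[zeta p].
    have [[z Pz]|h] := pselect (exists z, lifts zeta p z); first by exists z.
    by exists zeta.
  by exists (fun zeta p => g (zeta, p)) => zeta p; exact: (gP (zeta, p)).
have lift_eq zeta p z : lat z = lat (ppl p) ->
    (forall i, enorm (lab z i - lab zeta i) < r / 2) -> lift zeta p = z.
  move=> zl zz; have [|l1 l2] := liftP zeta p; first by exists z.
  apply: (@near_unique _ _ _ zeta); first by rewrite l1 zl.
    by move=> i; apply: (lt_trans (l2 i)); move: r0; lra.
  by move=> i; apply: (lt_trans (zz i)); move: r0; lra.
have r2 : 0 < r / 2 by rewrite divr_gt0.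
have lift_cvg zeta : lat zeta = lat (ppl p0) ->
    pat_cvg (nbhs p0) (lift zeta) zeta /\
    \forall p \near p0, lifts zeta p (lift zeta p).
  move=> zl; have near_l : \forall p \near p0, lifts zeta p (lift zeta p).
    by apply: filterS (near_lift FF cl zl r2) => p; exact: liftP.
  split=> //; split=> [i e e0|K e e0].
    have e'0 : 0 < Num.min e (r / 2) by rewrite lt_min e0.
    apply: filterS (near_lift FF cl zl e'0) => p [z [z1 z2]].
    have -> : lift zeta p = z.
      apply: lift_eq => // j; apply: (lt_le_trans (z2 j)).
      by rewrite ge_min lexx orbT.
    by apply: (lt_le_trans (z2 i)); rewrite ge_min lexx.
  rewrite zl; apply: filterS (filterI near_l (cl.2 K e e0)) => p [[l1 _]].
  by rewrite l1.
pose G p : (R[i])^o := \sum_(zeta \in A0)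
  mat b1 (ppl p) (lift zeta p) * mat b2 (lift zeta p) (ppr p).
have nearG : \forall p \near p0, G p = kprod b1 b2 p.
  have lA : \forall p \near p0, forall zeta, zeta \in fset_set A0 ->
      lifts zeta p (lift zeta p).
    apply: (@filter_all _ (nbhs p0) _ _ (fun zeta p => lifts zeta p (lift zeta p))) => zeta.
    rewrite in_fset_set// => /set_mem[zl _]; exact: (lift_cvg zeta zl).2.
  have labs : \forall p \near p0, forall i, i \in enum 'I_n ->
      enorm (lab (ppr p) i - lab (ppr p0) i) < 1.
    by apply: (@filter_all _ (nbhs p0) _ _ (fun i p =>
      enorm (lab (ppr p) i - lab (ppr p0) i) < 1)) => i _; exact: (cr.1 i 1 ltr01).
  apply: filterS (filterI (filterI lA labs) (cl.2 B (r / 2) r2)) => p [[pA pl] [_ pL]].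
  have pA' zeta : A0 zeta -> lifts zeta p (lift zeta p).
    by move=> h; apply: pA; rewrite in_fset_set// inE.
  have inj : set_inj A0 (fun zeta => lift zeta p).
    move=> z1 z2 /set_mem h1 /set_mem h2 e12.
    have [_ g1] := pA' _ h1; have [_ g2] := pA' _ h2.
    apply: (@near_unique _ _ _ (lift z1 p)); first by rewrite h1.1 h2.1.
      by move=> i; rewrite enormBC; apply: (lt_trans (g1 i)); move: r0; lra.
    by move=> i; rewrite e12 enormBC; apply: (lt_trans (g2 i)); move: r0; lra.
  rewrite /G -(@fsbig_image _ _ _ _ _ A0 (lift^~ p)
    (fun z => mat b1 (ppl p) z * mat b2 z (ppr p)) inj).
  apply: fsbig_widen => [_ [zeta Az <-]|z [zl nz]].
    by have [] := pA' _ Az.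
  apply: contrapT => /eqP; rewrite mulf_eq0 negb_or => /andP[_ /eqP] /mat_neq0.
  move=> [p' /MP[hM _] [zE prE]]; apply: nz.
  have zB i : enorm (lab z i) <= B.
    have [j] := hM i; rewrite -zE -prE => ij.
    have h1 := pl j (mem_enum _ j).
    have h2 : enorm (lab (ppr p0) j) <= \big[Num.max/0]_i enorm (lab (ppr p0) i).
      exact: le_bigmax.
    have h3 := enorm_triangle (lab z i) (lab (ppr p) j).
    have h4 := enorm_triangle (lab (ppr p) j) (lab (ppr p0) j).
    by rewrite /B; lra.
  have ex i : exists x, lat (ppl p0) x /\ enorm (lab z i - x) < r / 2.
    have [||x Lx zx] := pL (lab z i) => //; first by rewrite -zl; exact: lab_lat.
    by exists x.
  have [x xP] := choice ex.
  have x_inj : injective x.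
    move=> i j xij; apply: (@lab_inj _ _ _ _ _ z).
    apply: (delone_sep (lat_delone z)); [exact: lab_lat|exact: lab_lat|].
    apply: (le_trans (enormB_le _ (x i) _)).
    have [_ h1] := xP i; have [_] := xP j; rewrite -xij (enormBC (lab z j)).
    by move: r0; lra.
  exists (Pattern (lat_delone (ppl p0)) x_inj (fun i => (xP i).1)).
    split=> // i /=; have := enorm_triangle (x i) (lab z i).
    by rewrite enormBC; have [_] := xP i; have := zB i; move: r0; lra.
  by apply: lift_eq => // i; exact: (xP i).2.
have G0 : kprod b1 b2 p0 = G p0 by rewrite (nbhs_singleton nearG).
rewrite /continuous_at [X in _ --> X]G0.
apply: (@cvg_trans _ (G @ nbhs p0)).
  by apply: near_eq_cvg; apply: filterS nearG => p ->.
have lift0 zeta : A0 zeta -> lift zeta p0 = zeta.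
  by move=> [zl _]; apply: lift_eq => // i; rewrite subrr enorm0.
rewrite {2}/G fsbig_finite// (_ : G = fun p => \sum_(zeta <- fset_set A0)
    mat b1 (ppl p) (lift zeta p) * mat b2 (lift zeta p) (ppr p)); last first.
  by apply/funext => p; rewrite /G fsbig_finite.
apply: cvg_sum_seq => zeta; rewrite in_fset_set// => /set_mem Az.
have [lc ln] := lift_cvg zeta Az.1.
have l0 := lift0 _ Az; apply: cvgM.
  apply: (mat_cvg r0 FF c1 cl); first by rewrite l0.
    by rewrite l0 Az.1.
  by apply: filterS ln => p [].
apply: (mat_cvg r0 FF c2) => //; first by rewrite l0.
  by rewrite l0 Az.1 pp_lat.
by apply: filterS ln => p [-> _]; rewrite pp_lat.
Qed.

Lemma kprod_neq0 n (b1 b2 : pat_pair n -> R[i]) p : kprod b1 b2 p <> 0 ->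
  exists p1 p2, [/\ b1 p1 <> 0, b2 p2 <> 0, ppl p1 = ppl p,
    ppr p1 = ppl p2 & ppr p2 = ppr p].
Proof.
move/fsbig_neq0 => [zeta _ /eqP]; rewrite mulf_eq0 negb_or => /andP[/eqP h1 /eqP h2].
have [p1 p1n [-> e1]] := mat_neq0 h1; have [p2 p2n [e2 ->]] := mat_neq0 h2.
by exists p1, p2; split=> //; rewrite -e1 e2.
Qed.

(** The factor b of finite range moves patterns over their own lattice by a
    bounded distance, while the lattice is controlled by the compact support
    of q. *)
Lemma kprod_compact_r n (b q : pat_pair n.+1 -> R[i]) :
  local_kernel b -> compact_kernel q -> compact_kernel (kprod b q).
Proof.
move=> lb cq; have lq := compact_kernel_local r0 cq.
have [_ ib [Mb MbP]] := lb; have [_ iq [K cK KP]] := cq.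
split; [exact: kprod_continuous|exact: kprod_invariant|].
have [M MP] := compact_kernel_range r0 cq.
pose M' := Num.max 0 M + Num.max 0 Mb.
have M'M : M <= M' /\ Mb + M <= M'.
  rewrite /M'; have : M <= Num.max 0 M by rewrite le_max lexx orbT.
  have : Mb <= Num.max 0 Mb by rewrite le_max lexx orbT.
  have : 0 <= Num.max 0 Mb by rewrite le_max lexx.
  by split; lra.
apply: (ex_intro2 _ _ _ (@transfer_compact _ _ _ _ r0 _ K M' cK)).
move=> p p0 /kprod_neq0[p1 [p2 [h1 h2 e1 e2 e3]]].
exists p2, 0; split.
- by apply: KP => //; rewrite e3.
- rewrite enorm0; have : 0 <= Num.max 0 M by rewrite le_max lexx.
  have : 0 <= Num.max 0 Mb by rewrite le_max lexx.
  by rewrite /M'; lra.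
- by rewrite translate0 pp_lat -e3 -pp_lat.
- move=> i; have [M1 M2] := MP p2 h2 i; move: M1 M2; rewrite e3 p0 !subr0 => M1 M2.
  split; last by lra.
  have [j] := (MbP p1 h1).1 i; rewrite e1 e2 => hj.
  have [+ _] := MP p2 h2 j; rewrite e3 p0 subr0 => M3.
  by have := enorm_triangle (lab (ppl p) i) (lab (ppl p2) j); lra.
Qed.

(** As for the product in the other order, except that the reference label of
    the slice is moved by b: the lattice is controlled only up to a bounded
    translation. *)
Lemma kprod_compact_l n (q b : pat_pair n.+1 -> R[i]) :
  compact_kernel q -> local_kernel b -> compact_kernel (kprod q b).
Proof.
move=> cq lb; have lq := compact_kernel_local r0 cq.
have [_ ib [Mb MbP]] := lb; have [_ iq [K cK KP]] := cq.
split; [exact: kprod_continuous|exact: kprod_invariant|].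
have [M MP] := compact_kernel_range r0 cq.
pose a := Num.max 0 M; pose c := Num.max 0 Mb.
have a0 : 0 <= a by rewrite le_max lexx.
have c0 : 0 <= c by rewrite le_max lexx.
have Ma : M <= a by rewrite le_max lexx orbT.
have Mc : Mb <= c by rewrite le_max lexx orbT.
(* the base label z of p1 lies within a + c of the origin, and the labels of p
   within 2 (a + c) of z *)
apply: (ex_intro2 _ _ _ (@transfer_compact _ _ _ _ r0 _ K (3 * (a + c)) cK)).
move=> p p0 /kprod_neq0[p1 [p2 [h1 h2 e1 e2 e3]]].
pose z := lab (ppr p1) ord0.
have zle : enorm z <= a + c.
  have [j] := (MbP p2 h2).2 ord0; rewrite e3 p0 subr0 -e2 => hj.
  have [_] := MP p1 h1 j; rewrite -/z => h3.
  by have := enorm_triangle z (lab (ppr p1) j); rewrite enormBC; lra.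
exists (slice p1), (- z); split.
- by apply: KP; [exact: slice_label|rewrite iq].
- by rewrite enormN; lra.
- by rewrite [translate (- z) _]translateNK e1.
- move=> i; split.
    have [h3 _] := MP p1 h1 i; move: h3; rewrite e1 -/z => h3.
    by have := enorm_triangle (lab (ppl p) i) z; lra.
  have [j] := (MbP p2 h2).2 i; rewrite e3 -e2 => hj.
  have [_ h3] := MP p1 h1 j; rewrite -/z in h3.
  have := enorm_triangle (lab (ppr p) i) (lab (ppr p1) j).
  have := enorm_triangle (lab (ppr p1) j) z.
  by rewrite (enormBC (lab (ppr p) i)); lra.
Qed.

End KernelProduct.

(** * Operators given by kernels *)

Section KernelOperators.
Context (R : realType) (d : nat) (r rho : R).
Hypothesis r0 : 0 < r.
Local Notation E := 'rV[R]_d.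
Local Notation pat n := (pattern d r rho n).
Local Notation pat_pair n := (@pat_pair R d r rho n).

Lemma fsum_finite (V : nmodType) (I : choiceType) (A D : set I) (f : I -> V) :
  finite_set A -> A `<=` D -> (forall i, D i -> f i <> 0 -> A i) ->
  \sum_(i \in D) f i = \sum_(i <- fset_set A) f i.
Proof.
move=> finA AD fA; rewrite -fsbig_finite//; apply/esym/fsbig_widen => // i [Di nAi].
by apply: contrapT => fi; apply: nAi; exact: fA.
Qed.

Lemma relabelM n (s t : 'S_n) (xi : pat n) :
  relabel s (relabel t xi) = relabel (t * s)%g xi.
Proof. by apply: pattern_eq => //= i; rewrite invMg permM. Qed.

Lemma relabel1 n (xi : pat n) : relabel 1%g xi = xi.
Proof. by apply: pattern_eq => //= i; rewrite invg1 perm1. Qed.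

Lemma relabelK n (s : 'S_n) : cancel (@relabel R d r rho n s) (relabel s^-1%g).
Proof. by move=> xi; rewrite relabelM mulgV relabel1. Qed.

Lemma relabelVK n (s : 'S_n) : cancel (@relabel R d r rho n s^-1%g) (relabel s).
Proof. by move=> xi; rewrite relabelM mulVg relabel1. Qed.

Fact prelabel_lat n (s t : 'S_n) (p : pat_pair n) :
  lat (relabel s (ppl p)) = lat (relabel t (ppr p)).
Proof. exact: pp_lat. Qed.

Definition prelabel n (s t : 'S_n) (p : pat_pair n) : pat_pair n :=
  mkp (prelabel_lat s t p).

Lemma relabel_cvg (T : Type) (Fl : set_system T) n (f : T -> pat n) xi (s : 'S_n) :
  pat_cvg Fl f xi -> pat_cvg Fl (fun t => relabel s (f t)) (relabel s xi).
Proof. by move=> [h1 h2]; split=> [i|]; [exact: h1|exact: h2]. Qed.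

Lemma prelabel_continuous n (s t : 'S_n) : continuous (@prelabel n s t).
Proof.
move=> p; apply/(@pat_pair_cvgP _ _ _ _ r0 _ (nbhs p)); split.
  exact: (relabel_cvg s (pat_pair_cvgl r0 p)).
exact: (relabel_cvg t (pat_pair_cvgr r0 p)).
Qed.

Lemma prelabel_translate n (s t : 'S_n) x (p : pat_pair n) :
  prelabel s t (ptranslate x p) = ptranslate x (prelabel s t p).
Proof. by apply: pat_pair_eq; apply: pattern_eq. Qed.

Lemma compact_kernel_relabel n (k : pat_pair n.+1 -> R[i]) (s t : 'S_n.+1) :
  compact_kernel k -> compact_kernel (fun p => k (prelabel s t p)).
Proof.
move=> ck; have [M MP] := compact_kernel_range r0 ck.
have [cont inv [K cK KP]] := ck; split.
- move=> p; have c := @prelabel_continuous _ s t p.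
  exact: (continuous_comp c (cont _)).
- by move=> x p; rewrite prelabel_translate inv.
apply: (ex_intro2 _ _ _ (@transfer_compact _ _ _ _ r0 _ K (2 * Num.max 0 M) cK)).
have M0 : 0 <= Num.max 0 M by rewrite le_max lexx.
have MM : M <= Num.max 0 M by rewrite le_max lexx orbT.
move=> p p0 kp; set p1 := prelabel s t p in kp.
pose z := lab (ppr p1) ord0.
have zM : enorm z <= M.
  have [_] := MP p1 kp (t ord0).
  by rewrite [lab (ppr p1) _]/= permK p0 sub0r enormN.
exists (slice p1), (- z); split.
- by apply: KP; [exact: slice_label|rewrite inv].
- by rewrite enormN; lra.
- by rewrite [translate (- z) _]translateNK.
- move=> i; split.
    have [h _] := MP p1 kp (s i); move: h; rewrite -/z [lab (ppl p1) _]/= permK => h.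
    by have := enorm_triangle (lab (ppl p) i) z; lra.
  have [_ h] := MP p1 kp (t i); move: h; rewrite -/z [lab (ppr p1) _]/= permK => h.
  by have := enorm_triangle (lab (ppr p) i) z; lra.
Qed.

Lemma compact_kernelZ n (c : R[i]) (k : pat_pair n.+1 -> R[i]) :
  compact_kernel k -> compact_kernel (fun p => c * k p).
Proof.
move=> [cont inv [K cK KP]]; split.
- move=> p; have := @cvgM R[i] _ (nbhs p) _ (fun=> c) k c (k p).
  by apply; [exact: cvg_cst|exact: cont].
- by move=> x p; rewrite inv.
- exists K => // p p0 h; apply: KP => // kp; apply: h; by rewrite kp mulr0.
Qed.

Lemma compact_kernel_sum n (I : Type) (s : seq I) (k : I -> pat_pair n.+1 -> R[i]) :
  (forall i, compact_kernel (k i)) -> compact_kernel (fun p => \sum_(i <- s) k i p).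
Proof.
move=> h; elim: s => [|i s [cont inv [K cK KP]]].
  split=> [p|x p|]; last by exists set0; [exact: compact0|move=> p; rewrite big_nil].
    have -> : (fun p => \sum_(i <- [::]) k i p) = (fun=> 0 : (R[i])^o).
      by apply/funext => p'; rewrite big_nil.
    exact: (@cvg_cst (R[i])^o 0 _ (nbhs p)).
  by rewrite !big_nil.
have [ci ii [Ki cKi KPi]] := h i; split.
- move=> p; rewrite (_ : (fun _ => _) = (fun p => k i p + \sum_(j <- s) k j p)).
    exact: (@cvgD R[i] (R[i])^o _ (nbhs p) _ (k i)
      (fun p => \sum_(j <- s) k j p) _ _ (ci p) (cont p)).
  by apply/funext => p'; rewrite big_cons.
- by move=> x p; rewrite !big_cons inv ii.
- exists (Ki `|` K); first exact: compactU.
  move=> p p0; rewrite big_cons => hp.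
  have [k0|k0] := eqVneq (k i p) 0; last by left; apply: KPi => //; exact/eqP.
  by right; apply: KP => //; move: hp; rewrite k0 add0r.
Qed.

(** Averaging a kernel over relabellings yields the required symmetry. *)
Definition antisym n (k : pat_pair n -> R[i]) (p : pat_pair n) : R[i] :=
  (n`!%:R^-1 * n`!%:R^-1) *
    \sum_(st : 'S_n * 'S_n) (-1) ^+ st.1 * (-1) ^+ st.2 * k (prelabel st.1 st.2 p).

Lemma antisym_compact n (k : pat_pair n.+1 -> R[i]) :
  compact_kernel k -> compact_kernel (antisym k).
Proof.
move=> ck; apply: compact_kernelZ; apply: compact_kernel_sum => st.
by apply: compact_kernelZ; exact: compact_kernel_relabel.
Qed.

Lemma antisym_relabel n (k : pat_pair n -> R[i]) (s t : 'S_n) p :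
  antisym k (prelabel s t p) = (-1) ^+ s * (-1) ^+ t * antisym k p.
Proof.
rewrite /antisym mulrCA; congr (_ * _).
rewrite (reindex_inj (h := fun st => ((s^-1 * st.1)%g, (t^-1 * st.2)%g))) /=; last first.
  by move=> [a b] [a' b'] [/mulgI-> /mulgI->].
rewrite big_distrr /=; apply: eq_bigr => -[a b] _ /=.
rewrite !odd_permM !odd_permV !signr_addb.
have -> : prelabel (s^-1 * a)%g (t^-1 * b)%g (prelabel s t p) = prelabel a b p.
  by apply: pat_pair_eq; rewrite [LHS]relabelM mulKVg.
by rewrite mulrACA !mulrA.
Qed.

(** Every kernel with compact support thus has a coefficient that defines the
    same operator. *)
Lemma antisym_coefficient n (k : pat_pair n.+1 -> R[i]) :
  compact_kernel k -> is_coefficient (antisym k).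
Proof.
move=> ck; split; first by apply/(compact_kernelP r0); exact: antisym_compact.
move=> s1 s2 p p' e1 e2.
have -> : p' = prelabel s1 (s2^-1)%g p by apply: pat_pair_eq.
by rewrite antisym_relabel odd_permV mulrAC.
Qed.

Lemma coefficient_compact n (q : pat_pair n.+1 -> R[i]) :
  is_coefficient q -> compact_kernel q.
Proof. by move=> [h _]; apply/(compact_kernelP r0). Qed.

Context (L : set E) (L_delone : delone r rho L).
Local Notation patL n := [set xi : pat n | lat xi = L].

(** Columns of a kernel of finite range are finite since a lattice is locally
    finite. *)
Lemma local_support n (k : pat_pair n -> R[i]) (eta : pat n) : local_kernel k ->
  lat eta = L -> finite_set [set xi : pat n | lat xi = L /\ mat k xi eta <> 0].
Proof.
move=> [_ _ [M MP]] etaL.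
apply: (@sub_finite_set _ _ [set xi : pat n | lat xi = L /\ forall i,
  enorm (lab xi i) <= M + \big[Num.max/0]_j enorm (lab eta j)]); last first.
  exact: finite_patterns.
move=> xi [xiL /mat_neq0[p kp [xiE etaE]]]; split=> // i.
have [j] := (MP p kp).1 i; rewrite -xiE -etaE => h.
have := enorm_triangle (lab xi i) (lab eta j).
have : enorm (lab eta j) <= \big[Num.max/0]_j enorm (lab eta j) by exact: le_bigmax.
lra.
Qed.

Section Sector.
Context (n : nat) (H : hilbertType R) (ket : pat n -> H).
Hypothesis ket_fermi : is_fermi_space L ket.
Implicit Types T S : H -> H.

Lemma ket_norm xi : lat xi = L -> inner (ket xi) (ket xi) = 1.
Proof.
move=> xiL; have [h _ _] := ket_fermi.
by rewrite (h xi xi 1%g) ?odd_perm1// => i; rewrite perm1.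
Qed.

Lemma ket_perm xi zeta (s : 'S_n) : lat xi = L -> lat zeta = L ->
  (forall i, lab zeta i = lab xi (s i)) -> ket zeta = (-1) ^+ s *: ket xi.
Proof.
move=> xiL zL h; have [hi _ _] := ket_fermi.
apply/eqP; rewrite -subr_eq0; apply/eqP/inner_self_eq0.
have e1 := hi xi zeta s xiL zL h.
have e2 : inner (ket zeta) (ket xi) = (-1) ^+ s.
  by rewrite inner_conj e1 rmorph_sign.
rewrite innerBl !innerBr !innerZl !innerZr !ket_norm// e1 e2 rmorph_sign mulr1.
by rewrite -expr2 sqrr_sign subrr.
Qed.

Lemma ket_relabel (s : 'S_n) xi : lat xi = L ->
  ket (relabel s xi) = (-1) ^+ s *: ket xi.
Proof. by move=> xiL; rewrite -odd_permV; apply: ket_perm. Qed.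

(** Unlike in the quantization of a coefficient, each pair of sets of points
    is counted with the labellings on one side only, and no factorial appears;
    this is multiplicative in the kernel. *)
Definition acts T (k : pat_pair n -> R[i]) :=
  forall eta, lat eta = L ->
    T (ket eta) = \sum_(xi \in patL n) mat k xi eta *: ket xi.

Lemma mat_scale_neq0 (c : R[i]) (u : H) : c *: u <> 0 -> c <> 0.
Proof. by move=> h c0; apply: h; rewrite c0 scale0r. Qed.

Lemma acts_comp T1 T2 k1 k2 : bounded_op T1 -> local_kernel k1 ->
  local_kernel k2 -> acts T1 k1 -> acts T2 k2 -> acts (T1 \o T2) (kprod k1 k2).
Proof.
move=> bT l1 l2 a1 a2 eta etaL; rewrite /= a2//.
pose A2 := [set zeta : pat n | lat zeta = L /\ mat k2 zeta eta <> 0].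
have fA2 : finite_set A2 by exact: local_support.
pose A1 := \bigcup_(zeta in A2) [set xi : pat n | lat xi = L /\ mat k1 xi zeta <> 0].
have fA1 : finite_set A1.
  by apply: bigcup_finite => // zeta [zL _]; exact: local_support.
rewrite (@fsum_finite _ _ A2)//; last 2 first.
- by move=> zeta [].
- by move=> zeta zL /mat_scale_neq0 kz; split.
rewrite bop_sum//.
transitivity (\sum_(zeta <- fset_set A2) \sum_(xi <- fset_set A1)
    (mat k1 xi zeta * mat k2 zeta eta) *: ket xi).
  apply: eq_big_seq => zeta; rewrite in_fset_set// => /set_mem zA2.
  rewrite bopZ// a1; last by case: zA2.
  rewrite (@fsum_finite _ _ A1)//; last 2 first.
  - by move=> xi [z _ []].
  - by move=> xi xiL /mat_scale_neq0 kz; exists zeta.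
  by rewrite scaler_sumr; apply: eq_bigr => xi _; rewrite scalerA mulrC.
have prodE xi : lat xi = L -> mat (kprod k1 k2) xi eta =
    \sum_(zeta <- fset_set A2) mat k1 xi zeta * mat k2 zeta eta.
  move=> xiL; have e : lat xi = lat eta by rewrite xiL etaL.
  rewrite (mat_mkp _ e) /kprod /= xiL; apply: fsum_finite => //.
    by move=> zeta [].
  by move=> zeta zL /eqP; rewrite mulf_eq0 negb_or => /andP[_ /eqP].
rewrite exchange_big (@fsum_finite _ _ A1)//; last 2 first.
- by move=> xi [z _ []].
- move=> xi xiL /mat_scale_neq0; rewrite prodE// => h.
  apply: contrapT => nA1; apply: h; apply: big1_seq => zeta /=.
  rewrite in_fset_set// => /set_mem zA2; apply: contrapT => /eqP.
  rewrite mulf_eq0 negb_or => /andP[/eqP h1 _]; apply: nA1; by exists zeta.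
apply: eq_big_seq => xi; rewrite in_fset_set// => /set_mem [z _ [xiL _]].
by rewrite prodE// scaler_suml.
Qed.

End Sector.
End KernelOperators.

(** * Antisymmetric kernels *)

Section SectorAlgebra.
Context (R : realType) (d : nat) (r rho : R).
Hypothesis r0 : 0 < r.
Local Notation E := 'rV[R]_d.
Local Notation pat n := (pattern d r rho n).
Local Notation pat_pair n := (@pat_pair R d r rho n).
Context (L : set E) (L_delone : delone r rho L).
Local Notation patL n := [set xi : pat n | lat xi = L].

Lemma points_perm n (xi zeta : pat n) : points xi = points zeta ->
  exists s : 'S_n, forall i, lab zeta i = lab xi (s i).
Proof.
move=> e.
have ex i : exists j, lab zeta i = lab xi j.
  have : points xi (lab zeta i) by rewrite e; exists i.
  by case=> j _ <-; exists j.
have [g gP] := choice ex.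
have g_inj : injective g.
  by move=> i j gij; apply: (@lab_inj _ _ _ _ _ zeta); rewrite !gP gij.
by exists (perm g_inj) => i; rewrite permE.
Qed.

Definition flip n (p : pat_pair n) : pat_pair n := mkp (esym (pp_lat p)).

Lemma compact_kernel_flip n (k : pat_pair n.+1 -> R[i]) :
  compact_kernel k -> compact_kernel (fun p => (k (flip p))^*).
Proof.
move=> ck; have [M MP] := compact_kernel_range r0 ck.
have [cont inv [K cK KP]] := ck; split.
- move=> p.
  have cf : {for p, continuous (@flip n.+1)}.
    by apply/(@pat_pair_cvgP _ _ _ _ r0 _ (nbhs p)); split;
      [exact: pat_pair_cvgr|exact: pat_pair_cvgl].
  have ckf := continuous_comp cf (cont (flip p)).
  apply/(@cvgrPdist_lt _ _ _ (nbhs p)) => e e0.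
  move/(@cvgrPdist_lt _ _ _ (nbhs p)): ckf => /(_ e e0); apply: filterS => p'.
  by rewrite -rmorphB norm_conjC.
- move=> x p; congr (_^*); rewrite -(inv x (flip p)); congr k; exact: pat_pair_eq.
apply: (ex_intro2 _ _ _ (@transfer_compact _ _ _ _ r0 _ K (2 * Num.max 0 M) cK)).
have M0 : 0 <= Num.max 0 M by rewrite le_max lexx.
have MM : M <= Num.max 0 M by rewrite le_max lexx orbT.
move=> p p0 kp; have {}kp : k (flip p) <> 0 by move=> h; apply: kp; rewrite h conjC0.
pose z := lab (ppl p) ord0.
have zM : enorm z <= M.
  have [h _] := MP _ kp ord0; move: h.
  by rewrite [ppl _]/= [ppr (flip p)]/= p0 sub0r enormN.
exists (slice (flip p)), (- z); split.
- by apply: KP; [exact: slice_label|rewrite inv].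
- by rewrite enormN; lra.
- by rewrite [translate (- z) _]translateNK pp_lat.
- move=> i; have [h1 h2] := MP _ kp i; move: h1 h2.
  rewrite [ppl _]/= [ppr (flip p)]/= -/z => h1 h2; split.
    by have := enorm_triangle (lab (ppl p) i) z; lra.
  by have := enorm_triangle (lab (ppr p) i) z; lra.
Qed.

Section Sector.
Context (n : nat) (H : hilbertType R) (ket : pat n -> H).
Hypothesis ket_fermi : is_fermi_space L ket.
Implicit Types T S : H -> H.

Lemma column_bound (k : pat_pair n -> R[i]) (eta : pat n) : local_kernel k ->
  lat eta = L -> exists B : R, forall (t : 'S_n) xi, lat xi = L ->
    mat k xi (relabel t eta) <> 0 -> forall i, enorm (lab xi i) <= B.
Proof.
move=> [_ _ [M MP]] etaL.
exists (M + \big[Num.max/0]_j enorm (lab eta j)) => t xi xiL /mat_neq0[p kp [xiE etaE]] i.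
have [j] := (MP p kp).1 i; rewrite -xiE -etaE => h.
have := enorm_triangle (lab xi i) (lab (relabel t eta) j).
have : enorm (lab (relabel t eta) j) <= \big[Num.max/0]_j enorm (lab eta j).
  exact: le_bigmax.
lra.
Qed.

(** A ket depends on the labelling only up to sign. Hence T on a ket may be
    computed after relabelling, and averaging over both relabellings
    antisymmetrizes the kernel. *)
Lemma acts_antisym T k : bounded_op T -> local_kernel k -> acts L ket T k ->
  acts L ket T (antisym k).
Proof.
move=> bT lk a eta etaL; have [B BP] := column_bound lk etaL.
pose A := [set xi : pat n | lat xi = L /\ forall i, enorm (lab xi i) <= B].
have fA : finite_set A by exact: finite_patterns.
have nz : (n`!%:R : R[i]) != 0 by rewrite pnatr_eq0 -lt0n fact_gt0.
have term (s t : 'S_n) : T (ket eta) = \sum_(xi <- fset_set A)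
    ((-1) ^+ s * (-1) ^+ t * mat k (relabel s xi) (relabel t eta)) *: ket xi.
  have -> : ket eta = (-1) ^+ t *: ket (relabel t eta).
    by rewrite (ket_relabel ket_fermi)// scalerA -signr_addb addbb expr0 scale1r.
  rewrite bopZ// a// (@fsum_finite _ _ A)//; last 2 first.
  - by move=> xi [].
  - by move=> xi xiL /mat_scale_neq0 kz; split=> //; exact: BP kz.
  rewrite -fsbig_finite// (reindex_fsbig (relabel s) A A); last first.
    split.
    - by move=> xi [xiL xiB]; split=> // i; exact: xiB.
    - by move=> x1 x2 _ _; apply: can_inj; exact: relabelK.
    - move=> xi [xiL xiB]; exists (relabel s^-1%g xi); last exact: relabelVK.
      by split=> // i; exact: xiB.
  rewrite fsbig_finite// scaler_sumr; apply: eq_big_seq => xi.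
  rewrite in_fset_set// => /set_mem[xiL _]; rewrite (ket_relabel ket_fermi)//.
  by rewrite !scalerA; congr (_ *: _); rewrite mulrC mulrA.
have sumT : (n`!%:R * n`!%:R) *: T (ket eta) = \sum_(st : 'S_n * 'S_n)
    \sum_(xi <- fset_set A)
    ((-1) ^+ st.1 * (-1) ^+ st.2 * mat k (relabel st.1 xi) (relabel st.2 eta)) *: ket xi.
  rewrite (eq_bigr (fun=> T (ket eta))) => [|st _]; last by rewrite -term.
  rewrite sumr_const cardT -cardE card_prod !card_Sn -natrM.
  exact: scaler_nat.
have TE : T (ket eta) = (n`!%:R^-1 * n`!%:R^-1) *: ((n`!%:R * n`!%:R) *: T (ket eta)).
  by rewrite scalerA -invfM mulVf ?scale1r// mulf_neq0.
have matA xi : lat xi = L -> mat (antisym k) xi eta = (n`!%:R^-1 * n`!%:R^-1) *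
    \sum_(st : 'S_n * 'S_n) (-1) ^+ st.1 * (-1) ^+ st.2 *
      mat k (relabel st.1 xi) (relabel st.2 eta).
  move=> xiL; have e : lat xi = lat eta by rewrite xiL etaL.
  rewrite (mat_mkp _ e); congr (_ * _); apply: eq_bigr => st _; congr (_ * _).
  have e' : lat (relabel st.1 xi) = lat (relabel st.2 eta) by [].
  by rewrite (mat_mkp _ e'); congr k; apply: pat_pair_eq.
rewrite TE sumT exchange_big /= (@fsum_finite _ _ A)//; last 2 first.
- by move=> xi [].
- move=> xi xiL /mat_scale_neq0; rewrite matA// => h.
  apply: contrapT => nA; apply: h; rewrite big1 ?mulr0// => -[s t] _ /=.
  suff -> : mat k (relabel s xi) (relabel t eta) = 0 by rewrite mulr0.
  apply: contrapT => kn; apply: nA; split=> // i.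
  have := BP t (relabel s xi) xiL kn (s i).
  by rewrite /= permK.
rewrite scaler_sumr; apply: eq_big_seq => xi.
rewrite in_fset_set// => /set_mem[xiL _]; rewrite matA//.
by rewrite -[RHS]scalerA; congr (_ *: _); rewrite scaler_suml.
Qed.

Definition skew (k : pat_pair n -> R[i]) :=
  forall (s t : 'S_n) p, k (prelabel s t p) = (-1) ^+ s * (-1) ^+ t * k p.

Lemma mat_skew k (s t : 'S_n) xi zeta : skew k ->
  mat k (relabel s xi) (relabel t zeta) = (-1) ^+ s * (-1) ^+ t * mat k xi zeta.
Proof.
move=> sk; rewrite {2}/mat; case: pselect => e.
  have e' : lat (relabel s xi) = lat (relabel t zeta) by [].
  by rewrite (mat_mkp _ e') -sk; congr k; apply: pat_pair_eq.
by rewrite mulr0 /mat; case: pselect.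
Qed.

Lemma inner_neq0 xi eta : lat xi = L -> lat eta = L ->
  inner (ket xi) (ket eta) <> 0 -> exists t : 'S_n, xi = relabel t eta.
Proof.
move=> xiL etaL h; have [_ h2 _] := ket_fermi.
have [|s sP] := @points_perm n eta xi.
  by apply: contrapT => hp; apply: h; apply: h2 => // e; apply: hp.
exists s^-1%g; apply: pattern_eq => [|i]; first by rewrite xiL /= etaL.
by rewrite sP /= invgK.
Qed.

Lemma inner_relabel (t : 'S_n) eta : lat eta = L ->
  inner (ket (relabel t eta)) (ket eta) = (-1) ^+ t.
Proof.
move=> etaL; rewrite (ket_relabel ket_fermi)// innerZl rmorph_sign.
by rewrite (ket_norm ket_fermi)// mulr1.
Qed.

Lemma relabel_inj2 (eta : pat n) : injective (fun t : 'S_n => relabel t eta).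
Proof.
move=> s t e; apply: invg_inj; apply/permP => i; apply: (@lab_inj _ _ _ _ _ eta).
exact: (congr1 (fun xi : pat n => lab xi i) e).
Qed.

(** The overlaps with the kets of all the patterns add up to the labellings
    of a single set of points. *)
Lemma sum_overlap (V : lmodType R[i]) (c : pat n -> V) (eta : pat n) :
  lat eta = L -> (forall t : 'S_n, c (relabel t eta) = (-1) ^+ t *: c eta) ->
  \sum_(xi \in patL n) inner (ket xi) (ket eta) *: c xi = (n`!%:R : R[i]) *: c eta.
Proof.
move=> etaL ct.
pose rs := [seq relabel t eta | t <- enum 'S_n].
have urs : uniq rs by rewrite map_inj_uniq ?enum_uniq//; exact: relabel_inj2.
rewrite fsbig_supp (fsbig_fwiden rs)//; last 2 first.
- move=> xi [xiL h] /=; have [t ->] : exists t : 'S_n, xi = relabel t eta.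
    by apply: inner_neq0 => // h0; apply: h; rewrite h0 scale0r.
  by apply: map_f; rewrite mem_enum.
- move=> xi [/mapP[t _ ->] h]; apply: contrapT => h'; apply: h; split=> //.
rewrite big_map (eq_bigr (fun=> c eta)) => [|t _]; last first.
  by rewrite inner_relabel// ct scalerA -signr_addb addbb expr0 scale1r.
rewrite big_const_seq count_predT -cardE card_Sn iter_addr addr0.
by rewrite scaler_nat.
Qed.

(** For a fixed set of points the n! labellings of the right pattern
    contribute equally, which cancels the factor 1 / n!. *)
Lemma represents_acts q T : local_kernel q -> skew q ->
  represents L ket q T <-> acts L ket T q.
Proof.
move=> lq sq.
suff E1 (eta : pat n) : lat eta = L -> (n`!%:R^-1 : R[i]) *:
      \sum_(p \in [set p : pat_pair n | lat (ppl p) = L])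
        q p *: ketbra (ket (ppl p)) (ket (ppr p)) (ket eta) =
    \sum_(xi \in patL n) mat q xi eta *: ket xi.
  by split=> h eta etaL; rewrite h// E1.
move=> etaL; have [B BP] := column_bound lq etaL.
pose A := [set xi : pat n | lat xi = L /\ forall i, enorm (lab xi i) <= B].
have fA : finite_set A by exact: finite_patterns.
have nz : (n`!%:R : R[i]) != 0 by rewrite pnatr_eq0 -lt0n fact_gt0.
pose h (xi : pat n) (t : 'S_n) : pat_pair n :=
  if pselect (lat xi = lat (relabel t eta)) is left e then mkp e
  else mkp (erefl (lat eta)).
have hE xi t : lat xi = L -> ppl (h xi t) = xi /\ ppr (h xi t) = relabel t eta.
  by move=> xiL; rewrite /h; case: pselect => // [[]]; rewrite /= etaL.
pose rs := [seq h xi t | xi <- fset_set A, t <- enum 'S_n].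
have inA xi : xi \in fset_set A -> A xi by rewrite in_fset_set// => /set_mem.
have urs : uniq rs.
  apply: allpairs_uniq; [exact: fset_uniq|exact: enum_uniq|].
  move=> [x1 t1] [x2 t2] /allpairsP[[x1' t1'] [/= /inA[xl1 _] _ [-> ->]]].
  move=> /allpairsP[[x2' t2'] [/= /inA[xl2 _] _ [-> ->]]] e.
  have [a1 b1] := hE x1' t1' xl1; have [a2 b2] := hE x2' t2' xl2.
  by rewrite -a1 e a2; congr (_, _); apply: (@relabel_inj2 eta); rewrite -b1 e b2.
rewrite fsbig_supp (fsbig_fwiden rs)//; last 2 first.
- move=> p [pL /= hp].
  have qp : q p <> 0 by move=> h0; apply: hp; rewrite h0 scale0r.
  have [|||t tE] := @inner_neq0 (ppr p) eta => //; first by rewrite -pp_lat.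
    by move=> h0; apply: hp; rewrite /ketbra h0 scale0r scaler0.
  apply/allpairsP; exists (ppl p, t); split=> /=; last 2 first.
  + by rewrite mem_enum.
  + by have [a1 b1] := hE (ppl p) t pL; apply: pat_pair_eq; rewrite ?a1 ?b1.
  rewrite in_fset_set// inE; split=> //; apply: (BP t) => //.
  by rewrite -tE matE.
- move=> p [/allpairsP[[xi t] [/= /inA[xiL _] _ ->]]] h1.
  by apply: contrapT => h2; apply: h1; split=> //=; have [-> _] := hE xi t xiL.
rewrite big_allpairs_dep /= (@fsum_finite _ _ A)//; last 2 first.
- by move=> xi [].
- move=> xi xiL /mat_scale_neq0 k0; split=> //; apply: (BP 1%g) => //.
  by rewrite relabel1.
rewrite scaler_sumr; apply: eq_big_seq => xi /inA[xiL _].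
rewrite (eq_bigr (fun=> mat q xi eta *: ket xi)) => [|t _]; last first.
  have [a1 b1] := hE xi t xiL.
  rewrite /ketbra a1 b1 inner_relabel// scalerA; congr (_ *: _).
  rewrite -matE a1 b1 -{1}[xi]relabel1 mat_skew// odd_perm1 mul1r.
  by rewrite mulrAC -signr_addb addbb expr0 mul1r.
rewrite big_const_seq count_predT -cardE card_Sn iter_addr addr0.
by rewrite -(@scaler_nat R[i] _ n`! (mat q xi eta *: ket xi)) !scalerA mulVf// mul1r.
Qed.

Lemma ket_dense u v : (forall xi, lat xi = L -> inner (ket xi) u = inner (ket xi) v) ->
  u = v.
Proof.
move=> h; have [_ _ hspan] := ket_fermi.
pose W := [set w : H | inner w (u - v) = 0].
suff WT w : W w by apply/eqP; rewrite -subr_eq0; apply/eqP/inner_self_eq0/WT.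
have : closed_span (ket @` [set xi | lat xi = L]) w by rewrite hspan.
apply.
- move=> x clx; apply: eq0_normc; apply/le_anti; rewrite normc_ge0 andbT.
  apply/ler_addgt0Pl => e e0; rewrite addr0.
  have p : 0 < hnorm (u - v) + 1 by rewrite ltr_wpDl// hnorm_ge0.
  have e1 : 0 < e / (hnorm (u - v) + 1) by rewrite divr_gt0.
  have [y [Wy /= xy]] := clx _ (hnear x e1).
  have -> : inner x (u - v) = inner (x - y) (u - v) by rewrite innerBl Wy subr0.
  apply: (le_trans (cauchy_schwarz _ _)).
  apply: (@le_trans _ _ (e / (hnorm (u - v) + 1) * hnorm (u - v))).
    by rewrite ler_wpM2r ?hnorm_ge0// ltW.
  by rewrite mulrAC ler_pdivrMr// ler_pM2l// lerDl.
- by rewrite /W /= inner0l.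
- move=> c x y; rewrite /W /= innerDl innerZl => -> ->.
  by rewrite mulr0 addr0.
- by move=> _ [xi xiL <-]; rewrite /W /= innerBr h// subrr.
Qed.

End Sector.
End SectorAlgebra.

(** * Multiplier algebras *)

Section Multipliers.
Context (R : realType) (H : hilbertType R).
Implicit Types (T S : H -> H) (G : set (H -> H)).

Lemma adjoint_unique T S S' : adjoint_of T S -> adjoint_of T S' -> S = S'.
Proof.
by move=> a a'; apply/funext => u; apply: inner_injl => v; rewrite a a'.
Qed.

Lemma adjoint_comp T T' S S' : adjoint_of T T' -> adjoint_of S S' ->
  adjoint_of (T \o S) (S' \o T').
Proof. by move=> a b u v; rewrite /= b a. Qed.

(** What makes the multipliers of a set of operators a C*-algebra: the set is
    a norm closed, self-adjoint space. *)
Record op_star_space G := {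
  oss_bounded : forall T, G T -> bounded_op T;
  oss_lin : forall (c : R[i]) S T, G S -> G T -> G (fun u => c *: S u + T u);
  oss_adj : forall T, G T -> exists2 S, G S & adjoint_of T S;
  oss_closed : forall T, bounded_op T ->
    (forall e : R, 0 < e ->
       exists2 S, G S & op_bound (fun u => T u - S u) e) -> G T
}.

Section MultiplierAlgebra.
Context (G : set (H -> H)) (GP : op_star_space G).

Fact mult_id : multipliers G id.
Proof. by split; [exact: bounded_id|move=> S GS; split]. Qed.

Fact mult_lin (c : R[i]) S T : multipliers G S -> multipliers G T ->
  multipliers G (fun u => c *: S u + T u).
Proof.
move=> [bS hS] [bT hT]; split=> [|X GX]; first exact: bounded_lin.
have [S1 S2] := hS X GX; have [T1 T2] := hT X GX; split.
  exact: (oss_lin GP c S1 T1).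
rewrite (_ : X \o _ = fun u => c *: (X \o S) u + (X \o T) u).
  exact: (oss_lin GP c S2 T2).
by apply/funext => u /=; rewrite (boundedP (oss_bounded GP GX)).
Qed.

Fact mult_comp S T : multipliers G S -> multipliers G T -> multipliers G (S \o T).
Proof.
move=> [bS hS] [bT hT]; split=> [|X GX]; first exact: bounded_comp.
have [S1 S2] := hS X GX; have [T1 T2] := hT X GX; split.
  exact: (hS _ T1).1.
exact: (hT _ S2).2.
Qed.

(** The adjoint of T* X is X* T, and it lies in G. *)
Fact mult_adj T : multipliers G T -> exists2 S, multipliers G S & adjoint_of T S.
Proof.
move=> [bT hT]; have [S bS aS] := adjoint_ex bT; exists S => //.
split=> // X GX; have [X' GX' aX] := oss_adj GP GX.
have aX' := adjoint_sym aX; have [h1 h2] := hT X' GX'; split.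
  have [Z GZ aZ] := oss_adj GP h2.
  by rewrite (adjoint_unique (adjoint_comp aX' aS) aZ).
have [Z GZ aZ] := oss_adj GP h1.
by rewrite (adjoint_unique (adjoint_comp aS aX') aZ).
Qed.

Fact mult_closed T : bounded_op T ->
  (forall e : R, 0 < e ->
     exists2 S, multipliers G S & op_bound (fun u => T u - S u) e) ->
  multipliers G T.
Proof.
move=> bT h; split=> // X GX; have bX := oss_bounded GP GX.
have [k k0 Xk] := bounded_op_ge0 bX.
have app (e : R) : 0 < e -> exists2 S, multipliers G S &
    op_bound (fun u => T u - S u) (e / k).
  by move=> e0; apply: h; rewrite divr_gt0.
split; apply: (oss_closed GP); [exact: bounded_comp| |exact: bounded_comp|] => e e0.
  have [S [bS hS] TS] := app e e0; exists (S \o X); first exact: (hS X GX).1.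
  have := op_bound_comp (ltW (divr_gt0 e0 k0)) TS Xk.
  by rewrite divfK ?gt_eqF.
have [S [bS hS] TS] := app e e0; exists (X \o S); first exact: (hS X GX).2.
have := op_bound_comp (ltW k0) Xk TS; rewrite mulrC divfK ?gt_eqF//.
by move=> b u; have := b u; rewrite /= bopB.
Qed.

Definition mult_star_ops : star_ops H :=
  @StarOps R H (multipliers G) (fun T h => h.1) mult_id mult_lin mult_comp
    mult_adj mult_closed.

End MultiplierAlgebra.

(** Adjoints of approximations approximate the adjoint, with the same
    error. *)
Lemma norm_closure_space G : (forall T, G T -> bounded_op T) ->
  (exists T, G T) ->
  (forall (c : R[i]) S T, G S -> G T -> G (fun u => c *: S u + T u)) ->
  (forall T, G T -> exists2 S, G S & adjoint_of T S) ->
  op_star_space (norm_closure G).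
Proof.
move=> Gb [T0 GT0] Gl Ga; split.
- by move=> T [].
- move=> c S T [bS hS] [bT hT]; split=> [|e e0]; first exact: bounded_lin.
  have p : 0 < normc c + 1 by rewrite ltr_wpDl ?normc_ge0.
  have e1 : 0 < e / (normc c + 1) by rewrite divr_gt0.
  have [S' GS' S'S] := hS _ e1; have [T' GT' T'T] := hT _ e1.
  exists (fun u => c *: S' u + T' u); first exact: Gl.
  have := op_bound_lin c S'S T'T.
  have -> : normc c * (e / (normc c + 1)) + e / (normc c + 1) = e.
    by rewrite -{2}[e / _]mul1r -mulrDl mulrC divfK ?gt_eqF.
  by move=> b u; have := b u; rewrite scalerBr opprD addrACA.
- move=> T [bT hT]; have [S bS aS] := adjoint_ex bT; exists S => //.
  split=> // e e0; have [T' GT' T'T] := hT _ e0; have [S' GS' aS'] := Ga _ GT'.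
  exists S' => //; apply: (@op_bound_adjoint _ _ (fun u => T u - T' u)) => //.
    exact: ltW.
  by move=> u v; rewrite innerBl innerBr aS aS'.
- move=> T bT h; split=> // e e0; have e2 : 0 < e / 2 by rewrite divr_gt0.
  have [S [bS hS] TS] := h _ e2; have [S' GS' S'S] := hS _ e2; exists S' => //.
  move/op_boundP: TS => TS; move/op_boundP: S'S => SS.
  apply/op_boundP => u; apply: (le_trans (hnorm_sub_le _ (S u) _)).
  by have := TS u; have := SS u; lra.
Qed.

(** The scalar of a limit T of scalar operators is the quotient <u0, T u0> /
    <u0, u0> at any nonzero vector u0. *)
Lemma scalar_space : op_star_space (@scalar_ops R H).
Proof.
split.
- move=> _ [c ->]; split=> [e u v|].
    by rewrite scalerDr !scalerA mulrC.
  by exists (normc c); apply/op_boundP => u; rewrite hnormZ.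
- move=> c _ _ [a ->] [b ->]; exists (c * a + b); apply/funext => u.
  by rewrite scalerDl scalerA.
- move=> _ [c ->]; exists (fun u => c^* *: u); first by exists c^*.
  by move=> u v; rewrite innerZl innerZr conjCK.
- move=> T bT h.
  have [[u0 u0n]|triv] := pselect (exists u : H, u <> 0); last first.
    exists 0; apply/funext => u; rewrite scale0r.
    by apply: contrapT => Tu; apply: triv; exists (T u).
  have nu : 0 < hnorm u0.
    rewrite lt_def hnorm_ge0 andbT; apply/eqP => /hnorm_eq0; exact: u0n.
  pose c := inner u0 (T u0) / inner u0 u0.
  have s0 : inner u0 u0 != 0 by apply/eqP => /inner_self_eq0.
  exists c; apply/funext => v; apply/eqP; rewrite -subr_eq0; apply/eqP/hnorm_eq0.
  apply/le_anti; rewrite hnorm_ge0 andbT; apply/ler_addgt0Pl => e e0; rewrite addr0.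
  have p : 0 < 2 * (hnorm v + 1) by rewrite mulr_gt0// ltr_wpDl// hnorm_ge0.
  have e1 : 0 < e / (2 * (hnorm v + 1)) by rewrite divr_gt0.
  have [_ [a ->] /op_boundP Ta] := h _ e1; set e' := e / _ in e1 Ta.
  have ca : normc (a - c) <= e'.
    have : inner u0 (T u0 - a *: u0) = (c - a) * inner u0 u0.
      by rewrite innerBr innerZr mulrBl divfK.
    move/(congr1 (@normc R)); rewrite normcM inner_self.
    have -> : normc (hnorm u0 ^+ 2)%:C = hnorm u0 ^+ 2.
      by rewrite /= expr0n addr0 sqrtr_sqr ger0_norm// exprn_ge0// ltW.
    move=> E; have := cauchy_schwarz u0 (T u0 - a *: u0).
    rewrite E; have := Ta u0 => h1 h2.
    have h3 : normc (c - a) * hnorm u0 ^+ 2 <= e' * hnorm u0 ^+ 2.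
      apply: (le_trans h2).
      have -> : e' * hnorm u0 ^+ 2 = hnorm u0 * (e' * hnorm u0) by ring.
      by rewrite ler_wpM2l// ltW.
    have n2 : 0 < hnorm u0 ^+ 2 by rewrite exprn_gt0.
    have -> : normc (a - c) = normc (c - a) by rewrite -normcN opprB.
    by rewrite -(ler_pM2r n2).
  have -> : T v - c *: v = (T v - a *: v) + (a - c) *: v.
    by rewrite scalerBl addrA subrK.
  apply: (le_trans (hnormD _ _)); rewrite hnormZ.
  apply: (@le_trans _ _ (e' * hnorm v + e' * hnorm v)).
    by rewrite lerD// ler_wpM2r// hnorm_ge0.
  have : e' * (2 * (hnorm v + 1)) = e by rewrite divfK ?gt_eqF.
  by move=> <-; move: e1; nra.
Qed.

End Multipliers.

Section SectorMultipliers.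
Context (R : realType) (d : nat) (r rho : R).
Hypothesis r0 : 0 < r.
Local Notation E := 'rV[R]_d.
Local Notation pat n := (pattern d r rho n).
Local Notation pat_pair n := (@pat_pair R d r rho n).
Context (L : set E) (L_delone : delone r rho L).
Local Notation patL n := [set xi : pat n | lat xi = L].
Context (n : nat) (H : hilbertType R) (ket : pat n.+1 -> H).
Hypothesis ket_fermi : is_fermi_space L ket.
Implicit Types T S : H -> H.

(** The operators of the coefficients, described by arbitrary kernels of
    compact support so that stability under products is visible. *)
Definition kernel_ops : set (H -> H) := [set T | bounded_op T /\
  exists2 k : pat_pair n.+1 -> R[i], compact_kernel k & acts L ket T k].

Lemma kernel_ops_skew T : kernel_ops T ->
  exists q, [/\ is_coefficient q, compact_kernel q, skew q & acts L ket T q].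
Proof.
move=> [bT [k ck a]]; exists (antisym k); split.
- exact: antisym_coefficient.
- exact: antisym_compact.
- by move=> s t p; exact: antisym_relabel.
- by apply: (acts_antisym r0 L_delone ket_fermi) => //; exact: compact_kernel_local.
Qed.

Lemma coefficient_skew (q : pat_pair n.+1 -> R[i]) : is_coefficient q -> skew q.
Proof.
move=> [_ h] s t p; rewrite (h s t^-1%g p); first by rewrite odd_permV mulrAC.
  by [].
by rewrite invgK.
Qed.

Lemma G_algE : G_alg L ket = norm_closure kernel_ops.
Proof.
rewrite /G_alg; congr norm_closure; apply/seteqP; split=> T.
  move=> [bT [q cq rq]]; split=> //; exists q; first exact: coefficient_compact.
  have lq := compact_kernel_local r0 (coefficient_compact r0 cq).
  exact/(represents_acts r0 L_delone ket_fermi T lq (coefficient_skew cq)).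
move=> kT; have [bT _] := kT; have [q [cq ck sq a]] := kernel_ops_skew kT.
split=> //; exists q => //.
have lq := compact_kernel_local r0 ck.
exact/(represents_acts r0 L_delone ket_fermi T lq sq).
Qed.

Lemma compact_kernel_lin (c : R[i]) (k1 k2 : pat_pair n.+1 -> R[i]) :
  compact_kernel k1 -> compact_kernel k2 ->
  compact_kernel (fun p => c * k1 p + k2 p).
Proof.
move=> c1 c2; pose k (b : bool) := if b then (fun p => c * k1 p) else k2.
have := @compact_kernel_sum _ _ _ _ n bool [:: true; false] k.
rewrite (_ : (fun p => \sum_(i <- [:: true; false]) k i p) = fun p => c * k1 p + k2 p).
  by apply=> -[]; [exact: compact_kernelZ|].
by apply/funext => p; rewrite !big_cons big_nil addr0.
Qed.

Lemma mat_lin (c : R[i]) (k1 k2 : pat_pair n.+1 -> R[i]) xi zeta :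
  mat (fun p => c * k1 p + k2 p) xi zeta = c * mat k1 xi zeta + mat k2 xi zeta.
Proof. by rewrite /mat; case: pselect => // _; rewrite mulr0 addr0. Qed.

Lemma kernel_ops_lin (c : R[i]) S T : kernel_ops S -> kernel_ops T ->
  kernel_ops (fun u => c *: S u + T u).
Proof.
move=> [bS [k1 c1 a1]] [bT [k2 c2 a2]]; split; first exact: bounded_lin.
exists (fun p => c * k1 p + k2 p); first exact: compact_kernel_lin.
move=> eta etaL; rewrite a1// a2//.
pose A1 := [set xi : pat n.+1 | lat xi = L /\ mat k1 xi eta <> 0].
pose A2 := [set xi : pat n.+1 | lat xi = L /\ mat k2 xi eta <> 0].
have fA : finite_set (A1 `|` A2).
  by rewrite finite_setU; split; apply: local_support => //; exact: compact_kernel_local.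
have AL : A1 `|` A2 `<=` patL n.+1 by move=> xi [[]|[]].
rewrite (@fsum_finite _ _ (A1 `|` A2))//; last first.
  by move=> xi xiL /mat_scale_neq0 h; left.
rewrite (@fsum_finite _ _ (A1 `|` A2))//; last first.
  by move=> xi xiL /mat_scale_neq0 h; right.
rewrite (@fsum_finite _ _ (A1 `|` A2))//; last first.
  move=> xi xiL /mat_scale_neq0; rewrite mat_lin => h.
  have [h1|h1] := eqVneq (mat k1 xi eta) 0.
    by right; split=> // h2; apply: h; rewrite h1 h2 mulr0 addr0.
  by left; split=> //; exact/eqP.
rewrite scaler_sumr -big_split /=; apply: eq_bigr => xi _.
by rewrite mat_lin scalerDl scalerA.
Qed.

Lemma inner_sumr (u : H) (I : Type) (s : seq I) (f : I -> H) :
  inner u (\sum_(i <- s) f i) = \sum_(i <- s) inner u (f i).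
Proof. exact: (big_morph _ (innerDr u) (inner0r u)). Qed.

Lemma inner_suml (u : H) (I : Type) (s : seq I) (f : I -> H) :
  inner (\sum_(i <- s) f i) u = \sum_(i <- s) inner (f i) u.
Proof.
exact: (big_morph (fun v => inner v u) (fun v w => innerDl v w u) (inner0l u)).
Qed.

Lemma mat_flip (q : pat_pair n.+1 -> R[i]) xi zeta :
  mat (fun p => (q (flip p))^*) xi zeta = (mat q zeta xi)^*.
Proof.
rewrite {2}/mat; case: pselect => e.
  by rewrite (mat_mkp _ (esym e)); congr (_^*); congr q; exact: pat_pair_eq.
by rewrite conjC0 /mat; case: pselect => // e'; case: e; rewrite e'.
Qed.

(** The conjugate transpose of an antisymmetric kernel acts as the adjoint. By
    density it suffices to compare matrix elements between kets, and these are
    the kernel times n!. *)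
Lemma kernel_ops_adj T : kernel_ops T -> exists2 S, kernel_ops S & adjoint_of T S.
Proof.
move=> kT; have [bT _] := kT; have [q [_ cq sq a]] := kernel_ops_skew kT.
have [S bS aS] := adjoint_ex bT; exists S => //; split=> //.
have cq' := compact_kernel_flip r0 cq.
exists (fun p => (q (flip p))^*) => // eta etaL; apply: (ket_dense ket_fermi) => zeta zL.
rewrite -(adjoint_sym aS) a//.
pose A1 := [set xi : pat n.+1 | lat xi = L /\ mat q xi zeta <> 0].
have fA1 : finite_set A1 by apply: local_support => //; exact: compact_kernel_local.
pose A2 := [set xi : pat n.+1 | lat xi = L /\
  mat (fun p => (q (flip p))^*) xi eta <> 0].
have fA2 : finite_set A2 by apply: local_support => //; exact: compact_kernel_local.
have AL1 : A1 `<=` patL n.+1 by move=> xi [].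
have AL2 : A2 `<=` patL n.+1 by move=> xi [].
rewrite (@fsum_finite _ _ A1)//; last by move=> xi xiL /mat_scale_neq0.
rewrite (@fsum_finite _ _ A2)//; last by move=> xi xiL /mat_scale_neq0.
rewrite inner_suml inner_sumr.
have h1 := @sum_overlap _ _ _ _ _ _ _ _ ket_fermi (R[i])^o
  (fun xi => (mat q xi zeta)^*) eta etaL.
have h2 := @sum_overlap _ _ _ _ _ _ _ _ ket_fermi (R[i])^o
  (fun xi => mat q eta xi) zeta zL.
rewrite (@fsum_finite _ _ A1) in h1 => //; last first.
  move=> xi xiL h; split=> // h0; apply: h.
  by rewrite h0 conjC0 scaler0.
rewrite (@fsum_finite _ _ A2) in h2 => //; last first.
  move=> xi xiL h; split=> //; rewrite mat_flip => /eqP; rewrite conjC_eq0 => /eqP h0.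
  by apply: h; rewrite h0 scaler0.
transitivity ((n.+1`!%:R : R[i]) *: ((mat q eta zeta)^* : (R[i])^o)).
  rewrite -h1.
    by apply: eq_bigr => xi _; rewrite innerZl mulrC.
  move=> t; rewrite -{1}[zeta]relabel1 mat_skew// odd_perm1 mulr1.
  by rewrite rmorphM rmorph_sign.
transitivity (((n.+1`!%:R : R[i]) *: (mat q eta zeta : (R[i])^o))^*).
  by rewrite [in RHS]/( _ *: _)/= rmorphM rmorph_nat.
rewrite -h2.
  rewrite rmorph_sum; apply: eq_bigr => xi _.
  by rewrite innerZr mat_flip [in LHS]/(_ *: _)/= rmorphM /= mulrC -inner_conj.
move=> t; rewrite -{1}[eta]relabel1 mat_skew// odd_perm1 mul1r.
by [].
Qed.

Lemma kernel_ops_neq0 : exists T, kernel_ops T.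
Proof.
exists (fun=> 0); split.
  split=> [c u v|]; first by rewrite scaler0 addr0.
  by exists 0 => u; rewrite mul0r normr0.
exists (fun p => \sum_(i <- [::] : seq void) 0).
  by apply: (@compact_kernel_sum _ _ _ _ n void [::] (fun _ _ => 0)) => -[].
move=> eta etaL; rewrite fsbig1// => xi _.
by rewrite /mat; case: pselect => [e|_]; rewrite ?big_nil scale0r.
Qed.

Lemma G_space : op_star_space (G_alg L ket).
Proof.
rewrite G_algE; apply: norm_closure_space.
- by move=> T [].
- exact: kernel_ops_neq0.
- exact: kernel_ops_lin.
- exact: kernel_ops_adj.
Qed.

(** Products of a kernel of finite range with kernels of compact support have
    compact support; the norm closure is reached by boundedness of T. *)
Lemma local_multiplier T (b : pat_pair n.+1 -> R[i]) : bounded_op T ->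
  local_kernel b -> acts L ket T b -> multipliers (G_alg L ket) T.
Proof.
move=> bT lb aT; rewrite G_algE; split=> // X [bX hX].
have [k k0 Tk] := bounded_op_ge0 bT.
have mul S : kernel_ops S -> kernel_ops (T \o S) /\ kernel_ops (S \o T).
  move=> [bS [q cq aS]]; have lq := compact_kernel_local r0 cq.
  split; (split; first exact: bounded_comp).
    by exists (kprod b q); [exact: kprod_compact_r|exact: acts_comp].
  by exists (kprod q b); [exact: kprod_compact_l|exact: acts_comp].
split; (split; first exact: bounded_comp) => e e0.
  have [S kS XS] := hX (e / k) (divr_gt0 e0 k0).
  exists (T \o S); first exact: (mul S kS).1.
  have := op_bound_comp (ltW k0) Tk XS; rewrite mulrC divfK ?gt_eqF//.
  by move=> h u; have := h u; rewrite /= bopB.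
have [S kS XS] := hX (e / k) (divr_gt0 e0 k0).
exists (S \o T); first exact: (mul S kS).2.
by have := op_bound_comp (ltW (divr_gt0 e0 k0)) XS Tk; rewrite divfK ?gt_eqF.
Qed.

End SectorMultipliers.

(** * Words in the canonical anticommutation relations *)

Section CARWords.
Context (R : realType) (d : nat) (r rho : R).
Local Notation E := 'rV[R]_d.
Local Notation pat n := (pattern d r rho n).
Local Notation pat_pair n := (@pat_pair R d r rho n).
Context (A : cstarAlgType R) (a : E -> A) (L : set E).
Hypotheses (L_delone : delone r rho L) (A_CAR : is_CAR a L).
Implicit Types (x y : E) (u v w z : seq E).

Definition word u := forall x, x \in u -> L x.

Lemma word_cons x u : word (x :: u) <-> L x /\ word u.
Proof.
split=> [h|[Lx h] y]; last by rewrite inE => /orP[/eqP->//|]; exact: h.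
by split=> [|y yu]; apply: h; rewrite inE ?eqxx// yu orbT.
Qed.

Lemma word_cat u v : word (u ++ v) <-> word u /\ word v.
Proof.
split=> [h|[hu hv] y]; last by rewrite mem_cat => /orP[/hu|/hv].
by split=> y yu; apply: h; rewrite mem_cat yu ?orbT.
Qed.

Fixpoint cre u : A := if u is x :: w then star (a x) * cre w else 1.
(** The reversal matches the order of the factors in the monomials: the first
    letter of the word acts first. *)
Fixpoint ann u : A := if u is x :: w then ann w * a x else 1.

Lemma ann_cons x u : ann (x :: u) = ann u * a x. Proof. by []. Qed.

Lemma star1 : star (1 : A) = 1.
Proof. by have := starM (star 1) (1 : A); rewrite mulr1 starK mulr1. Qed.

Lemma star0 : star (0 : A) = 0.
Proof. by rewrite -[X in star X](scale0r 0) starZ conjC0 scale0r. Qed.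

Lemma starN (x : A) : star (- x) = - star x.
Proof. by rewrite -scaleN1r starZ rmorphN rmorph1 scaleN1r. Qed.

Lemma star_sign (b : nat) (x : A) : star ((-1) ^+ b * x) = (-1) ^+ b * star x.
Proof. by elim: b x => [|b IH] x; rewrite ?mul1r// exprS -!mulrA !mulN1r starN IH. Qed.

Lemma star_ann u : star (ann u) = cre u.
Proof. by elim: u => [|x u IH] /=; rewrite ?star1// starM IH. Qed.

Lemma star_cre u : star (cre u) = ann u.
Proof. by rewrite -star_ann starK. Qed.

Lemma cre_cat u v : cre (u ++ v) = cre u * cre v.
Proof. by elim: u => [|x u IH] /=; rewrite ?mul1r// IH mulrA. Qed.

Lemma ann_cat u v : ann (u ++ v) = ann v * ann u.
Proof. by elim: u => [|x u IH] /=; rewrite ?mulr1// IH mulrA. Qed.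

Lemma ann_rcons u x : ann (rcons u x) = a x * ann u.
Proof. by rewrite -cats1 ann_cat /= mul1r. Qed.

Lemma a_anti x y : L x -> L y -> a x * a y = - (a y * a x).
Proof.
by move=> Lx Ly; have [h _ _] := A_CAR; apply/eqP; rewrite -addr_eq0 h.
Qed.

Lemma star_anti x y : L x -> L y ->
  star (a x) * star (a y) = - (star (a y) * star (a x)).
Proof. by move=> Lx Ly; rewrite -!starM a_anti// starN. Qed.

Lemma a_star x y : L x -> L y ->
  a y * star (a x) = (x == y)%:R - star (a x) * a y.
Proof.
by move=> Lx Ly; have [_ h _] := A_CAR; rewrite -h// addrAC subrr add0r.
Qed.

Lemma signC (b : nat) (x : A) : (-1) ^+ b * x = x * (-1) ^+ b.
Proof. exact: (esym (commr_sign x b)). Qed.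

Lemma sign_mulCA (b : nat) (x y : A) : x * ((-1) ^+ b * y) = (-1) ^+ b * (x * y).
Proof. by rewrite !mulrA signC. Qed.

Lemma cre_front x u : word u -> x \in u ->
  exists b : bool, cre u = (-1) ^+ b * cre (x :: rem x u).
Proof.
elim: u => // y u IH /word_cons[Ly wu]; rewrite inE /=.
have [->|yx] := eqVneq y x; first by exists false; rewrite mul1r.
move=> /= xu; have [b ->] := IH wu xu.
have Lx : L x by exact: wu.
exists (~~ b); rewrite /= sign_mulCA (mulrA (star (a y))) star_anti// mulNr -mulrA.
by case: b; rewrite ?mul1r ?mulN1r ?opprK.
Qed.

Lemma word_rem x u : word u -> word (rem x u).
Proof. by move=> wu y /mem_rem /wu. Qed.

(** The sign is left open here; the representation on kets identifies it
    later. *)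
Lemma cre_perm u v : word v -> perm_eq u v ->
  exists b : bool, cre u = (-1) ^+ b * cre v.
Proof.
elim: u v => [|x u IH] v wv.
  by rewrite perm_sym => /perm_nilP ->; exists false; rewrite mul1r.
move=> uv; have xv : x \in v by rewrite -(perm_mem uv) mem_head.
have uv' : perm_eq u (rem x v).
  by rewrite -(perm_cons x); apply: (perm_trans uv); exact: perm_to_rem.
have [b1 e1] := IH _ (word_rem wv) uv'; have [b2 ->] := cre_front wv xv.
exists (b1 (+) b2); rewrite /= e1 sign_mulCA signr_addb -!mulrA.
by congr (_ * _); rewrite mulrA -signr_addb addbb mul1r.
Qed.

Lemma cre_dup u : word u -> ~~ uniq u -> cre u = 0.
Proof.
elim: u => // x u IH /word_cons[Lx wu] /=; rewrite negb_and negbK => /orP[xu|nu].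
  have [b ->] := cre_front wu xu; rewrite /= sign_mulCA (mulrA (star (a x))).
  suff -> : star (a x) * star (a x) = 0 by rewrite mul0r mulr0.
  have := star_anti Lx Lx; move/eqP; rewrite -addr_eq0 -mulr2n -scaler_nat.
  by rewrite scaler_eq0 pnatr_eq0 /= => /eqP.
by rewrite IH// mulr0.
Qed.

Lemma ann_dup u : word u -> ~~ uniq u -> ann u = 0.
Proof. by move=> wu nu; rewrite -star_cre cre_dup// star0. Qed.

Lemma a_cre x u : L x -> word u -> x \notin u ->
  a x * cre u = (-1) ^+ size u * cre u * a x.
Proof.
move=> Lx; elim: u => [|y u IH] /=; first by rewrite mulr1 !mul1r.
move=> /word_cons[Ly wu]; rewrite inE negb_or => /andP[xy xu].
rewrite mulrA a_star// [y == x]eq_sym (negPf xy) sub0r mulNr -(mulrA (star (a y))) IH//.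
rewrite exprS mulN1r !mulNr; congr (- _).
by rewrite !mulrA -signC.
Qed.

Lemma a_ann x u : L x -> word u -> a x * ann u = (-1) ^+ size u * ann u * a x.
Proof.
move=> Lx; elim: u => [|y u IH] /=; first by rewrite mulr1 !mul1r.
move=> /word_cons[Ly wu]; rewrite mulrA IH// -(mulrA _ (a x)) a_anti// mulrN.
by rewrite exprS mulN1r !mulNr -!mulrA.
Qed.

(** The signs from the two halves of a word of even degree cancel. *)
Lemma a_comm x u v : L x -> word u -> word v -> size u = size v -> x \notin u ->
  a x * (cre u * ann v) = (cre u * ann v) * a x.
Proof.
move=> Lx wu wv uv xu; rewrite mulrA a_cre// -(mulrA _ (a x)) a_ann// -uv -!mulrA.
rewrite sign_mulCA (mulrA ((-1) ^+ _)) -exprD addnn.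
by rewrite -mul2n exprM sqrrN expr1n expr1n mul1r.
Qed.

Lemma star_comm x u v : L x -> word u -> word v -> size u = size v ->
  x \notin v -> star (a x) * (cre u * ann v) = (cre u * ann v) * star (a x).
Proof.
move=> Lx wu wv uv xv; have := a_comm Lx wv wu (esym uv) xv.
by move/(congr1 star); rewrite !starM star_ann star_cre => ->.
Qed.

(** Observables with disjoint supports commute, since both have even
    degree. *)
Lemma words_comm u v u' v' : word u -> word v -> size u = size v ->
  word u' -> word v' -> (forall x, x \in u' -> x \notin v) ->
  (forall x, x \in v' -> x \notin u) ->
  (cre u' * ann v') * (cre u * ann v) = (cre u * ann v) * (cre u' * ann v').
Proof.
move=> wu wv uv wu' wv' du dv.
have hc : cre u' * (cre u * ann v) = (cre u * ann v) * cre u'.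
  elim: u' wu' du => [|x u' IH] /=; first by rewrite mul1r mulr1.
  move=> /word_cons[Lx wu'] du; rewrite -(mulrA (star (a x))) IH//; last first.
    by move=> y yu; apply: du; rewrite inE yu orbT.
  rewrite (mulrA (star (a x))) star_comm//; last by apply: du; rewrite mem_head.
  by rewrite !mulrA.
have ha : ann v' * (cre u * ann v) = (cre u * ann v) * ann v'.
  elim: v' wv' dv => [|x v' IH] /=; first by rewrite mul1r mulr1.
  move=> /word_cons[Lx wv'] dv; rewrite -(mulrA (ann v')) a_comm//; last first.
    by apply: dv; rewrite mem_head.
  rewrite (mulrA (ann v')) IH//; first by rewrite !mulrA.
  by move=> y yu; apply: dv; rewrite inE yu orbT.
by rewrite -(mulrA (cre u')) ha (mulrA (cre u')) hc -(mulrA _ (cre u')).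
Qed.

Definition letters n (xi : pat n) : seq E := [seq lab xi i | i <- enum 'I_n].

Lemma size_letters n (xi : pat n) : size (letters xi) = n.
Proof. by rewrite size_map size_enum_ord. Qed.

Lemma letters_uniq n (xi : pat n) : uniq (letters xi).
Proof. by rewrite map_inj_uniq ?enum_uniq//; exact: lab_inj. Qed.

Lemma letters_word n (xi : pat n) : lat xi = L -> word (letters xi).
Proof. by move=> xiL x /mapP[i _ ->]; rewrite -xiL; exact: lab_lat. Qed.

Lemma mem_letters n (xi : pat n) i : lab xi i \in letters xi.
Proof. by apply: map_f; rewrite mem_enum. Qed.

Lemma letters_eq n (xi zeta : pat n) : lat xi = lat zeta ->
  letters xi = letters zeta -> xi = zeta.
Proof.
move=> e /eq_in_map h; apply: pattern_eq => // i.
by apply: h; rewrite mem_enum.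
Qed.

Lemma word_pattern n u : size u = n -> uniq u -> word u ->
  exists xi : pat n, lat xi = L /\ letters xi = u.
Proof.
move=> /eqP un uu wu; pose t : n.-tuple E := Tuple un.
have t_inj : injective (tnth t) by apply/tuple_uniqP.
have t_L i : L (tnth t i) by apply: wu; exact: mem_tnth.
exists (Pattern L_delone t_inj t_L); split=> //.
by rewrite /letters /=; have := map_tnth_enum t.
Qed.

Lemma annihilatorsE n (xi : pat n) : annihilators a xi = ann (letters xi).
Proof.
have annE u : ann u = \prod_(x <- rev u) a x.
  by elim: u => [|x u IH] /=; rewrite ?big_nil// rev_cons big_rcons IH.
rewrite annE /annihilators -map_rev big_map.
transitivity (\prod_(i <- enum 'I_n) a (lab xi (rev_ord i))).
  by rewrite [index_enum _]unlock -enumT.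
rewrite -(big_map (@rev_ord n) xpredT (fun i => a (lab xi i))) /=.
congr (\prod_(i <- _) _); apply: (inj_map val_inj).
rewrite map_rev val_enum_ord -map_comp.
apply: (@eq_from_nth _ 0%N); first by rewrite size_map size_enum_ord size_rev size_iota.
move=> i; rewrite size_map size_enum_ord => iN.
rewrite (nth_map (Ordinal iN)) ?size_enum_ord//= nth_rev ?size_iota//.
by rewrite nth_enum_ord// nth_iota ?add0n// ltn_subrL (leq_ltn_trans _ iN).
Qed.

Lemma monomialE n (p : pat_pair n) :
  monomial a p = cre (letters (ppl p)) * ann (letters (ppr p)).
Proof. by rewrite /monomial !annihilatorsE star_ann. Qed.

Local Notation GI := (@GI R d r rho A a L).

Lemma GI_monomial m n (p : pat_pair n) : (m <= n)%N -> lat (ppl p) = L ->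
  GI m (monomial a p).
Proof. by move=> mn pL W cW W0 Wl WS; apply: WS; exists n, p. Qed.

Lemma GI0 m : GI m 0.
Proof. by move=> W. Qed.

Lemma GI_lin m (c : R[i]) (x y : A) : GI m x -> GI m y -> GI m (c *: x + y).
Proof. by move=> hx hy W cW W0 Wl WS; apply: (Wl c x y); [exact: (hx W cW W0 Wl WS)|exact: (hy W cW W0 Wl WS)]. Qed.

Lemma GIZ m (c : R[i]) (x : A) : GI m x -> GI m (c *: x).
Proof. by move=> hx; rewrite -[_ *: _]addr0; apply: GI_lin => //; exact: GI0. Qed.

Lemma GID m (x y : A) : GI m x -> GI m y -> GI m (x + y).
Proof. by move=> hx hy; rewrite -[x]scale1r; exact: GI_lin. Qed.

Lemma GIN m (x : A) : GI m x -> GI m (- x).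
Proof. by move=> hx; rewrite -scaleN1r; exact: GIZ. Qed.

Lemma GI_sign m (b : nat) (x : A) : GI m x -> GI m ((-1) ^+ b * x).
Proof.
elim: b x => [|b IH] x hx; first by rewrite mul1r.
by rewrite exprS mulN1r mulNr; apply: GIN; exact: IH.
Qed.

Lemma GI_leq m n (x : A) : (m <= n)%N -> GI n x -> GI m x.
Proof.
move=> mn hx W cW W0 Wl WS; apply: (hx W cW W0 Wl) => _ [k [p [nk pL ->]]].
by apply: WS; exists k, p; split=> //; exact: leq_trans nk.
Qed.

Lemma GI_normal m u v : word u -> word v -> size u = size v -> (m <= size u)%N ->
  GI m (cre u * ann v).
Proof.
move=> wu wv uv mu.
have [uu|/cre_dup->//] := boolP (uniq u); last by rewrite mul0r; exact: GI0.
have [vv|/ann_dup->//] := boolP (uniq v); last by rewrite mulr0; exact: GI0.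
have [xi [xiL xiE]] := word_pattern (erefl _) uu wu.
have [zeta [zL zE]] := word_pattern (esym uv) vv wv.
have e : lat xi = lat zeta by rewrite xiL zL.
have -> : cre u * ann v = monomial a (mkp e) by rewrite monomialE xiE zE.
exact: GI_monomial.
Qed.

(** Normal ordering only lowers the degree by contractions, one for each
    annihilator that stands on the left of a creator. *)
Lemma GI_word m u' v1 u v2 : word u' -> word v1 -> word u -> word v2 ->
  (m + size v1 <= size u' + size u)%N ->
  (size u' + size u = size v1 + size v2)%N ->
  GI m (cre u' * ann v1 * cre u * ann v2).
Proof.
elim: v1 u v2 => [|x z IH] u v2 wu' wv1 wu wv2 /= mle sz.
  rewrite mulr1 -cre_cat; apply: GI_normal => //; first exact/word_cat.
    by rewrite size_cat.
  by rewrite size_cat -[m]addn0.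
have [Lx wz] := (word_cons _ _).1 wv1.
(* a x moves to the right through the creators of u2, one at a time *)
have inner_ind u1 u2 : word u1 -> word u2 -> (size u1 + size u2 = size u)%N ->
    GI m (cre u' * ann z * cre u1 * a x * cre u2 * ann v2).
  elim: u2 u1 => [|y w IHw] u1 wu1 wu2 /= szu.
    rewrite mulr1 -[_ * a x * _]mulrA -ann_rcons; apply: IH => //.
    - by move=> y; rewrite mem_rcons => yv; apply: ((word_cons x v2).2 (conj Lx wv2)).
    - by move: mle szu; lia.
    - by move: sz szu; rewrite size_rcons; lia.
  have [Ly ww] := (word_cons _ _).1 wu2.
  have -> : cre u' * ann z * cre u1 * a x * (star (a y) * cre w) * ann v2 =
      (y == x)%:R *: (cre u' * ann z * cre (u1 ++ w) * ann v2) -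
      cre u' * ann z * cre (rcons u1 y) * a x * cre w * ann v2.
    rewrite cre_cat -cats1 cre_cat /= mulr1.
    rewrite [cre u' * ann z * cre u1 * a x * _]mulrA -(mulrA _ (a x)) a_star//.
    rewrite mulrBr !mulrBl !mulrA; congr (_ - _).
    by case: (y == x); rewrite ?scale1r ?scale0r ?mulr1// ?mulr0 !mul0r.
  apply: GI_lin; last first.
    apply: GIN; apply: IHw => //; last by rewrite size_rcons addSn -addnS.
    by move=> x'; rewrite mem_rcons; apply: ((word_cons y u1).2 (conj Ly wu1)).
  apply: IH => //; first exact/word_cat.
    by rewrite size_cat; move: mle szu; lia.
  by rewrite size_cat; move: sz szu; lia.
rewrite (mulrA (cre u')); have := inner_ind [::] u.
by rewrite /= mulr1; apply.
Qed.

(** An annihilator without partner anticommutes with all the creators on its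
    right, hence joins the annihilators of v. A normal ordered word that is
    longer by one remains. *)
Lemma GI_unmatched u' v' u v x : word u' -> word v' -> word u -> word v ->
  size u' = size v' -> size u = size v -> x \in v' -> x \notin u ->
  GI (size u).+1 (cre u' * ann v' * cre u * ann v).
Proof.
move=> wu' wv' wu wv s1 s2 xv xu; have Lx : L x by exact: wv'.
have [b] := cre_front wv' xv; move/(congr1 star).
rewrite star_sign !star_cre => ->.
rewrite ann_cons sign_mulCA -!mulrA; apply: GI_sign; rewrite (mulrA (a x)) a_cre//.
rewrite -!mulrA sign_mulCA sign_mulCA; apply: GI_sign.
rewrite -ann_rcons !mulrA; apply: GI_word => //; first exact: word_rem.
- by move=> y; rewrite mem_rcons; apply: ((word_cons x v).2 (conj Lx wv)).
- by move: s1 s2; rewrite size_rem//; case: v' xv {wv'} => //= y v' _; lia.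
- by move: s1 s2; rewrite size_rcons size_rem//; case: v' xv {wv'} => //= y v' _; lia.
Qed.

(** Each matched annihilator meets its creator and is replaced by 1 minus the
    reverse product; the latter adds a creator and an annihilator. *)
Lemma GI_contract u' z w v : word u' -> word (z ++ w) -> word v ->
  uniq (z ++ w) -> (size u' + size w = size v)%N ->
  GI (size v).+1 (cre u' * ann z * cre (z ++ w) * ann v - cre (u' ++ w) * ann v).
Proof.
move=> wu'; elim: z => [|x z IH] /=.
  by rewrite mulr1 cre_cat subrr => _ _ _ _; exact: GI0.
move=> /word_cons[Lx wzw] wv /andP[xzw uzw] sz.
have -> : cre u' * (ann z * a x) * (star (a x) * cre (z ++ w)) * ann v =
    cre u' * ann z * cre (z ++ w) * ann v -
    cre u' * ann z * star (a x) * (a x * cre (z ++ w)) * ann v.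
  rewrite (mulrA (cre u')) (mulrA _ (star (a x))) -(mulrA _ (a x)) a_star// eqxx.
  by rewrite mulrBr mulr1 !mulrBl !mulrA.
rewrite addrAC; apply: GID; first exact: IH.
apply: GIN; rewrite a_cre// -!mulrA sign_mulCA sign_mulCA sign_mulCA; apply: GI_sign.
rewrite -ann_rcons (mulrA (star (a x))) !mulrA -(mulrA _ (star (a x))).
apply: (@GI_word _ _ _ (x :: z ++ w)) => //.
- by move: wzw => /word_cat[].
- exact/word_cons.
- by move=> y; rewrite mem_rcons; apply: ((word_cons x v).2 (conj Lx wv)).
- by rewrite /= size_cat; move: sz; lia.
- by rewrite /= size_rcons size_cat; move: sz; lia.
Qed.

Lemma GI_product m n (p' : pat_pair n) (p : pat_pair m) : lat (ppl p') = L ->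
  lat (ppl p) = L -> GI m (monomial a p' * monomial a p).
Proof.
move=> p'L pL; rewrite !monomialE !mulrA.
have p'L' : lat (ppr p') = L by rewrite -pp_lat.
have pL' : lat (ppr p) = L by rewrite -pp_lat.
by apply: GI_word; rewrite ?size_letters 1?addnC//; exact: letters_word.
Qed.

End CARWords.

(** * Products modulo higher degree *)

Section QuotientMap.
Context (R : realType) (d : nat) (r rho : R).
Local Notation E := 'rV[R]_d.
Local Notation pat n := (pattern d r rho n).
Local Notation pat_pair n := (@pat_pair R d r rho n).
Context (A : cstarAlgType R) (a : E -> A) (L : set E).
Hypotheses (L_delone : delone r rho L) (A_CAR : is_CAR a L).
Local Notation GI := (@GI R d r rho A a L).

Section Sector.
Context (N : nat) (H : hilbertType R) (ket : pat N -> H).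
Hypothesis ket_fermi : is_fermi_space L ket.
Context (pi : A -> H -> H) (piP : is_quotient_map L ket a pi).

Lemma pi_eq0 (x : A) : GI N.+1 x -> pi x = (fun=> 0).
Proof.
move=> hx; have [[_ _ h] _ _] := piP; apply/h => //; exact: GI_leq hx.
Qed.

Lemma pi_lin (c : R[i]) (x y : A) : GI N x -> GI N y ->
  pi (c *: x + y) = (fun u => c *: pi x u + pi y u).
Proof. by have [_ [h _ _] _] := piP; exact: h. Qed.

Lemma pi0 : pi 0 = (fun=> 0).
Proof. by apply: pi_eq0; move=> W. Qed.

Lemma piZ (c : R[i]) (x : A) : GI N x -> pi (c *: x) = (fun u => c *: pi x u).
Proof.
move=> hx; rewrite -[_ *: _]addr0 pi_lin//.
by rewrite pi0; apply/funext => u; rewrite addr0.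
Qed.

Lemma pi_eq (x y : A) : GI N x -> GI N y -> GI N.+1 (x - y) -> pi x = pi y.
Proof.
move=> hx hy /pi_eq0; rewrite addrC -scaleN1r pi_lin// => h.
apply/funext => u; have := congr1 (fun f => f u) h.
by rewrite scaleN1r => /eqP; rewrite addrC subr_eq0 => /eqP.
Qed.

Lemma pi_monomial (p : pat_pair N) : lat (ppl p) = L ->
  pi (monomial a p) = ketbra (ket (ppl p)) (ket (ppr p)).
Proof. by have [_ _ h] := piP; exact: h. Qed.

Lemma pi_letters (xi zeta : pat N) : lat xi = L -> lat zeta = L ->
  pi (cre a (letters xi) * ann a (letters zeta)) = ketbra (ket xi) (ket zeta).
Proof.
move=> xiL zL; have e : lat xi = lat zeta by rewrite xiL zL.
by rewrite -(monomialE a (mkp e)) pi_monomial.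
Qed.

Lemma GI_letters (xi zeta : pat N) : lat xi = L -> lat zeta = L ->
  GI N (cre a (letters xi) * ann a (letters zeta)).
Proof.
move=> xiL zL; apply: (GI_normal L_delone A_CAR).
- exact: letters_word.
- exact: letters_word.
- by rewrite !size_letters.
- by rewrite size_letters.
Qed.

(** The parity of the relabelling is that of the reordering of the creators
    because both describe the same operator in the quotient. *)
Lemma cre_relabel (t : 'S_N) (xi : pat N) : lat xi = L ->
  cre a (letters xi) = (-1) ^+ t * cre a (letters (relabel t xi)).
Proof.
move=> xiL; have [|b bE] := cre_perm A_CAR (letters_word (xi := relabel t xi) xiL)
    (u := letters xi).
  apply: uniq_perm; rewrite ?letters_uniq// => x.
  apply/mapP/mapP => -[i _ ->]; first by exists (t i); rewrite ?mem_enum//= permK.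
  by exists (t^-1 i)%g; rewrite ?mem_enum.
(* the sign is read off from the image under pi *)
suff -> : (t : bool) = b by [].
have := pi_letters xiL xiL; rewrite bE -mulrA.
have -> : (-1) ^+ b * (cre a (letters (relabel t xi)) * ann a (letters xi)) =
    ((-1) ^+ b : R[i]) *: (cre a (letters (relabel t xi)) * ann a (letters xi)).
  by case: b {bE}; rewrite ?scale1r ?mul1r// mulN1r scaleN1r.
rewrite piZ; last exact: GI_letters.
rewrite pi_letters// => /(congr1 (fun f => inner (ket xi) (f (ket xi)))).
rewrite /ketbra !innerZr (ket_relabel ket_fermi)// innerZr (ket_norm ket_fermi)//.
rewrite !mul1r mulr1 -signr_addb; case: (t : bool) b {bE} => -[] //=.
  by rewrite expr1 => /eqP; rewrite -subr_eq0 -opprD oppr_eq0 (_ : 1 + 1 = 2%:R)// pnatr_eq0.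
by rewrite expr1 => /eqP; rewrite -subr_eq0 -opprD oppr_eq0 (_ : 1 + 1 = 2%:R)// pnatr_eq0.
Qed.

Lemma pi_unmatched n (p' : pat_pair n) (p : pat_pair N) i : lat (ppl p') = L ->
  lat (ppl p) = L -> lab (ppr p') i \notin letters (ppl p) ->
  pi (monomial a p' * monomial a p) = (fun=> 0).
Proof.
move=> p'L pL h; apply: pi_eq0; rewrite !monomialE !mulrA.
have p'L' : lat (ppr p') = L by rewrite -pp_lat.
have pL' : lat (ppr p) = L by rewrite -pp_lat.
have := @GI_unmatched _ _ _ _ _ _ _ L_delone A_CAR (letters (ppl p')) (letters (ppr p'))
  (letters (ppl p)) (letters (ppr p)) (lab (ppr p') i).
rewrite !size_letters; apply => //; try exact: letters_word.
exact: mem_letters.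
Qed.

End Sector.

Section Split.
Context (n m : nat).
Local Notation N := (n + m)%N.

Lemma prefix_inj (xi : pat N) : injective (fun i : 'I_n => lab xi (lshift m i)).
Proof. by move=> i j /lab_inj /lshift_inj. Qed.

Definition prefix_pat (xi : pat N) : pat n :=
  Pattern (lat_delone xi) (@prefix_inj xi) (fun i => lab_lat xi _).

Definition suffix_lab (xi : pat N) (j : 'I_m) : E := lab xi (rshift n j).

Lemma enum_split_ord :
  enum 'I_N = map (lshift m) (enum 'I_n) ++ map (@rshift n m) (enum 'I_m).
Proof.
apply: (inj_map val_inj); rewrite val_enum_ord map_cat iotaD add0n.
congr (_ ++ _); first by rewrite -map_comp -val_enum_ord; apply: eq_map.
rewrite -[in LHS](addn0 n) iotaDl -val_enum_ord -!map_comp.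
exact: eq_map.
Qed.

Definition suffix_word (xi : pat N) := [seq suffix_lab xi j | j <- enum 'I_m].

Lemma letters_split (xi : pat N) :
  letters xi = letters (prefix_pat xi) ++ suffix_word xi.
Proof.
rewrite /letters enum_split_ord map_cat.
by congr (_ ++ _); rewrite -[LHS]map_comp; apply: eq_map.
Qed.

Lemma split_eq (xi zeta : pat N) : lat xi = lat zeta ->
  prefix_pat xi = prefix_pat zeta -> suffix_lab xi =1 suffix_lab zeta -> xi = zeta.
Proof.
move=> e ep es; apply: letters_eq => //; rewrite !letters_split ep; congr (_ ++ _).
exact: eq_map.
Qed.

Context (H : hilbertType R) (ket : pat N -> H).
Hypothesis ket_fermi : is_fermi_space L ket.

Definition glued (xi' : pat n) (xi eta : pat N) :=
  [/\ lat eta = L, prefix_pat eta = xi' & suffix_lab eta =1 suffix_lab xi].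

(** The ket of the pattern with first labels xi' and the last labels of xi;
    by Pauli exclusion it vanishes when these points are not distinct. *)
Definition glued_ket (xi' : pat n) (xi : pat N) : H :=
  if pselect (exists eta, glued xi' xi eta) is left e then ket (projT1 (cid e)) else 0.

Lemma glued_ketE xi' xi eta : glued xi' xi eta -> glued_ket xi' xi = ket eta.
Proof.
move=> g; rewrite /glued_ket; case: pselect => [e|]; last by case; exists eta.
case: cid => zeta [zL zp zs] /=; case: g => eL ep es.
by congr ket; apply: split_eq => [||j]; rewrite ?zL ?zp// zs es.
Qed.

Lemma glued_ket0 xi' xi : ~ (exists eta, glued xi' xi eta) -> glued_ket xi' xi = 0.
Proof. by rewrite /glued_ket; case: pselect. Qed.

Context (pi : A -> H -> H) (piP : is_quotient_map L ket a pi).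

Lemma suffix_word_word (xi : pat N) : lat xi = L -> word L (suffix_word xi).
Proof. by move=> xiL x /mapP[j _ ->]; rewrite -xiL; exact: lab_lat. Qed.

(** The first points of the relabelled pattern are annihilated and replaced,
    while the others are spectators. *)
Lemma pi_matched (p' : pat_pair n) (p : pat_pair N) (t : 'S_N) :
  lat (ppl p') = L -> lat (ppl p) = L ->
  ppr p' = prefix_pat (relabel t (ppl p)) ->
  pi (monomial a p' * monomial a p) =
  ketbra ((-1) ^+ t *: glued_ket (ppl p') (relabel t (ppl p))) (ket (ppr p)).
Proof.
move=> p'L pL e; set xi := relabel t (ppl p) in e *.
have xiL : lat xi = L by [].
have pL' : lat (ppr p) = L by rewrite -pp_lat.
have wxi : word L (letters xi) by exact: letters_word.
have wp' : word L (letters (ppl p')) by exact: letters_word.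
have wp : word L (letters (ppr p)) by exact: letters_word.
pose X := cre a (letters (ppl p') ++ suffix_word xi) * ann a (letters (ppr p)).
pose Y := cre a (letters (ppl p')) * ann a (letters (prefix_pat xi)) *
  cre a (letters xi) * ann a (letters (ppr p)).
have sz : size (letters (ppl p') ++ suffix_word xi) = N.
  by rewrite size_cat size_letters size_map size_enum_ord.
have GX : GI N X.
  apply: (GI_normal L_delone A_CAR) => //.
  - by apply/word_cat; split=> //; exact: suffix_word_word.
  - by rewrite sz size_letters.
  - by rewrite sz.
have h1 : word L (letters (prefix_pat xi) ++ suffix_word xi) by rewrite -letters_split.
have h2 : uniq (letters (prefix_pat xi) ++ suffix_word xi).
  by rewrite -letters_split; exact: letters_uniq.
have h3 : (size (letters (ppl p')) + size (suffix_word xi) = size (letters (ppr p)))%N.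
  by rewrite !size_letters size_map size_enum_ord.
have YX : GI N.+1 (Y - X).
  have := GI_contract L_delone A_CAR wp' h1 wp h2 h3.
  by rewrite (size_letters (ppr p)) -letters_split.
have GY : GI N Y.
  by have := GID (GI_leq (leqnSn N) YX) GX; rewrite subrK.
have -> : monomial a p' * monomial a p = ((-1) ^+ t : R[i]) *: Y.
  rewrite !monomialE e (cre_relabel ket_fermi piP t pL) -/xi.
  rewrite -!mulrA !sign_mulCA /Y -!mulrA.
  by case: (t : bool); rewrite ?scale1r ?mul1r// mulN1r scaleN1r.
rewrite (piZ piP)// (pi_eq piP GY GX YX).
have [[eta g]|ng] := pselect (exists eta, glued (ppl p') xi eta).
  rewrite (glued_ketE g); have [eL ep es] := g.
  have -> : X = cre a (letters eta) * ann a (letters (ppr p)).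
    by rewrite letters_split ep /X; congr (cre a (_ ++ _) * _); apply: eq_map => j; rewrite es.
  rewrite (pi_letters piP)//; apply/funext => u.
  by rewrite /ketbra !scalerA mulrC.
rewrite (glued_ket0 ng) scaler0.
have -> : X = 0.
  rewrite /X (cre_dup A_CAR) ?mul0r//.
    by apply/word_cat; split=> //; exact: suffix_word_word.
  apply/negP => uw; apply: ng.
  have [|eta [eL eE]] := word_pattern L_delone sz uw.
    by apply/word_cat; split=> //; exact: suffix_word_word.
  move: eE; rewrite letters_split => /eqP; rewrite eqseq_cat ?size_letters//.
  move=> /andP[/eqP e1 /eqP e2]; exists eta; split=> //.
    by apply: letters_eq => //; rewrite /= eL p'L.
  move=> j; move/eq_in_map: e2; apply; exact: mem_enum.
by rewrite (pi0 piP); apply/funext => u; rewrite /ketbra !scaler0.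
Qed.

Definition same_prefix (t t' : 'S_N) :=
  [forall i : 'I_n, (t^-1)%g (lshift m i) == (t'^-1)%g (lshift m i)].

(** Each way of matching a pattern with the beginning of a relabelling is
    obtained once for every ordering of the remaining points. *)
Definition prefix_weight (t : 'S_N) : R[i] :=
  (#|[pred t' | same_prefix t t']|%:R)^-1.

Lemma same_prefixP (xi : pat N) (t t' : 'S_N) :
  reflect (prefix_pat (relabel t xi) = prefix_pat (relabel t' xi)) (same_prefix t t').
Proof.
apply: (iffP forallP) => [h|e i].
  by apply: pattern_eq => // i /=; rewrite (eqP (h i)).
apply/eqP/(@lab_inj _ _ _ _ _ xi).
exact: (congr1 (fun z : pat n => lab z i) e).
Qed.

Definition prefix_matches (xi' : pat n) (xi : pat N) (t : 'S_N) : bool :=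
  `[< xi' = prefix_pat (relabel t xi) >].

Lemma sum_weight (xi' : pat n) (xi : pat N) (t0 : 'S_N) : prefix_matches xi' xi t0 ->
  \sum_(t | prefix_matches xi' xi t) prefix_weight t = 1.
Proof.
move=> /asboolP e0.
have mE t : prefix_matches xi' xi t = same_prefix t0 t.
  by apply/asboolP/(same_prefixP xi) => [<-//|<-].
rewrite (eq_bigr (fun=> prefix_weight t0)) => [|t mt]; last first.
  move: mt; rewrite mE => /(same_prefixP xi) e.
  rewrite /prefix_weight (@eq_card _ _ [pred t' | same_prefix t0 t'])// => t'.
  by rewrite !inE; apply/(same_prefixP xi)/(same_prefixP xi); rewrite e.
rewrite sumr_const (_ : #|_| = #|[pred t' | same_prefix t0 t']|); last first.
  by apply: eq_card => t; exact: mE.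
rewrite -mulr_natl mulfV// pnatr_eq0 -lt0n; apply/card_gt0P; exists t0.
by rewrite inE; apply/(same_prefixP xi).
Qed.

(** The ket that results from applying the monomial of p' to the ket of xi: a
    sum over the ways to find the annihilated points among those of xi, each
    way being weighted to count once. *)
Definition theta (p' : pat_pair n) (xi : pat N) : H :=
  \sum_(t : 'S_N | prefix_matches (ppr p') xi t)
    prefix_weight t *: ((-1) ^+ t *: glued_ket (ppl p') (relabel t xi)).

Lemma match_ex (xi' : pat n) (xi : pat N) : lat xi' = lat xi ->
  (forall i, lab xi' i \in letters xi) -> exists t, prefix_matches xi' xi t.
Proof.
move=> e sub; pose rest := [seq x <- letters xi | x \notin letters xi'].
have pw : perm_eq (letters xi' ++ rest) (letters xi).
  apply: uniq_perm; [|exact: letters_uniq|].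
    rewrite cat_uniq letters_uniq filter_uniq ?letters_uniq// andbT /=.
    by apply/hasPn => x; rewrite mem_filter => /andP[].
  move=> x; rewrite mem_cat mem_filter; have [xx|//] := boolP (x \in letters xi').
  by rewrite /=; apply/esym; move: xx => /mapP[i _ ->]; exact: sub.
move: (pw); rewrite {2}/letters.
have -> : [seq lab xi i | i <- enum 'I_N] = [tuple lab xi i | i < N] by [].
move/tuple_permP => [s sE]; exists s^-1%g; apply/asboolP.
apply: letters_eq => //.
have : letters xi' ++ rest = letters (relabel s^-1%g xi).
  by rewrite sE /letters /=; apply: eq_map => i /=; rewrite tnth_mktuple invgK.
rewrite letters_split => /eqP; rewrite eqseq_cat ?size_letters//.
by move=> /andP[/eqP].
Qed.

(** Left multiplication by a monomial acts on the first factor of the rank one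
    operators. *)
Lemma pi_theta (p' : pat_pair n) (p : pat_pair N) :
  lat (ppl p') = L -> lat (ppl p) = L ->
  pi (monomial a p' * monomial a p) = ketbra (theta p' (ppl p)) (ket (ppr p)).
Proof.
move=> p'L pL; have [|nsub] := pselect (forall i, lab (ppr p') i \in letters (ppl p)).
  move=> /match_ex[|t0 mt0]; first by rewrite -pp_lat p'L.
  transitivity (fun u => \sum_(t | prefix_matches (ppr p') (ppl p) t)
      prefix_weight t *: pi (monomial a p' * monomial a p) u).
    by apply/funext => u; rewrite -scaler_suml (sum_weight mt0) scale1r.
  apply/funext => u; rewrite /ketbra /theta scaler_sumr; apply: eq_bigr => t /asboolP mt.
  by rewrite (pi_matched p'L pL mt) /ketbra !scalerA (mulrC (prefix_weight t)).
have [i iN] : exists i, lab (ppr p') i \notin letters (ppl p).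
  apply: contrapT => h; apply: nsub => i; apply: contrapT => /negP iN; apply: h.
  by exists i.
rewrite (pi_unmatched piP p'L pL iN) /theta big1 => [|t /asboolP mt].
  by apply/funext => u; rewrite /ketbra scaler0.
exfalso; move: iN; rewrite mt /= => /negP; apply.
exact: mem_letters.
Qed.

End Split.
End QuotientMap.

(** * Operators implementing the derivations *)

Section CNormLimit.
Context (R : realType) (A : cstarAlgType R).

Lemma cnormN (x : A) : cnorm (- x) = cnorm x.
Proof.
apply: complexI; rewrite -scaleN1r cnormZ normrN normr1 mul1r; by [].
Qed.

Lemma cnorm0 : cnorm (0 : A) = 0.
Proof. by apply: complexI; rewrite -[X in cnorm X](scale0r 0) cnormZ normr0 mul0r. Qed.

Lemma cnorm_ge0 (x : A) : 0 <= cnorm x.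
Proof. by have := cnormD x (- x); rewrite subrr cnorm0 cnormN; lra. Qed.

Lemma eventually_lim (s : nat -> A) (c y : A) (k0 : nat) :
  (forall k, (k0 <= k)%N -> s k = c) -> s @ \oo --> y -> y = c.
Proof.
move=> sc sy; apply/eqP; rewrite -subr_eq0; apply/eqP/cnorm_eq0/le_anti.
rewrite cnorm_ge0 andbT; apply/ler_addgt0Pl => e e0; rewrite addr0.
have : nbhs y [set z | cnorm (z - y) < e] by apply/cnorm_nbhs; exists e.
move=> /sy [k1 _ h]; have := h (maxn k0 k1) (leq_maxr _ _).
rewrite /= sc ?leq_maxl// => h'; rewrite -cnormN opprB; exact: ltW.
Qed.

End CNormLimit.

Section Implementers.
Context (R : realType) (d : nat) (r rho : R).
Hypothesis r0 : 0 < r.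
Local Notation E := 'rV[R]_d.
Local Notation pat n := (pattern d r rho n).
Local Notation pat_pair n := (@pat_pair R d r rho n).
Context (A : cstarAlgType R) (a : E -> A) (L : set E).
Hypotheses (L_delone : delone r rho L) (A_CAR : is_CAR a L).
Context (Lk : nat -> set E) (Lk_exhausts : exhausts L Lk).
Local Notation GI := (@GI R d r rho A a L).

Lemma exhaust_word (s : seq E) : word L s ->
  exists k0, forall k, (k0 <= k)%N -> forall x, x \in s -> Lk k x.
Proof.
have [_ mono cover] := Lk_exhausts.
have mono' k l : (k <= l)%N -> Lk k `<=` Lk l.
  elim: l => [|l IH]; first by rewrite leqn0 => /eqP ->.
  by rewrite leq_eqVlt => /orP[/eqP->//|/IH h]; apply: subset_trans (mono l).
elim: s => [|x s IH]; first by exists 0%N.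
move=> /word_cons[Lx /IH[k1 h1]].
have [k2 _ h2] : (\bigcup_k Lk k) x by rewrite cover.
exists (maxn k1 k2) => k; rewrite geq_max => /andP[kk1 kk2] y.
rewrite inE => /orP[/eqP->|]; last exact: h1.
exact: (mono' _ _ kk2).
Qed.

Lemma cstar_generated_word (S : set E) (u : seq E) : (forall x, x \in u -> S x) ->
  cstar_generated (a @` S) (cre a u).
Proof.
move=> uS W cW W1 Wl WM Wst WS; elim: u uS => [|x u IH] uS //=.
apply: WM; last by apply: IH => y yu; apply: uS; rewrite inE yu orbT.
by apply: Wst; apply: WS; exists x => //; apply: uS; rewrite mem_head.
Qed.

Lemma local_monomial n (p : pat_pair n) : lat (ppl p) = L ->
  local_algebra a Lk (monomial a p).
Proof.
move=> pL; have [|k0 h] := @exhaust_word (letters (ppl p) ++ letters (ppr p)).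
  by apply/word_cat; split; apply: letters_word => //; rewrite -pp_lat.
have hl : cstar_generated (a @` Lk k0) (cre a (letters (ppl p))).
  by apply: cstar_generated_word => x xu; apply: (h k0) => //; rewrite mem_cat xu.
have hr : cstar_generated (a @` Lk k0) (cre a (letters (ppr p))).
  by apply: cstar_generated_word => x xu; apply: (h k0) => //; rewrite mem_cat xu orbT.
exists k0; rewrite monomialE => W cW W1 Wl WM Wst WS; apply: (WM); first exact: hl.
by rewrite -star_cre; apply: (Wst); exact: hr.
Qed.

Section Coefficient.
Context (n : nat) (q : pat_pair n.+1 -> R[i]) (cq : compact_kernel q).

Definition support_in (k : nat) : set (pat_pair n.+1) := [set p |
  [/\ lat (ppl p) = L, points (ppl p) `<=` Lk k & points (ppr p) `<=` Lk k]].

Lemma support_in_finite k : finite_set (support_in k).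
Proof.
have [fin _ _] := Lk_exhausts.
apply: (sub_finite_set _ (@finite_pairs_in _ _ r rho n.+1 L _ (fin k))).
by move=> p [pL h1 h2]; split=> // i; split; [apply: h1|apply: h2]; exists i.
Qed.

(** Only these terms of Q can fail to commute with the words in the letters of
    s. *)
Definition touching (s : seq E) : set (pat_pair n.+1) := [set p |
  [/\ lat (ppl p) = L, q p <> 0 & exists2 x, x \in s &
     (x \in letters (ppl p)) || (x \in letters (ppr p))]].

Lemma mem_le_sum (s : seq E) x : x \in s -> enorm x <= \sum_(y <- s) enorm y.
Proof.
move=> xs; rewrite (big_rem x)//= lerDl sumr_ge0// => y _; exact: enorm_ge0.
Qed.

Lemma touching_bounded (s : seq E) : exists B : R, forall p, touching s p ->
  forall i, enorm (lab (ppl p) i) <= B /\ enorm (lab (ppr p) i) <= B.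
Proof.
have [M MP] := compact_kernel_range r0 cq.
exists (\sum_(y <- s) enorm y + 2 * M) => p [pL qp [x /mem_le_sum xs xp]].
have h := MP p qp; set c := lab (ppr p) ord0 in h.
have cB : enorm c <= \sum_(y <- s) enorm y + M.
  have xc : enorm (x - c) <= M.
    by case/orP: xp => /mapP[i _ ->]; have [] := h i.
  by have := enorm_triangle c x; rewrite enormBC; lra.
move=> i; have [h1 h2] := h i; split.
  by have := enorm_triangle (lab (ppl p) i) c; lra.
by have := enorm_triangle (lab (ppr p) i) c; lra.
Qed.

(** The range of the coefficient confines these terms to a bounded region. *)
Lemma touching_finite (s : seq E) : finite_set (touching s).
Proof.
have [B BP] := touching_bounded s.
apply: (sub_finite_set _ (@finite_pairs_in _ _ r rho n.+1 L _
  (delone_finite B r0 L_delone))).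
move=> p tp; have [pL _ _] := tp; split=> // i; have [h1 h2] := BP p tp i.
split; split=> //; first by rewrite -pL; exact: lab_lat.
by rewrite -pL pp_lat; exact: lab_lat.
Qed.

Lemma touching_exhausted (s : seq E) :
  exists k0, forall k, (k0 <= k)%N -> touching s `<=` support_in k.
Proof.
have [B BP] := touching_bounded s.
have [u uE] := (finite_seqP _).1 (delone_finite B r0 L_delone).
have uP x : L x -> enorm x <= B -> x \in u.
  by move=> Lx xB; have : [set x | L x /\ enorm x <= B] x by []; rewrite uE.
have [|k0 k0P] := @exhaust_word u.
  move=> x xu; have : [set` u] x by []. rewrite -uE; by case.
exists k0 => k kk p tp; have [pL _ _] := tp; split=> //.
  move=> _ [i _ <-]; apply: (k0P k kk); apply: uP; last by have [] := BP p tp i.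
  by rewrite -pL; exact: lab_lat.
move=> _ [i _ <-]; apply: (k0P k kk); apply: uP; last by have [] := BP p tp i.
by rewrite -pL pp_lat; exact: lab_lat.
Qed.

Local Notation Q k := (truncation a L q (Lk k)).

Lemma truncationE k : Q k = (n.+1`!%:R^-1 : R[i]) *:
  \sum_(p <- fset_set (support_in k)) q p *: monomial a p.
Proof. by rewrite /truncation fsbig_finite//; exact: support_in_finite. Qed.

(** The finitely many touching terms are eventually all included. *)
Lemma sum_stable (V : lmodType R[i]) (s : seq E) (f : pat_pair n.+1 -> V) :
  (forall p, lat (ppl p) = L -> q p *: f p <> 0 -> touching s p) ->
  exists k0, forall k, (k0 <= k)%N ->
    \sum_(p <- fset_set (support_in k)) q p *: f p =
    \sum_(p <- fset_set (touching s)) q p *: f p.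
Proof.
move=> h; have [k0 k0P] := touching_exhausted s; exists k0 => k kk.
rewrite -!fsbig_finite; [|exact: touching_finite|exact: support_in_finite].
apply/esym/fsbig_widen => [|p [[pL _ _] nt]]; first exact: k0P.
by apply: contrapT => fp; apply: nt; exact: h.
Qed.

Section Sector.
Context (N : nat) (H : hilbertType R) (ket : pat N -> H).
Hypothesis ket_fermi : is_fermi_space L ket.
Context (pi : A -> H -> H) (piP : is_quotient_map L ket a pi).
Context (theta : pat_pair n.+1 -> pat N -> H).
Hypothesis thetaP : forall (p' : pat_pair n.+1) (p : pat_pair N),
  lat (ppl p') = L -> lat (ppl p) = L ->
  pi (monomial a p' * monomial a p) = ketbra (theta p' (ppl p)) (ket (ppr p)).
Hypothesis theta0 : forall (p' : pat_pair n.+1) (xi : pat N),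
  theta p' xi <> 0 -> forall i, lab (ppr p') i \in letters xi.

(** Terms without common points commute. *)
Lemma commutator_stable (p0 : pat_pair N) : lat (ppl p0) = L ->
  exists k0, exists C, forall k, (k0 <= k)%N ->
    monomial a p0 * Q k - Q k * monomial a p0 = C.
Proof.
move=> p0L; pose s := letters (ppl p0) ++ letters (ppr p0).
pose f (p : pat_pair n.+1) := monomial a p0 * monomial a p - monomial a p * monomial a p0.
have [p pL fp|k0 h] := @sum_stable _ s f.
  split=> //; first by move=> qp; apply: fp; rewrite qp scale0r.
  apply: contrapT => nt; apply: fp; rewrite /f !monomialE (words_comm A_CAR) ?subrr ?scaler0//.
  - by apply: letters_word; rewrite -?pp_lat.
  - by apply: letters_word; rewrite -?pp_lat.
  - by rewrite !size_letters.
  - by apply: letters_word; rewrite -?pp_lat.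
  - by apply: letters_word; rewrite -?pp_lat.
  - move=> x xu; apply/negP => xv; apply: nt; exists x; last by rewrite xv orbT.
    by rewrite mem_cat xu.
  - move=> x xu; apply/negP => xv; apply: nt; exists x; last by rewrite xv.
    by rewrite mem_cat xu orbT.
exists k0, (n.+1`!%:R^-1 *: \sum_(p <- fset_set (touching s)) q p *: f p).
move=> k /h <-; rewrite truncationE -scalerAr -scalerAl -scalerBr; congr (_ *: _).
rewrite mulr_sumr mulr_suml -sumrB; apply: eq_bigr => p _.
by rewrite -scalerAr -scalerAl -scalerBr.
Qed.

Definition column k (xi : pat N) : H := n.+1`!%:R^-1 *:
  \sum_(p <- fset_set (support_in k)) q p *: theta p xi.

(** The formal operator Q applied to a ket, as a finite sum. *)
Definition limit_column (xi : pat N) : H := n.+1`!%:R^-1 *: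
  \sum_(p <- fset_set (touching (letters xi))) q p *: theta p xi.

Lemma theta_touching (xi : pat N) p : lat (ppl p) = L -> q p *: theta p xi <> 0 ->
  touching (letters xi) p.
Proof.
move=> pL h; split=> //; first by move=> qp; apply: h; rewrite qp scale0r.
have tn : theta p xi <> 0 by move=> t0; apply: h; rewrite t0 scaler0.
by exists (lab (ppr p) ord0); [exact: theta0|rewrite mem_letters orbT].
Qed.

Lemma column_stable (xi : pat N) :
  exists k0, forall k, (k0 <= k)%N -> column k xi = limit_column xi.
Proof.
have [k0 h] := sum_stable (@theta_touching xi).
by exists k0 => k /h e; rewrite /column e.
Qed.

Lemma GI_term k (p0 : pat_pair N) (p : pat_pair n.+1) : lat (ppl p0) = L -> p \in fset_set (support_in k) ->
  GI N (monomial a p * monomial a p0).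
Proof.
move=> p0L; rewrite in_fset_set; last exact: support_in_finite.
by move=> /set_mem[pL _ _]; apply: (GI_product L_delone A_CAR).
Qed.

Lemma GI_sum_seq (s : seq (pat_pair n.+1)) (f : pat_pair n.+1 -> A) :
  (forall p, p \in s -> GI N (f p)) -> GI N (\sum_(p <- s) f p).
Proof.
elim: s => [|p s IH] h; first by rewrite big_nil; move=> W.
rewrite big_cons; apply: GID; first by apply: h; rewrite mem_head.
by apply: IH => p' p's; apply: h; rewrite inE p's orbT.
Qed.

Lemma pi_sum_seq (s : seq (pat_pair n.+1)) (f : pat_pair n.+1 -> A) :
  (forall p, p \in s -> GI N (f p)) ->
  pi (\sum_(p <- s) f p) = (fun u => \sum_(p <- s) pi (f p) u).
Proof.
elim: s => [|p s IH] h.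
  by rewrite big_nil (pi0 piP); apply/funext => u; rewrite big_nil.
rewrite big_cons -[f p]scale1r (pi_lin piP); last 2 first.
- by apply: h; rewrite mem_head.
- by apply: GI_sum_seq => p' p's; apply: h; rewrite inE p's orbT.
rewrite IH; last by move=> p' p's; apply: h; rewrite inE p's orbT.
by apply/funext => u; rewrite big_cons scale1r.
Qed.

Lemma GI_left k (p0 : pat_pair N) : lat (ppl p0) = L -> GI N (Q k * monomial a p0).
Proof.
move=> p0L; rewrite truncationE -scalerAl; apply: GIZ; rewrite mulr_suml.
apply: GI_sum_seq => p pk; rewrite -scalerAl; apply: GIZ; exact: GI_term pk.
Qed.

Lemma pi_left k (p0 : pat_pair N) : lat (ppl p0) = L ->
  pi (Q k * monomial a p0) = ketbra (column k (ppl p0)) (ket (ppr p0)).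
Proof.
move=> p0L; rewrite truncationE -scalerAl mulr_suml.
have Gt (p : pat_pair n.+1) : p \in fset_set (support_in k) -> GI N (q p *: monomial a p * monomial a p0).
  by move=> pk; rewrite -scalerAl; apply: GIZ; exact: GI_term pk.
rewrite (piZ piP); last exact: GI_sum_seq.
rewrite pi_sum_seq//; apply/funext => u.
rewrite /ketbra /column scalerA mulrC -scalerA; congr (_ *: _).
rewrite scaler_sumr; apply: eq_big_seq => p pk.
rewrite -scalerAl (piZ piP); last exact: GI_term pk.
rewrite thetaP//; last first.
  by move: pk; rewrite in_fset_set; [move=> /set_mem[]|exact: support_in_finite].
by rewrite /ketbra !scalerA mulrC.
Qed.

Lemma star_monomial m (p : pat_pair m) : star (monomial a p) = monomial a (flip p).
Proof. by rewrite !monomialE starM star_ann star_cre. Qed.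

Lemma flipK m : involutive (@flip R d r rho m).
Proof. by move=> p; apply: pat_pair_eq. Qed.

Lemma GI_star m (x : A) : GI m x -> GI m (star x).
Proof.
move=> hx W cW W0 Wl WS.
apply: (hx (star @^-1` W)).
- by apply: closed_comp => // y _; exact: star_continuous.
- by rewrite /= star0.
- by move=> c u v Wu Wv; rewrite /= starD starZ; exact: Wl.
- move=> _ [k [p [mk pL ->]]]; rewrite /= star_monomial; apply: WS.
  by exists k, (flip p); split=> //; rewrite /= -pp_lat.
Qed.

Lemma pi_star (x : A) (u v : H) : GI N x -> pi x = ketbra u v ->
  pi (star x) = ketbra v u.
Proof.
move=> hx e; have [_ [_ _ h] _] := piP; apply/funext => w; apply: inner_injl => z.
rewrite h// e /ketbra innerZr innerZl mulrC; congr (_ * _).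
by rewrite -inner_conj.
Qed.

(** Obtained from the left multiplication by taking adjoints. *)
Lemma right_term k (p0 : pat_pair N) (p : pat_pair n.+1) : lat (ppl p0) = L ->
  p \in fset_set (support_in k) -> GI N (monomial a p0 * monomial a p) /\
  pi (monomial a p0 * monomial a p) =
    ketbra (ket (ppl p0)) (theta (flip p) (ppr p0)).
Proof.
move=> p0L; rewrite in_fset_set; last exact: support_in_finite.
move=> /set_mem[pL _ _].
have fpL : lat (ppl (flip p)) = L by rewrite /= -pp_lat.
have fp0L : lat (ppl (flip p0)) = L by rewrite /= -pp_lat.
have -> : monomial a p0 * monomial a p = star (monomial a (flip p) * monomial a (flip p0)).
  by rewrite starM !star_monomial !flipK.
have G : GI N (monomial a (flip p) * monomial a (flip p0)).
  exact: (GI_product L_delone A_CAR).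
by split; [exact: GI_star|apply: pi_star => //; rewrite thetaP].
Qed.

Definition row k (zeta : pat N) : H := n.+1`!%:R^-1 *:
  \sum_(p <- fset_set (support_in k)) (q p)^* *: theta (flip p) zeta.

Lemma GI_right k (p0 : pat_pair N) : lat (ppl p0) = L -> GI N (monomial a p0 * Q k).
Proof.
move=> p0L; rewrite truncationE -scalerAr; apply: GIZ; rewrite mulr_sumr.
apply: GI_sum_seq => p pk; rewrite -scalerAr; apply: GIZ.
by have [] := right_term p0L pk.
Qed.

Lemma pi_right k (p0 : pat_pair N) : lat (ppl p0) = L ->
  pi (monomial a p0 * Q k) = ketbra (ket (ppl p0)) (row k (ppr p0)).
Proof.
move=> p0L; rewrite truncationE -scalerAr mulr_sumr.
have Gt (p : pat_pair n.+1) : p \in fset_set (support_in k) -> GI N (monomial a p0 * (q p *: monomial a p)).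
  by move=> pk; rewrite -scalerAr; apply: GIZ; have [] := right_term p0L pk.
rewrite (piZ piP); last exact: GI_sum_seq.
rewrite pi_sum_seq//; apply/funext => u.
rewrite /ketbra /row innerZl rmorphV ?unitfE ?pnatr_eq0 -?lt0n ?fact_gt0// rmorph_nat.
rewrite -scalerA; congr (_ *: _); rewrite inner_suml scaler_suml.
apply: eq_big_seq => p pk; have [G e] := right_term p0L pk.
rewrite -scalerAr (piZ piP)// e /ketbra innerZl conjCK.
by rewrite scalerA.
Qed.

(** On the rank one operators |xi><z0| with z0 fixed, the derivation is the
    commutator with B and, by the contractions, also with the formal operator
    Q. Evaluation at the ket of z0 shows that B - Q multiplies the ket of xi
    by a number cc, which depends on z0 only. *)
Lemma implementer_columns (B : H -> H) (delta : (H -> H) -> H -> H) :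
  bounded_op B ->
  (forall x, GI N x -> local_algebra a Lk x ->
      exists2 y, ad_lim a L Lk q x y & GI N y /\ delta (pi x) = pi y) ->
  (forall T, compact_op T -> delta T = (fun u => 'i *: (T (B u) - B (T u)))) ->
  exists c : R[i], forall xi, lat xi = L ->
    B (ket xi) = limit_column xi + c *: ket xi.
Proof.
move=> bB dP dB.
have [[z0 z0L]|nz] := pselect (exists z : pat N, lat z = L); last first.
  by exists 0 => xi xiL; case: nz; exists xi.
(* for large k this is the scalar <z0, (B - Q) z0> *)
pose cc k := inner (ket z0) (B (ket z0)) - inner (row k z0) (ket z0).
have step xi : lat xi = L -> exists k0, forall k, (k0 <= k)%N ->
    B (ket xi) = limit_column xi + cc k *: ket xi.
  move=> xiL; have e0 : lat xi = lat z0 by rewrite xiL z0L.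
  pose p0 := mkp e0; have p0L : lat (ppl p0) = L by [].
  have [k1 [C CP]] := commutator_stable p0L.
  have [k2 k2P] := column_stable xi.
  exists (maxn k1 k2) => k; rewrite geq_max => /andP[kk1 kk2].
  have Gx : GI N (monomial a p0) by exact: GI_monomial.
  have [y ylim [Gy dy]] := dP _ Gx (local_monomial p0L).
  have yE : y = 'i *: (monomial a p0 * Q k - Q k * monomial a p0).
    by apply: (@eventually_lim _ _ _ _ _ k1 _ ylim) => l l1; rewrite !CP.
  have cx : compact_op (pi (monomial a p0)).
    by have [[h _ _] _ _] := piP; exact: h.
  have iN : ('i : R[i]) != 0 by rewrite neq0Ci.
  move: (dB _ cx); rewrite dy yE (piZ piP); last first.
    apply: GID; [exact: GI_right|apply: GIN; exact: GI_left].
  rewrite addrC -scaleN1r (pi_lin piP); [|exact: GI_left|exact: GI_right].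
  rewrite pi_left// pi_right// (pi_monomial piP)//.
  move/(congr1 (fun f => f (ket z0))) => /(scalerI iN).
  rewrite /ketbra /= (ket_norm ket_fermi)// !scale1r scaleN1r k2P// => h.
  rewrite /cc scalerBl -[LHS](subKr (inner (ket z0) (B (ket z0)) *: ket xi)) -h.
  by rewrite opprD opprK addrCA.
have [k0 k0P] := step z0 z0L.
exists (cc k0) => xi xiL; have [k1 k1P] := step xi xiL.
rewrite (k1P (maxn k0 k1)) ?leq_maxr//; congr (_ + _ *: _).
have := k0P _ (leq_maxl k0 k1); rewrite {1}(k0P k0 (leqnn _)) => /addrI.
move/(congr1 (inner (ket z0))); rewrite !innerZr (ket_norm ket_fermi)// !mulr1.
by move=> ->.
Qed.

End Sector.
End Coefficient.
End Implementers.

(** * Second quantization of a coefficient *)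

Section LocalKernels.
Context (R : realType) (d : nat) (r rho : R).
Hypothesis r0 : 0 < r.
Local Notation E := 'rV[R]_d.
Local Notation pat n := (pattern d r rho n).
Local Notation pat_pair n := (@pat_pair R d r rho n).

Lemma local_kernel_relabel n (k : pat_pair n -> R[i]) (s t : 'S_n) :
  local_kernel k -> local_kernel (fun p => k (prelabel s t p)).
Proof.
move=> [cont inv [M MP]]; split.
- move=> p; have c := @prelabel_continuous _ _ _ rho r0 n s t p.
  exact: (continuous_comp c (cont _)).
- by move=> x p; rewrite prelabel_translate inv.
exists M => p /MP[h1 h2]; split=> i.
  by have [j] := h1 (s i); rewrite /= permK => h; exists (t^-1 j)%g.
by have [j] := h2 (t i); rewrite /= permK => h; exists (s^-1 j)%g.
Qed.

Lemma local_kernelZ n (c : R[i]) (k : pat_pair n -> R[i]) :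
  local_kernel k -> local_kernel (fun p => c * k p).
Proof.
move=> [cont inv [M MP]]; split.
- move=> p; have := @cvgM R[i] _ (nbhs p) _ (fun=> c) k c (k p).
  by apply; [exact: cvg_cst|exact: cont].
- by move=> x p; rewrite inv.
- exists M => p h; apply: MP => kp; apply: h; by rewrite kp mulr0.
Qed.

Lemma local_kernel_sum n (I : Type) (s : seq I) (k : I -> pat_pair n -> R[i]) :
  (forall i, local_kernel (k i)) -> local_kernel (fun p => \sum_(i <- s) k i p).
Proof.
move=> h; elim: s => [|i s [cont inv [M MP]]].
  split=> [p|x p|]; last by exists 0 => p; rewrite big_nil.
    have -> : (fun p => \sum_(i <- [::]) k i p) = (fun=> 0 : (R[i])^o).
      by apply/funext => p'; rewrite big_nil.
    exact: (@cvg_cst (R[i])^o 0 _ (nbhs p)).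
  by rewrite !big_nil.
have [ci ii [Mi MPi]] := h i; split.
- move=> p; rewrite (_ : (fun _ => _) = (fun p => k i p + \sum_(j <- s) k j p)).
    exact: (@cvgD R[i] (R[i])^o _ (nbhs p) _ (k i)
      (fun p => \sum_(j <- s) k j p) _ _ (ci p) (cont p)).
  by apply/funext => p'; rewrite big_cons.
- by move=> x p; rewrite !big_cons inv ii.
- exists (Num.max Mi M) => p; rewrite big_cons => hp.
  have [k0|k0] := eqVneq (k i p) 0.
    have [h1 h2] : (forall i0, exists j, enorm (lab (ppl p) i0 - lab (ppr p) j) <= M) /\
        (forall j, exists i0, enorm (lab (ppl p) i0 - lab (ppr p) j) <= M).
      by apply: MP => e; apply: hp; rewrite k0 e addr0.
    split=> j; [have [l hl] := h1 j|have [l hl] := h2 j]; exists l;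
      by rewrite le_max hl orbT.
  have [h1 h2] := MPi p (elimN eqP k0).
  split=> j; [have [l hl] := h1 j|have [l hl] := h2 j]; exists l; by rewrite le_max hl.
Qed.

Section Lift.
Context (n m : nat).
Local Notation N := (n.+1 + m)%N.
Context (q : pat_pair n.+1 -> R[i]) (cq : compact_kernel q).

Definition prefix_pair (p : pat_pair N) : pat_pair n.+1 :=
  @mkp _ _ _ _ _ (prefix_pat (ppl p)) (prefix_pat (ppr p)) (pp_lat p).

Definition same_suffix (p : pat_pair N) : bool :=
  `[< forall j, suffix_lab (ppl p) j = suffix_lab (ppr p) j >].

(** The coefficient acts on the first points, the other ones stay where they
    are. *)
Definition spectator (p : pat_pair N) : R[i] :=
  if same_suffix p then q (prefix_pair p) else 0.

Lemma prefix_cvg (T : Type) (Fl : set_system T) (f : T -> pat N) xi :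
  pat_cvg Fl f xi -> pat_cvg Fl (fun t => prefix_pat (f t)) (prefix_pat xi).
Proof. by move=> [h1 h2]; split=> [i|]; [exact: h1|exact: h2]. Qed.

Lemma prefix_pair_continuous : continuous prefix_pair.
Proof.
move=> p; apply/(@pat_pair_cvgP _ _ _ _ r0 _ (nbhs p)); split.
  exact: (prefix_cvg (pat_pair_cvgl r0 p)).
exact: (prefix_cvg (pat_pair_cvgr r0 p)).
Qed.

(** Coincidences between points of a common Delone set are locally constant,
    by uniform discreteness. *)
Lemma near_same_suffix (p0 : pat_pair N) :
  \forall p \near p0, same_suffix p = same_suffix p0.
Proof.
have cl := pat_pair_cvgl r0 p0; have cr := pat_pair_cvgr r0 p0.
have r2 : 0 < r / 2 by rewrite divr_gt0.
have near_l : \forall p \near p0, forall i, i \in enum 'I_N ->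
    enorm (lab (ppl p) i - lab (ppl p0) i) < r / 2.
  by apply: (@filter_all _ (nbhs p0) _ _ (fun i p =>
    enorm (lab (ppl p) i - lab (ppl p0) i) < r / 2)) => i _; exact: (cl.1 i _ r2).
have near_r : \forall p \near p0, forall i, i \in enum 'I_N ->
    enorm (lab (ppr p) i - lab (ppr p0) i) < r / 2.
  by apply: (@filter_all _ (nbhs p0) _ _ (fun i p =>
    enorm (lab (ppr p) i - lab (ppr p0) i) < r / 2)) => i _; exact: (cr.1 i _ r2).
apply: filterS (filterI near_l near_r) => p [hl hr].
apply/asboolP/asboolP => h j.
  apply: (delone_sep (lat_delone (ppl p0))); first exact: lab_lat.
    by rewrite pp_lat; exact: lab_lat.
  have := hl (rshift n.+1 j) (mem_enum _ _); have := hr (rshift n.+1 j) (mem_enum _ _).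
  have := h j; rewrite /suffix_lab => ->.
  rewrite (enormBC (lab (ppr p) _) (lab (ppl p0) _)) => h1 h2.
  apply: (le_trans (enormB_le _ (lab (ppr p) (rshift n.+1 j)) _)).
  by move: r0; lra.
apply: (delone_sep (lat_delone (ppl p))); first exact: lab_lat.
  by rewrite pp_lat; exact: lab_lat.
have := hl (rshift n.+1 j) (mem_enum _ _); have := hr (rshift n.+1 j) (mem_enum _ _).
have := h j; rewrite /suffix_lab => ->.
rewrite (enormBC (lab (ppr p) _)) => h1 h2.
apply: (le_trans (enormB_le _ (lab (ppr p0) (rshift n.+1 j)) _)).
by move: r0; lra.
Qed.

Lemma prefix_translate x (xi : pat N) :
  prefix_pat (translate x xi) = translate x (prefix_pat xi).
Proof. exact: pattern_eq. Qed.

(** The spectators stay at distance 0 while the prefix moves within the range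
    of q. Continuity on the whole space holds since the condition on the
    suffixes is open and closed. *)
Lemma spectator_local : local_kernel spectator.
Proof.
have [cont inv _] := cq; have [_ _ [M MP]] := compact_kernel_local r0 cq; split.
- move=> p0; have c := continuous_comp (@prefix_pair_continuous p0) (cont _).
  have [s0|s0] := boolP (same_suffix p0).
    rewrite /continuous_at [X in _ --> X]/spectator s0.
    apply: (cvg_trans _ c); apply: (@near_eq_cvg _ _ (nbhs p0)).
    by apply: filterS (near_same_suffix p0) => p; rewrite /spectator => ->; rewrite s0.
  rewrite /continuous_at [X in _ --> X]/spectator (negPf s0).
  apply: (cvg_trans _ (@cvg_cst (R[i])^o 0 _ (nbhs p0) _)); apply: (@near_eq_cvg _ _ (nbhs p0)).
  by apply: filterS (near_same_suffix p0) => p; rewrite /spectator => ->; rewrite (negPf s0).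
- move=> x p; rewrite /spectator.
  have -> : same_suffix (ptranslate x p) = same_suffix p.
    by apply/asboolP/asboolP => h j; [apply: (addIr (- x)); exact: h|
      rewrite /suffix_lab /=; congr (_ - _); exact: h].
  by case: ifP => // _; rewrite -(inv x (prefix_pair p)); congr q; apply: pat_pair_eq;
    exact: prefix_translate.
exists (Num.max 0 M) => p; rewrite /spectator; case: ifP => // /asboolP ss /MP[h1 h2].
split=> i; rewrite -(splitK i); case: (fintype.split i) => j /=.
- by have [l hl] := h1 j; exists (lshift m l); rewrite le_max hl orbT.
- by exists (rshift n.+1 j); have := ss j; rewrite /suffix_lab => ->;
    rewrite subrr enorm0 le_max lexx.
- by have [l hl] := h2 j; exists (lshift m l); rewrite le_max hl orbT.
- by exists (rshift n.+1 j); have := ss j; rewrite /suffix_lab => ->;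
    rewrite subrr enorm0 le_max lexx.
Qed.

(** The sum over relabellings in theta, carried over from kets to kernels. *)
Definition lift_kernel (p : pat_pair N) : R[i] := n.+1`!%:R^-1 *
  \sum_(t : 'S_N) (prefix_weight R t * (-1) ^+ t) * spectator (prelabel 1%g t p).

Lemma lift_kernel_local : local_kernel lift_kernel.
Proof.
apply: local_kernelZ; apply: local_kernel_sum => t; apply: local_kernelZ.
exact: (local_kernel_relabel 1%g t spectator_local).
Qed.

Context (L : set E) (L_delone : delone r rho L).
Context (H : hilbertType R) (ket : pat N -> H).
Hypothesis ket_fermi : is_fermi_space L ket.
Local Notation patL := [set xi : pat N | lat xi = L].

(** A term of Q whose right half is the prefix of the relabelled xi
    corresponds to the pattern that replaces this prefix by the left half;
    terms for which there is no such pattern vanish by Pauli exclusion. *)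
Lemma glued_sum (xi : pat N) (t : 'S_N) : lat xi = L ->
  \sum_(p <- fset_set (touching L q (letters xi)) | prefix_matches (ppr p) xi t)
     q p *: glued_ket L ket (ppl p) (relabel t xi) =
  \sum_(eta \in patL) mat spectator eta (relabel t xi) *: ket eta.
Proof.
move=> xiL; set zeta := relabel t xi.
have fT := touching_finite r0 L_delone cq (letters xi).
pose f p := if prefix_matches (ppr p) xi t then q p *: glued_ket L ket (ppl p) zeta else 0.
rewrite big_mkcond /= -[LHS]/(\sum_(p <- _) f p) -fsbig_finite//.
pose D := [set eta : pat N | lat eta = L /\ mat spectator eta zeta <> 0].
have DP eta : D eta -> exists2 e : lat (prefix_pat eta) = lat (prefix_pat zeta),
    (forall j, suffix_lab eta j = suffix_lab zeta j) & q (mkp e) = mat spectator eta zeta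
      /\ q (mkp e) <> 0.
  move=> [eL]; have e : lat eta = lat zeta by rewrite eL.
  rewrite (mat_mkp _ e) /spectator; case: ifP => // /asboolP ss.
  have <- : @mkp _ _ _ _ _ (prefix_pat eta) (prefix_pat zeta) e = prefix_pair (mkp e).
    exact: pat_pair_eq.
  by move=> qe; exists e.
(* the term of Q that leads from the relabelled xi to eta *)
pose g (eta : pat N) : pat_pair n.+1 :=
  if pselect (lat (prefix_pat eta) = lat (prefix_pat zeta)) is left e then mkp e
  else mkp (erefl (lat (prefix_pat eta))).
have gE eta : D eta -> [/\ ppl (g eta) = prefix_pat eta,
    ppr (g eta) = prefix_pat zeta & q (g eta) = mat spectator eta zeta].
  move=> /DP[e _ [<- _]]; rewrite /g; case: pselect => // e'; split=> //.
  by congr q; apply: pat_pair_eq.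
have glueD eta : D eta -> glued_ket L ket (ppl (g eta)) zeta = ket eta.
  move=> De; have [e ss _] := DP _ De; have [gl _ _] := gE _ De.
  by apply: glued_ketE; split; rewrite ?gl //; case: De.
have fg eta : D eta -> f (g eta) = mat spectator eta zeta *: ket eta.
  move=> De; have [_ gr qg] := gE _ De; rewrite /f glueD// qg.
  by rewrite (_ : prefix_matches _ _ _ = true)//; apply/asboolP; rewrite gr.
have g_inj : set_inj D g.
  move=> e1 e2 /set_mem D1 /set_mem D2 e12.
  have [l1 _ _] := gE _ D1; have [l2 _ _] := gE _ D2.
  have [a1 s1 _] := DP _ D1; have [a2 s2 _] := DP _ D2.
  apply: split_eq; first by rewrite D1.1 D2.1.
    by rewrite -l1 e12.
  by move=> j; rewrite s1 s2.
have fD : finite_set D by exact: (local_support r0 L_delone spectator_local).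
transitivity (\sum_(p \in g @` D) f p).
  apply/esym/fsbig_widen.
    move=> _ [eta De <-]; have [gl gr qg] := gE _ De; split.
    - by rewrite gl /=; case: De.
    - by rewrite qg; case: De.
    - exists (lab (prefix_pat zeta) ord0); last by rewrite gr mem_letters orbT.
      exact: mem_letters.
  move=> p [[pL qp _] ng]; rewrite /= /f; case: ifP => // /asboolP pr.
  rewrite glued_ket0 ?scaler0// => -[eta [eL ep es]]; apply: ng.
  have De : D eta.
    split=> //; have e : lat eta = lat zeta by rewrite eL.
    rewrite (mat_mkp _ e) /spectator ifT; last by apply/asboolP => j; exact: es.
    rewrite (_ : prefix_pair _ = p)//; apply: pat_pair_eq; [exact: ep|by rewrite pr].
  by exists eta => //; have [gl gr _] := gE _ De; apply: pat_pair_eq; rewrite ?gl ?gr ?ep ?pr.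
rewrite (fsbig_image D g f g_inj).
transitivity (\sum_(eta \in D) mat spectator eta zeta *: ket eta).
  by apply: eq_fsbigr => eta /set_mem; exact: fg.
apply: fsbig_widen => [eta []//|eta [eL nD]].
by apply: contrapT => h; apply: nD; split=> //; exact: mat_scale_neq0 h.
Qed.

Lemma limit_column_lift (xi : pat N) : lat xi = L ->
  limit_column L q (@theta _ _ _ _ L _ _ _ ket) xi =
  \sum_(eta \in patL) mat lift_kernel eta xi *: ket eta.
Proof.
move=> xiL.
pose A := \bigcup_(t in [set: 'S_N]) [set eta : pat N | lat eta = L /\
  mat spectator eta (relabel t xi) <> 0].
have fA : finite_set A.
  apply: bigcup_finite => [|t _]; first exact: finite_finset.
  exact: (local_support r0 L_delone spectator_local).
have AL : A `<=` patL by move=> eta [t _ []].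
have matE eta : lat eta = L -> mat lift_kernel eta xi = n.+1`!%:R^-1 *
    \sum_(t : 'S_N) (prefix_weight R t * (-1) ^+ t) * mat spectator eta (relabel t xi).
  move=> eL; have e : lat eta = lat xi by rewrite eL xiL.
  rewrite (mat_mkp _ e); congr (_ * _); apply: eq_bigr => t _; congr (_ * _).
  have e' : lat eta = lat (relabel t xi) by [].
  rewrite (mat_mkp _ e'); congr spectator; apply: pat_pair_eq => //.
  exact: relabel1.
rewrite /limit_column /theta (@fsum_finite _ _ A)//; last first.
  move=> eta eL /mat_scale_neq0; rewrite matE// => h.
  apply: contrapT => nA; apply: h; rewrite big1 ?mulr0// => t _.
  suff -> : mat spectator eta (relabel t xi) = 0 by rewrite mulr0.
  by apply: contrapT => h; apply: nA; exists t.
under eq_bigr => p _ do rewrite scaler_sumr big_mkcond /=.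
rewrite exchange_big /=.
transitivity (n.+1`!%:R^-1 *: \sum_(t : 'S_N) (prefix_weight R t * (-1) ^+ t) *:
    \sum_(eta <- fset_set A) mat spectator eta (relabel t xi) *: ket eta).
  congr (_ *: _); apply: eq_bigr => t _.
  rewrite -big_mkcond /= -(@fsum_finite _ _ A patL)//; last first.
    by move=> eta eL /mat_scale_neq0 h; exists t.
  rewrite -(glued_sum t xiL) scaler_sumr; apply: eq_bigr => p _.
  by rewrite !scalerA -mulrA mulrC.
under [in LHS]eq_bigr => t _ do rewrite scaler_sumr.
rewrite exchange_big scaler_sumr; apply: eq_big_seq => eta.
rewrite in_fset_set// => /set_mem/AL eL; rewrite matE// -[RHS]scalerA; congr (_ *: _).
by rewrite scaler_suml; apply: eq_bigr => t _; rewrite scalerA.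
Qed.

End Lift.
End LocalKernels.

(** * Hamiltonians are multipliers *)

Section Hamiltonians.
Context (R : realType) (d : nat) (r rho : R).
Hypothesis r0 : 0 < r.
Local Notation E := 'rV[R]_d.
Local Notation pat n := (pattern d r rho n).
Local Notation pat_pair n := (@pat_pair R d r rho n).
Context (L : set E) (L_delone : delone r rho L).
Context (A : cstarAlgType R) (a : E -> A) (A_CAR : is_CAR a L).
Context (Lk : nat -> set E) (Lk_exhausts : exhausts L Lk).

Lemma G_alg_space n (H : hilbertType R) (ket : pat n -> H) :
  is_fermi_space L ket -> op_star_space (G_alg L ket).
Proof. by case: n ket => [|n] ket kf; [exact: scalar_space|exact: G_space]. Qed.

(** A derivation determines its implementer up to a scalar, and scalars are
    multipliers. *)
Lemma shifted_local_multiplier n (H : hilbertType R) (ket : pat n.+1 -> H)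
    (B : H -> H) (b : pat_pair n.+1 -> R[i]) (c : R[i]) :
  is_fermi_space L ket -> bounded_op B -> local_kernel b ->
  (forall xi, lat xi = L -> B (ket xi) =
    \sum_(eta \in [set eta : pat n.+1 | lat eta = L]) mat b eta xi *: ket eta +
    c *: ket xi) ->
  multipliers (G_alg L ket) B.
Proof.
move=> kf bB lb h; pose D (u : H) : H := (- c) *: id u + B u.
have bD : bounded_op D by apply: bounded_lin => //; exact: bounded_id.
have mD : multipliers (G_alg L ket) D.
  apply: (local_multiplier r0 L_delone kf bD lb) => xi xiL.
  by rewrite /D h// scaleNr addrC addrK.
have -> : B = fun u => c *: id u + D u.
  by apply/funext => u; rewrite /D scaleNr addrA subrr add0r.
have GP := G_alg_space kf.
exact: (mult_lin GP c (mult_id _) mD).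
Qed.

Lemma zero_local_kernel n : local_kernel (fun p : pat_pair n => 0 : R[i]).
Proof.
have <- : (fun p : pat_pair n => \sum_(i <- [::] : seq void) 0) = fun=> 0 :> R[i].
  by apply/funext => p; rewrite big_nil.
by apply: local_kernel_sum => -[].
Qed.

(** If Q annihilates more points than the sector has, no term acts and B is
    a scalar. Otherwise B is, up to a scalar, the operator of the lifted
    kernel. *)
Lemma generator_multiplier n (H : hilbertType R) (ket : pat n.+1 -> H) (B : H -> H) :
  is_fermi_space L ket -> H_generators L ket a Lk B ->
  multipliers (G_alg L ket) B.
Proof.
move=> kf [bB [k [q [delta [k0 qc [_ [pi piP dP]] dB]]]]].
case: k k0 q qc dP => // n' _ q qc dP.
have cq := coefficient_compact r0 qc.
have [nn|nn] := leqP n' n.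
  have nE : n = (n' + (n - n'))%N by rewrite subnKC.
  move: (n - n')%N nE => m nE; subst n.
  have thetaP : forall (p' : pat_pair n'.+1) (p : pat_pair (n'.+1 + m)),
      lat (ppl p') = L -> lat (ppl p) = L -> pi (monomial a p' * monomial a p) =
      ketbra (theta L (n := n'.+1) (m := m) ket p' (ppl p)) (ket (ppr p)).
    by move=> p' p; exact: (pi_theta (n := n'.+1) (m := m) (ket := ket) L_delone A_CAR kf piP).
  have theta0 : forall (p' : pat_pair n'.+1) (xi : pat (n'.+1 + m)),
      theta L (n := n'.+1) (m := m) ket p' xi <> 0 -> forall i, lab (ppr p') i \in letters xi.
    move=> p' xi t0 i; have [t /asboolP mt] : exists t, prefix_matches (ppr p') xi t.
      apply: contrapT => nt; apply: t0; rewrite /theta big1// => t mt.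
      by case: nt; exists t.
    by rewrite mt /=; exact: mem_letters.
  have [c h] := implementer_columns r0 L_delone A_CAR Lk_exhausts cq kf piP thetaP theta0 bB dP dB.
  apply: (shifted_local_multiplier kf bB (lift_kernel_local r0 m cq)) => xi xiL.
  by rewrite h// (limit_column_lift (n := n') (m := m) r0 cq L_delone).
have [p' p pL' pL||c h] := implementer_columns r0 L_delone A_CAR Lk_exhausts cq kf piP
    (theta := fun _ _ => 0) _ _ bB dP dB.
- have [i iN] : exists i, lab (ppr p') i \notin letters (ppl p).
    apply: contrapT => h; have : {subset letters (ppr p') <= letters (ppl p)}.
      move=> _ /mapP[i _ ->]; apply: contrapT => /negP iN; apply: h.
      by exists i.
    move/(uniq_leq_size (letters_uniq _)); rewrite !size_letters; lia.
  rewrite (pi_unmatched L_delone A_CAR piP pL' pL iN).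
  by apply/funext => u; rewrite /ketbra scaler0.
- by [].
apply: (shifted_local_multiplier (c := c) kf bB (@zero_local_kernel _)) => xi xiL.
rewrite h// /limit_column big1 => [|p _]; last by rewrite scaler0.
rewrite scaler0 fsbig1// => eta _.
by rewrite /mat; case: pselect; rewrite scale0r.
Qed.

Lemma H_alg_multipliers n (H : hilbertType R) (ket : pat n -> H) :
  is_fermi_space L ket -> H_alg L ket a Lk `<=` multipliers (G_alg L ket).
Proof.
case: n ket => [|n] ket kf B.
  move=> [c ->]; have S := scalar_space H.
  have -> : (fun u : H => c *: u) = fun u => (c - 1) *: id u + id u.
    by apply/funext => u; rewrite scalerBl scale1r subrK.
  by apply: (mult_lin S); exact: mult_id.
have GP := G_alg_space kf.
apply; first exact: mult_id.
- by move=> c S T; exact: mult_lin.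
- by move=> S T; exact: mult_comp.
- by move=> S; exact: generator_multiplier.
Qed.

(** The empty pattern gives a unit vector, so that the sums of the tower are
    nontrivial rings. *)
Lemma fermi_vacuum (H : hilbertType R) (ket : pat 0 -> H) :
  is_fermi_space L ket -> exists u : H, u <> 0.
Proof.
move=> kf; pose f (i : 'I_0) : E := 0.
have fi : injective f by case.
have fL i : L (f i) by case: i.
exists (ket (Pattern L_delone fi fL)) => e.
have := ket_norm kf (xi := Pattern L_delone fi fL) erefl.
by rewrite e inner0r => /eqP; rewrite eq_sym oner_eq0.
Qed.

End Hamiltonians.

Theorem theorem6p24 (R : realType) (d : nat) (r rho : R)
  (d_gt0 : (0 < d)%N) (r_gt0 : 0 < r) (r_lt_rho : r < rho)
  (L : set 'rV[R]_d) (L_delone : delone r rho L)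
  (* CAR(L), generated by the a x, and the finite sets exhausting L *)
  (A : cstarAlgType R) (a : 'rV[R]_d -> A) (A_CAR : is_CAR a L)
  (Lk : nat -> set 'rV[R]_d) (Lk_exhausts : exhausts L Lk)
  (* the antisymmetric sectors F N with their vectors |xi> *)
  (F : nat -> hilbertType R) (ket : forall N, pattern d r rho N -> F N)
  (F_fermi : forall N, is_fermi_space L (ket N)) :
  let Hn := fun N => H_alg L (ket N) a Lk in
  let MG := fun N => multipliers (G_alg L (ket N)) in
  (* the tower of the algebras B N = H_0 + ... + H_N, with limit dotH *)
  forall (B : nat -> algType R[i])
    (evB : forall N (n : 'I_N.+1), B N -> F n -> F n)
    (connB : forall N, {lrmorphism B N.+1 -> B N})
    (dotH : algType R[i]) (pB : forall N, {lrmorphism dotH -> B N}),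
  (forall N, is_op_sum Hn (evB N)) ->
  (forall N (n : 'I_N.+1) x,
     evB N n (connB N x) = evB N.+1 (widen_ord (leqnSn N.+1) n) x) ->
  is_algebra_limit connB pB ->
  (forall n, Hn n `<=` MG n) /\
  (* the tower of the C*-algebras C N = M(G_0) + ... + M(G_N) *)
  exists (C : nat -> cstarAlgType R)
    (evC : forall N (n : 'I_N.+1), C N -> F n -> F n)
    (connC : forall N, {lrmorphism C N.+1 -> C N}),
  [/\ forall N, is_cstar_sum MG (evC N),
      forall N (n : 'I_N.+1) x,
        evC N n (connC N x) = evC N.+1 (widen_ord (leqnSn N.+1) n) x,
      forall N, topstar_morphism (connC N) /\ (forall y, exists x, connC N x = y) &
  exists (X : topStarAlgType R) (pC : forall N, {lrmorphism X -> C N}),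
  [/\ @is_inverse_limit R (fun N => C N : topStarAlgType R) connC X pC,
      pro_cstar X &
  (* embedding of the towers, and the induced morphism of the limits *)
  exists (emb : forall N, {lrmorphism B N -> C N})
    (j : {lrmorphism dotH -> X}),
  [/\ forall N (n : 'I_N.+1) x, evC N n (emb N x) = evB N n x,
      forall N, injective (emb N),
      forall N x, connC N (emb N.+1 x) = emb N (connB N x),
      forall N x, pC N (j x) = emb N (pB N x) &
      injective j]]].
Proof.
move=> Hn MG B evB connB dotH pB sumB evB_conn limB.
have HM n : Hn n `<=` MG n by exact: (H_alg_multipliers r_gt0 L_delone A_CAR Lk_exhausts).
split=> //.
pose S n : star_ops (F n) := mult_star_ops (G_alg_space r_gt0 L_delone (F_fermi n)).
have F0 := fermi_vacuum L_delone (F_fermi 0%N).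
exists (fun N => opsum S F0 N), (@evS _ _ S F0), (conn S F0); split.
- exact: opsum_cstar_sum.
- by move=> N n x; rewrite connE.
- by move=> N; split; [exact: conn_topstar|exact: conn_surj].
exists (oplim S F0), (plim S F0); split.
- exact: oplim_inverse_limit.
- exact: opprod_pro_cstar.
exact: (@tower_embedding _ _ S F0 Hn HM B evB connB dotH pB sumB evB_conn limB).
Qed.
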